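(* Let $\Sigma \subset \mathbb{R}^{2,1}$ be a connected regular lightlike surface of constant type. Then, up to a Minkowski isometry $\varphi(\mathbf{x}) = A\mathbf{x}+\mathbf{b}$ with $A \in O(2,1)$, $\mathbf{b} \in \mathbb{R}^{2,1}$, one of the following holds: (i) $\Sigma$ is contained in a lightlike plane in $\mathbb{R}^{2,1}$; (ii) $\Sigma$ is contained in a lightlike cone in $\mathbb{R}^{2,1}$; or (iii) $\Sigma$ is locally parametrized by $$\mathbf{x}(u,v) = e^u G_0(v) - \int_0^v G_0(\tau)\, d\tau - G_0(0),$$ where $f(v)$ is a smooth real-valued function on an open interval $I \ni 0$ and $G_0 : I \to \mathbb{R}^{2,1}$ is the unique solution of the linear ODE $$G_0'''(v) - 2 f(v) G_0'(v) - f'(v) G_0(v) = 0$$ with initial conditions $$G_0(0) = \frac{1}{\sqrt{2}}\begin{bmatrix} 1 \\ 1 \\ 0 \end{bmatrix}, \qquad G_0'(0) = \begin{bmatrix} \frac{1}{\sqrt{2}} \\ \frac{1}{\sqrt{2}} \\ 1 \end{bmatrix}, \qquad G_0''(0) = \begin{bmatrix} \frac{1}{\sqrt{2}}\left(f(0) + \frac{3}{2}\right) \\ \frac{1}{\sqrt{2}}\left(f(0) - \frac{1}{2}\right) \\ 1 \end{bmatrix}.$$ That is, for every point $p \in \Sigma$ there exist an open neighborhood $U \subset \Sigma$ of $p$, a Minkowski isometry $\varphi$, a smooth real-valued function $f$ on an open interval $I \ni 0$ and an open set $W \subset \mathbb{R} \times I$ such that the map $\mathbf{x}(u,v) = e^u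 G_0(v) - \int_0^v G_0(\tau)\, d\tau - G_0(0)$, with $G_0$ the unique solution on $I$ of $G_0''' - 2 f G_0' - f' G_0 = 0$ with the initial values $G_0(0)$, $G_0'(0)$, $G_0''(0)$ displayed in (iii), restricts to a regular parametrization of $\varphi(U)$ on $W$. In (iii) the function $f$ is arbitrary: for every smooth real-valued $f$ on an open interval $I \ni 0$, the map $\mathbf{x}(u,v) = e^u G_0(v) - \int_0^v G_0(\tau)\, d\tau - G_0(0)$ on $\mathbb{R} \times I$, with $G_0$ the unique solution on $I$ of $G_0''' - 2 f G_0' - f' G_0 = 0$ with the initial values $G_0(0)$, $G_0'(0)$, $G_0''(0)$ displayed in (iii), is locally a parametrization of a non-conical lightlike surface.
   Context: All objects are smooth ($C^\infty$). $\mathbb{R}^{2,1}$ denotes $\mathbb{R}^3$ with coordinates $(x^0,x^1,x^2)$ (written as column vectors) and with the indefinite inner product $\langle \mathbf{v},\mathbf{w}\rangle = -v^0w^0+v^1w^1+v^2w^2$ on each tangent space. $O(2,1)$ is the group of linear maps preserving $\langle\cdot,\cdot\rangle$. A nonzero vector $\mathbf{v}$ is null (lightlike) if $\langle \mathbf{v},\mathbf{v}\rangle=0$. A regular surface $\Sigma \subset \mathbb{R}^{2,1}$ is lightlike if the restriction of $\langle\cdot,\cdot\rangle$ to each tangent plane $T_{\mathbf{x}}\Sigma$ is degenerate. A lightlike plane is an affine plane that is a lightlike surface; the lightlike cone based at $\mathbf{p}$ is $\{\mathbf{x} : \langle \mathbf{x}-\mathbf{p},\mathbf{x}-\mathbf{p}\rangle=0\}$.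 Adapted frames. Let $\Sigma$ be a lightlike surface. A 0-adapted frame on (an open subset of) $\Sigma$ is a smooth choice of basis $(\mathbf{e}_0,\mathbf{e}_1,\mathbf{e}_2)$ of $\mathbb{R}^{2,1}$ at each point $\mathbf{x}$ such that $\mathbf{e}_0,\mathbf{e}_1$ span $T_{\mathbf{x}}\Sigma$, $\langle \mathbf{e}_0,\mathbf{e}_0\rangle=\langle \mathbf{e}_0,\mathbf{e}_1\rangle=\langle \mathbf{e}_1,\mathbf{e}_2\rangle=\langle \mathbf{e}_2,\mathbf{e}_2\rangle=0$ and $\langle \mathbf{e}_0,\mathbf{e}_2\rangle=\langle \mathbf{e}_1,\mathbf{e}_1\rangle=1$. Its Maurer-Cartan forms are the 1-forms $\omega^\alpha,\omega^\alpha_\beta$ ($0\le\alpha,\beta\le 2$) on $\Sigma$ defined by $d\mathbf{x}=\sum_\alpha \mathbf{e}_\alpha\omega^\alpha$ and $d\mathbf{e}_\beta=\sum_\alpha \mathbf{e}_\alpha\omega^\alpha_\beta$. One has $\omega^2=0$, and $\omega^0,\omega^1$ form a coframe on $\Sigma$. For every 0-adapted frame there is a function $a_1$ with $\omega^1_0=a_1\omega^1$; whether $a_1$ vanishes at a point does not depend on the 0-adapted frame chosen. If $a_1$ is nowhere zero, a 0-adapted frame with $a_1\equiv 1$ is called 1-adapted (such frames exist locally). For every 1-adapted frame there is a function $a_2$ with $\omega^0_0-\omega^0=a_2\omega^1$; whether $a_2$ vanishes at a point does not depend on the 1-adapted frame chosen. $\Sigma$ is of constant type if either $a_1$ is identically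 zero on $\Sigma$, or $a_1$ is nowhere zero on $\Sigma$ and $a_2$ is either identically zero or nowhere zero on $\Sigma$. $\Sigma$ is called non-conical if $a_1$ and $a_2$ are both nowhere zero. *)

(* Defs.v *)
From mathcomp Require Import all_boot all_order all_algebra.
From mathcomp Require Import all_classical all_reals all_analysis.
Set Implicit Arguments.
Unset Strict Implicit.
Unset Printing Implicit Defensive.
Import Order.TTheory GRing.Theory Num.Theory.
Import numFieldNormedType.Exports.
Local Open Scope classical_set_scope.
Local Open Scope ring_scope.

(* Only meaningful for [U] open: ['D_v f] at a point of an open [U] depends on
   the values of [f] on [U] only. *)
Fixpoint class_C (R : realType) (V W : normedModType R) (k : nat)
    (U : set V) (f : V -> W) : Prop :=
  match k with
  | 0 => forall x, U x -> {for x, continuous f}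
  | k'.+1 => (forall x, U x -> differentiable f x) /\
             (forall v, class_C k' U ('D_v f))
  end.

Definition smooth_on (R : realType) (V W : normedModType R)
    (U : set V) (f : V -> W) : Prop := forall k, class_C k U f.

Section Minkowski.
Variable R : realType.

Definition col3 (a b c : R) : 'cV[R]_3 := \col_i [:: a; b; c]`_i.

Definition mdot (v w : 'cV[R]_3) : R :=
  - (v 0 0 * w 0 0) + v 1 0 * w 1 0 + v 2 0 * w 2 0.

Definition O21 (A : 'M[R]_3) : Prop :=
  forall v w, mdot (A *m v) (A *m w) = mdot v w.

Definition mink_isometry (phi : 'cV[R]_3 -> 'cV[R]_3) : Prop :=
  exists A b, O21 A /\ phi = (fun x => A *m x + b).

(* [X] restricted to [W] is a smooth injective immersion that is a
   homeomorphism onto its image, and this image is [S]. *)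
Definition regular_parametrization (W : set (R * R)) (X : R * R -> 'cV[R]_3)
    (S : set 'cV[R]_3) : Prop :=
  [/\ open W, smooth_on W X, X @` W = S,
      (forall q, W q -> injective ('d X q)) &
      exists g : 'cV[R]_3 -> R * R,
        (forall q, W q -> g (X q) = q) /\ {within S, continuous g}].

Definition open_in (S O : set 'cV[R]_3) : Prop :=
  exists2 V : set 'cV[R]_3, open V & O = V `&` S.

Definition chart (S : set 'cV[R]_3) (U : set (R * R))
    (X : R * R -> 'cV[R]_3) : Prop :=
  open_in S (X @` U) /\ regular_parametrization U X (X @` U).

Definition regular_surface (S : set 'cV[R]_3) : Prop :=
  forall p, S p -> exists U X, chart S U X /\ (X @` U) p.

Definition tangent (S : set 'cV[R]_3) (p : 'cV[R]_3) : set 'cV[R]_3 :=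
  [set w | exists U X q h, [/\ chart S U X, U q, X q = p & w = 'd X q h]].

Definition lightlike_surface (S : set 'cV[R]_3) : Prop :=
  regular_surface S /\
  forall p, S p -> exists n, [/\ tangent S p n, n != 0 &
                                 forall w, tangent S p w -> mdot n w = 0].

Definition affine_plane (P : set 'cV[R]_3) : Prop :=
  exists p a b : 'cV[R]_3,
    (forall s t : R, s *: a + t *: b = 0 -> s = 0 /\ t = 0) /\
    P = [set x | exists s t : R, x = p + s *: a + t *: b].

Definition lightlike_plane (P : set 'cV[R]_3) : Prop :=
  affine_plane P /\ lightlike_surface P.

Definition lightlike_cone (p : 'cV[R]_3) : set 'cV[R]_3 :=
  [set x | mdot (x - p) (x - p) = 0].

(* [F] need only be meaningful on [O]; smoothness and differentials of maps
   on a surface are read in charts, and do not depend on the chart. *)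
Definition smooth_on_surface (V : normedModType R) (S O : set 'cV[R]_3)
    (F : 'cV[R]_3 -> V) : Prop :=
  forall p, O p -> exists U X,
    [/\ chart S U X, (X @` U) p, X @` U `<=` O & smooth_on U (F \o X)].

Definition surface_diff (V : normedModType R) (S : set 'cV[R]_3)
    (F : 'cV[R]_3 -> V) (p w : 'cV[R]_3) : V :=
  xget 0 [set z | exists U X q h,
    [/\ chart S U X /\ U q, X q = p, 'd X q h = w,
        differentiable (F \o X) q & z = 'd (F \o X) q h]].

(* A frame field is a matrix-valued map whose columns are e_0, e_1, e_2. *)
Definition adapted0 (S O : set 'cV[R]_3) (E : 'cV[R]_3 -> 'M[R]_3) : Prop :=
  [/\ open_in S O, smooth_on_surface S O E &
      forall p, O p ->
        let e i := col i (E p) in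
        [/\ E p \in unitmx,
            tangent S p = [set w | exists a b : R, w = a *: e 0 + b *: e 1],
            [/\ mdot (e 0) (e 0) = 0, mdot (e 0) (e 1) = 0,
                mdot (e 1) (e 2) = 0 & mdot (e 2) (e 2) = 0],
            mdot (e 0) (e 2) = 1 & mdot (e 1) (e 1) = 1]].

(* Maurer-Cartan forms: dx = E omega and dE = E Omega as matrix identities,
   evaluated on a tangent vector [w] at [p]; [mc2 S E a b] is the form with
   upper index [a] and lower index [b]. *)
Definition mc1 (E : 'cV[R]_3 -> 'M[R]_3) (a : 'I_3) (p w : 'cV[R]_3) : R :=
  (invmx (E p) *m w) a 0.

Definition mc2 (S : set 'cV[R]_3) (E : 'cV[R]_3 -> 'M[R]_3) (a b : 'I_3)
    (p w : 'cV[R]_3) : R :=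
  (invmx (E p) *m surface_diff S E p w) a b.

Definition is_a1 (S O : set 'cV[R]_3) (E : 'cV[R]_3 -> 'M[R]_3)
    (a : 'cV[R]_3 -> R) : Prop :=
  forall p w, O p -> tangent S p w -> mc2 S E 1 0 p w = a p * mc1 E 1 p w.

Definition is_a2 (S O : set 'cV[R]_3) (E : 'cV[R]_3 -> 'M[R]_3)
    (a : 'cV[R]_3 -> R) : Prop :=
  forall p w, O p -> tangent S p w ->
    mc2 S E 0 0 p w - mc1 E 0 p w = a p * mc1 E 1 p w.

Definition adapted1 (S O : set 'cV[R]_3) (E : 'cV[R]_3 -> 'M[R]_3) : Prop :=
  adapted0 S O E /\ is_a1 S O E (fun=> 1).

(* Vanishing of a_1 (a_2) at a point does not depend on the 0-adapted
   (1-adapted) frame, and such frames exist locally, the 1-adapted ones when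
   a_1 is nowhere zero; hence the quantification over all local frames. *)
Definition a1_zero (S : set 'cV[R]_3) : Prop :=
  forall O E, adapted0 S O E -> is_a1 S O E (fun=> 0).

Definition a1_nowhere_zero (S : set 'cV[R]_3) : Prop :=
  forall O E, adapted0 S O E ->
    exists2 a, is_a1 S O E a & forall p, O p -> a p != 0.

Definition a2_zero (S : set 'cV[R]_3) : Prop :=
  forall O E, adapted1 S O E -> is_a2 S O E (fun=> 0).

Definition a2_nowhere_zero (S : set 'cV[R]_3) : Prop :=
  forall O E, adapted1 S O E ->
    exists2 a, is_a2 S O E a & forall p, O p -> a p != 0.

Definition constant_type (S : set 'cV[R]_3) : Prop :=
  a1_zero S \/ (a1_nowhere_zero S /\ (a2_zero S \/ a2_nowhere_zero S)).

Definition non_conical (S : set 'cV[R]_3) : Prop :=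
  a1_nowhere_zero S /\ a2_nowhere_zero S.

Definition is_solution (f : R -> R) (I : set R) (G : R -> 'cV[R]_3) : Prop :=
  let s : R := (Num.sqrt 2)^-1 in
  [/\ forall k v, (k < 3)%N -> I v -> derivable (derive1n k G) v 1,
      forall v, I v ->
        derive1n 3 G v - (2 * f v) *: derive1 G v - derive1 f v *: G v = 0,
      G 0 = s *: col3 1 1 0,
      derive1 G 0 = col3 s s 1 &
      derive1n 2 G 0 = col3 (s * (f 0 + 3 / 2)) (s * (f 0 - 1 / 2)) 1].

Definition unique_solution (f : R -> R) (I : set R) (G : R -> 'cV[R]_3) :
    Prop :=
  is_solution f I G /\
  forall H, is_solution f I H -> forall v, I v -> H v = G v.

Definition open_interval0 (I : set R) : Prop :=
  [/\ open I, is_interval I & I 0].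

Definition oriented_integral (g : R -> R) (a b : R) : R :=
  if a <= b then \int[lebesgue_measure]_(t in `[a, b]) g t
  else - \int[lebesgue_measure]_(t in `[b, a]) g t.

Definition surface_map (G : R -> 'cV[R]_3) (q : R * R) : 'cV[R]_3 :=
  expR q.1 *: G q.2
    - \col_i oriented_integral (fun t => G t i 0) 0 q.2
    - G 0.

End Minkowski.

(* Main.v *)
Require Import Defs.
From HB Require Import structures.
From mathcomp Require Import all_boot all_order all_algebra.
From mathcomp Require Import all_classical all_reals all_analysis.
From mathcomp Require Import ring lra.
Import Order.TTheory GRing.Theory Num.Theory.
Import numFieldNormedType.Exports.
Set Implicit Arguments.
Unset Strict Implicit.
Unset Printing Implicit Defensive.
Local Open Scope classical_set_scope.
Local Open Scope ring_scope.

(** A lightlike surface is ruled by null lines, and the theorem reads off how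
    these lines fit together. Each tangent plane is the orthogonal complement
    of the null line it contains; let [N] be the null tangent vector with time
    component 1 ([nhat]). It can only turn in the spacelike tangent direction,
    and [a_1] is the rate at which it does ([null_field_derivative]). If [a_1]
    vanishes, [N] is constant and the surface lies in a null plane
    ([plane_case]).

    If [a_1] has no zeros, consider the edge [y = x - N / a_1]. Its displacement
    is along [N] ([edge_derivative]) and is measured by [a_2] ([a2_chart]). If
    [a_2] vanishes, [y] is constant and the surface lies in the light cone with
    vertex [y] ([cone_case]).

    If [a_2] has no zeros either, then [s = 1 / a_1] and [t = x^0 - s] are local
    coordinates in which [N] and [y] depend on [t] alone. The surface is the
    tangent developable [x = Y(t) + s n(t)] of the null curve [Y], with [Y' = n]
    ([tangent_developable]). In the pseudo-arclength parameter
    ([pseudo_arclength]) the velocity of [Y] is [-G], where [G] runs on the light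
    cone with unit speed. The inner products of [G], [G'], [G''] are then known
    except for [mdot G'' G'' = - 2 f], and differentiating them gives the
    third-order equation ([null_curve_third]). A Lorentz transformation arranges
    the initial values ([normal_position]), and [s] becomes a multiple of [exp u]
    ([normal_parametrization]).

    Conversely, the third-order equation is the symmetric square of
    [y'' = (f / 2) y], so its solution is a quadratic expression in two solutions
    of the latter ([null_curve_exists]); it is unique because the equation has a
    conserved bilinear concomitant ([null_curve_unique]). On the resulting
    surface every adapted frame has [e_0] proportional to [G], which makes [a_1]
    and [a_2] explicit and nonzero ([developable_non_conical]).

    The analysis behind this is the inverse function theorem in the plane
    ([inverse_function]), the differentiability of continuous lifts through
    immersions ([is_diff_lift]), on which the independence of charts rests
    ([chart_lift]), and the solution of linear second-order equations by Picard
    iteration ([linear_ode2]). *)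

Section Calculus.
Context {R : realType}.
Implicit Types V W : normedModType R.

(** * Differentials of maps known near a point *)

(** The epsilon form of differentiability and its converse, for remainder
    estimates that involve a second map. *)
Lemma diff_eps V W (f : V -> W) x : differentiable f x ->
  forall e, 0 < e -> \forall h \near 0,
    `|f (h + x) - f x - 'd f x h| <= e * `|h|.
Proof.
move=> /diff_locallyP[_ /eqaddoP H] e e0.
have := H _ e0; apply: filter_app; near=> h.
by rewrite /= fctE opprD addrA.
Unshelve. all: by end_near. Qed.

Lemma eps_diff V W (f : V -> W) x (L : {linear V -> W}) : continuous L ->
  (forall e, 0 < e -> \forall h \near 0,
    `|f (h + x) - f x - L h| <= e * `|h|) -> is_diff x f L.
Proof.
move=> cL H.
have HL : f \o shift x = cst (f x) + L +o_ 0 id.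
  apply/eqaddoP => e e0; have := H _ e0; apply: filter_app; near=> h.
  by rewrite /= fctE opprD addrA.
have E := diff_unique cL HL.
split => //; apply/diff_locallyP; rewrite E; by split.
Unshelve. all: by end_near. Qed.

(** Maps on a surface and lifts through charts are known only near a point,
    so differentials have to be compared along germs. *)
Lemma near_eq_diff V W (f g : V -> W) x : (\near x, f x = g x) ->
  differentiable f x -> is_diff x g ('d f x).
Proof.
move=> fg df; apply: eps_diff; first exact: diff_continuous.
move=> e e0; have := diff_eps df e0; apply: filter_app.
have fgx := nbhs_singleton fg.
have : \forall h \near (0:V), f (h + x) = g (h + x).
  have : (fun h : V => h + x) @ 0 --> x.
    rewrite -[X in _ --> X]add0r; apply: cvgD; [exact: cvg_id|exact: cvg_cst].
  by move=> /(_ _ fg).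
by apply: filter_app; near=> h => -> ; rewrite fgx.
Unshelve. all: by end_near. Qed.

Lemma near_eq_differentiable V W (f g : V -> W) x : (\near x, f x = g x) ->
  differentiable f x -> differentiable g x.
Proof. by move=> fg df; have [] := near_eq_diff fg df. Qed.

Lemma near_eq_diffE V W (f g : V -> W) x : (\near x, f x = g x) ->
  differentiable f x -> 'd g x = 'd f x :> (V -> W).
Proof. by move=> fg df; have [] := near_eq_diff fg df. Qed.

Lemma near_open V (U : set V) (P : V -> Prop) x : open U -> U x ->
  (forall y, U y -> P y) -> \near x, P x.
Proof. by move=> oU Ux H; apply: filterS (open_nbhs_nbhs (conj oU Ux)). Qed.

(** * Closure properties of the classes of differentiability *)

Lemma class_C_ext k V W (U : set V) (f g : V -> W) : open U ->
  (forall x, U x -> f x = g x) -> class_C k U f -> class_C k U g.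
Proof.
move=> oU; elim: k f g => [|k IH] f g fg /=.
  move=> Hf x Ux; rewrite /prop_for /continuous_at -(fg _ Ux).
  apply: cvg_trans (Hf x Ux); apply: near_eq_cvg.
  by apply: (@near_open _ U).
case=> df H; have n x : U x -> \near x, f x = g x by move=> Ux; apply: (@near_open _ U).
split=> [x Ux|v]; first by apply: near_eq_differentiable (df x Ux); exact: n.
apply: IH (H v) => x Ux; rewrite (deriveE _ (df _ Ux)).
rewrite (deriveE _ (near_eq_differentiable (n x Ux) (df x Ux))).
exact: (esym (f_equal (fun L => L v) (near_eq_diffE (n x Ux) (df x Ux)))).
Qed.

Lemma class_C_pred k V W (U : set V) (f : V -> W) : class_C k.+1 U f -> class_C k U f.
Proof.
elim: k f => [|k IH] f /= [df H].
  by move=> x Ux; apply: differentiable_continuous; exact: df.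
by split=> // v; apply: IH; exact: H.
Qed.

Lemma class_C_sub k V W (U U' : set V) (f : V -> W) : U' `<=` U ->
  class_C k U f -> class_C k U' f.
Proof.
move=> UU'; elim: k f => [|k IH] f /=; first by move=> H x /UU'; exact: H.
by case=> df H; split=> [x /UU'|v]; [exact: df|exact/IH/H].
Qed.

Lemma class_C_cst k V W (U : set V) (c : W) : class_C k U (fun _ : V => c).
Proof.
elim: k c => [|k IH] c /=; first by move=> x _; exact: cst_continuous.
split=> // v; rewrite (_ : 'D_v _ = fun=> 0)//.
by apply/funext => x; rewrite derive_cst.
Qed.

Lemma class_CD k V W (U : set V) (f g : V -> W) : open U ->
  class_C k U f -> class_C k U g -> class_C k U (fun x => f x + g x).
Proof.
move=> oU; elim: k f g => [|k IH] f g /=.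
  by move=> Hf Hg x Ux; apply: cvgD; [exact: Hf|exact: Hg].
move=> [df Hf] [dg Hg]; split=> [x Ux|v].
  by apply: differentiableD; [exact: df|exact: dg].
apply: class_C_ext (IH _ _ (Hf v) (Hg v)) => // x Ux.
by rewrite -deriveD//; apply: diff_derivable; [exact: df|exact: dg].
Qed.

(** Postcomposition with a continuous linear map commutes with all
    directional derivatives. *)
Lemma class_C_lin k V W W' (U : set V) (L : {linear W -> W'}) (f : V -> W) :
  open U -> continuous L -> class_C k U f -> class_C k U (L \o f).
Proof.
move=> oU cL; elim: k f => [|k IH] f /=.
  by move=> Hf x Ux; apply: continuous_comp; [exact: Hf|exact: cL].
move=> [df Hf].
have dLf x : U x -> differentiable (L \o f) x.
  by move=> Ux; apply: differentiable_comp; [exact: df|exact: linear_differentiable].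
split=> // v; apply: class_C_ext (IH _ (Hf v)) => // x Ux.
rewrite /= (deriveE _ (df _ Ux)) (deriveE _ (dLf _ Ux)).
rewrite (diff_comp (df _ Ux) (linear_differentiable _ cL)).
by rewrite /= diff_lin.
Qed.

Lemma scaler_is_bilinear W : bilinear_for
    (GRing.Scale.Law.clone _ _ *:%R _) (GRing.Scale.Law.clone _ _ *:%R _)
    (@GRing.scale R W).
Proof.
split=> [u'|u] a x y /=.
- by rewrite scalerDl scalerA.
- by rewrite scalerDr !scalerA mulrC.
Qed.
HB.instance Definition _ W := bilinear_isBilinear.Build R R W W _ _
  (@GRing.scale R W) (scaler_is_bilinear W).

Lemma is_diff_scale V W (k : V -> R) (f : V -> W) x :
  differentiable k x -> differentiable f x ->
  is_diff x (fun y => k y *: f y) (fun h => k x *: 'd f x h + 'd k x h *: f x).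
Proof.
move=> dk df.
have c : continuous (fun p : R * W => p.1 *: p.2) by move=> p; exact: scale_continuous.
have E := @diff_bilin _ _ _ _ (@GRing.scale R W) (k x, f x) c.
have D := @differentiable_bilin _ _ _ _ (@GRing.scale R W) (k x, f x) c.
have dp : differentiable (fun y => (k y, f y)) x by exact: differentiable_pair.
split.
  exact: (@differentiable_comp _ _ _ _ (fun y => (k y, f y)) (fun p => p.1 *: p.2)).
rewrite (@diff_comp _ _ _ _ (fun y => (k y, f y)) (fun p : R * W => p.1 *: p.2))// E.
by rewrite diff_pair.
Qed.

Lemma class_CZ k V W (U : set V) (f : V -> R) (g : V -> W) : open U ->
  class_C k U f -> class_C k U g -> class_C k U (fun x => f x *: g x).
Proof.
move=> oU; elim: k f g => [|k IH] f g.
  by move=> Hf Hg x Ux; apply: cvgZ; [exact: Hf|exact: Hg].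
move=> Cf Cg; have Pf := class_C_pred Cf; have Pg := class_C_pred Cg.
case: Cf Cg => df Hf [dg Hg].
have D x (Ux : U x) := is_diff_scale (df x Ux) (dg x Ux).
split=> [x Ux|v]; first by have [] := D x Ux.
apply: class_C_ext (class_CD oU (IH _ _ Pf (Hg v)) (IH _ _ (Hf v) Pg)) => // x Ux.
have [d1 d2] := D x Ux.
rewrite (deriveE _ (dg x Ux)) (deriveE _ (df x Ux)) (deriveE _ d1).
exact: (esym (f_equal (fun L => L v) d2)).
Qed.

Lemma class_CM k V (U : set V) (f g : V -> R) : open U ->
  class_C k U f -> class_C k U g -> class_C k U (fun x => f x * g x).
Proof. exact: class_CZ. Qed.

Lemma class_CN k V W (U : set V) (f : V -> W) : open U ->
  class_C k U f -> class_C k U (fun x => - f x).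
Proof.
move=> oU Cf; apply: class_C_ext (class_CZ oU (class_C_cst k U (-1:R)) Cf) => //.
by move=> x _; rewrite scaleN1r.
Qed.

Lemma class_CB k V W (U : set V) (f g : V -> W) : open U ->
  class_C k U f -> class_C k U g -> class_C k U (fun x => f x - g x).
Proof. by move=> oU Cf Cg; apply: class_CD => //; exact: class_CN. Qed.

Lemma class_C_linear k V W (U : set V) (L : {linear V -> W}) :
  continuous L -> class_C k U L.
Proof.
move=> cL; case: k => [|k]; first by move=> x _; exact: cL.
split=> [x _|v]; first exact: linear_differentiable.
rewrite (_ : 'D_v L = fun=> L v); first exact: class_C_cst.
by apply/funext => x; rewrite deriveE ?diff_lin//; exact: linear_differentiable.
Qed.

Lemma linear_scalar W (L : {linear R -> W}) v : L v = v *: L 1.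
Proof. by rewrite -linearZ /= -[v *: 1]/(v * 1) mulr1. Qed.

(** With one outer variable the derivative of the composite is a product, to
    which the induction applies. *)
Lemma class_C_comp k V W (U : set V) (J : set R) (f : V -> R) (g : R -> W) :
  open U -> (forall x, U x -> J (f x)) ->
  class_C k U f -> class_C k J g -> class_C k U (g \o f).
Proof.
move=> oU UJ; elim: k g f UJ => [|k IH] g f UJ.
  by move=> Hf Hg x Ux; apply: continuous_comp; [exact: Hf|apply: Hg; exact: UJ].
move=> Cf Cg; have Pf := class_C_pred Cf; have Pg := class_C_pred Cg.
case: Cf Cg => df Hf [dg Hg].
have dgf x : U x -> differentiable (g \o f) x.
  by move=> Ux; apply: differentiable_comp; [exact: df|apply: dg; exact: UJ].
split=> // v; apply: class_C_ext (class_CZ oU (Hf v) (IH _ _ UJ Pf (Hg 1))) => // x Ux.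
have dfx := df _ Ux; have dgx := dg _ (UJ _ Ux).
rewrite /= (deriveE _ dfx) (deriveE _ dgx) (deriveE _ (dgf _ Ux)) (diff_comp dfx dgx) /=.
by rewrite -linear_scalar.
Qed.

(** All directional derivatives are multiples of the one in direction 1. *)
Lemma class_C_derive1 k W (J : set R) (g g' : R -> W) : open J ->
  (forall x, J x -> is_derive x 1 g (g' x)) -> class_C k J g' -> class_C k.+1 J g.
Proof.
move=> oJ H Cg'.
have dg x : J x -> differentiable g x.
  by move=> Jx; apply/derivable1_diffP; have [] := H x Jx.
split=> // v; apply: class_C_ext (class_CZ oJ (class_C_cst k J (v:R)) Cg') => // x Jx.
rewrite deriveE; last exact: dg.
have [_ <-] := H x Jx; rewrite deriveE; last exact: dg.
by rewrite -linear_scalar.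
Qed.

Lemma class_C_inv k V (U : set V) (f : V -> R) : open U ->
  (forall x, U x -> f x != 0) -> class_C k U f -> class_C k U (fun x => (f x)^-1).
Proof.
move=> oU f0 Cf.
have oJ : open [set x : R | x != 0] by exact: open_neq.
suff H : class_C k [set x : R | x != 0] (fun x => x^-1).
  exact: (@class_C_comp k V R U _ f _ oU f0 Cf H).
elim: k {Cf} => [|k IH]; first by move=> x; exact: inv_continuous.
apply: (@class_C_derive1 _ _ _ _ (fun x => - (x^-1 * x^-1))) => //.

  move=> x /= x0; have := @is_deriveV R id x 1 1 x0 (is_derive_id _ _).
  move=> D; rewrite (_ : - _ = (- x ^- 2) *: (1 : R)) //.
  by rewrite -[_ *: _]/(_ * _) mulr1 -exprVn expr2.
by apply: class_CN => //; exact: class_CM.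
Qed.

Lemma class_C_sqrt k V (U : set V) (f : V -> R) : open U ->
  (forall x, U x -> 0 < f x) -> class_C k U f -> class_C k U (fun x => Num.sqrt (f x)).
Proof.
move=> oU f0 Cf.
have oJ : open [set x : R | 0 < x] by exact: open_gt.
suff H : class_C k [set x : R | 0 < x] (@Num.sqrt R).
  exact: (@class_C_comp k V R U _ f _ oU f0 Cf H).
elim: k {Cf} => [|k IH]; first by move=> x _; exact: sqrt_continuous.
apply: (@class_C_derive1 _ _ _ _ (fun x => (2 * Num.sqrt x)^-1)) => //.
apply: class_C_inv => //; first by move=> x /= x0; rewrite mulf_neq0 ?sqrtr_eq0// -ltNge.
by apply: class_CM => //; exact: class_C_cst.
Qed.

Lemma class_C_expR k V (U : set V) (f : V -> R) : open U ->
  class_C k U f -> class_C k U (fun x => expR (f x)).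
Proof.
move=> oU Cf.
suff H : class_C k [set: R] (@expR R) by exact: (@class_C_comp k V R U _ f _ oU _ Cf H).
elim: k {Cf} => [|k IH]; first by move=> x _; exact: continuous_expR.
by apply: (@class_C_derive1 _ _ _ _ (@expR R)) => //; exact: openT.
Qed.

(** ** Matrix-valued maps *)

Definition entry m n (i : 'I_m) (j : 'I_n) (M : 'M[R]_(m, n)) : R := M i j.

Lemma entry_is_linear m n i j : linear (@entry m n i j).
Proof. by move=> a M N; rewrite /entry !mxE. Qed.
HB.instance Definition _ m n i j := GRing.isLinear.Build R 'M[R]_(m, n) R _
  (@entry m n i j) (@entry_is_linear m n i j).

Lemma entry_continuous m n i j : continuous (@entry m.+1 n.+1 i j).
Proof. exact: coord_continuous. Qed.

Lemma class_C_entry k V m n (U : set V) (F : V -> 'M[R]_(m.+1, n.+1)) i j :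
  open U -> class_C k U F -> class_C k U (fun x => F x i j).
Proof.
move=> oU CF; apply: (@class_C_lin k V _ R U (@entry _ _ i j)) => //.
exact: entry_continuous.
Qed.

Lemma class_C_sum k V W (U : set V) (I : Type) (r : seq I) (F : I -> V -> W) :
  open U -> (forall i, class_C k U (F i)) -> class_C k U (fun x => \sum_(i <- r) F i x).
Proof.
move=> oU CF; elim: r => [|i r IH].
  by apply: class_C_ext (class_C_cst k U 0) => // x _; rewrite big_nil.
by apply: class_C_ext (class_CD oU (CF i) IH) => // x _; rewrite big_cons.
Qed.

Lemma class_C_mx k V m n (U : set V) (F : V -> 'M[R]_(m.+1, n.+1)) : open U ->
  (forall i j, class_C k U (fun x => F x i j)) -> class_C k U F.
Proof.
move=> oU CF.
have H : class_C k U (fun x => \sum_i \sum_j F x i j *: (delta_mx i j : 'M[R]_(m.+1, n.+1))).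
  do 2! (apply: class_C_sum => // ?).
  by apply: class_CZ => //; exact: class_C_cst.
by apply: class_C_ext H => // x _; rewrite [RHS]matrix_sum_delta.
Qed.

(** ** Pointwise differentials *)

Lemma diffD_fun V W (f g : V -> W) x h : differentiable f x -> differentiable g x ->
  'd (fun y => f y + g y) x h = 'd f x h + 'd g x h.
Proof. by move=> df dg; have := diffD df dg => /(f_equal (fun L => L h)). Qed.

Lemma diffB_fun V W (f g : V -> W) x h : differentiable f x -> differentiable g x ->
  'd (fun y => f y - g y) x h = 'd f x h - 'd g x h.
Proof. by move=> df dg; have := diffB df dg => /(f_equal (fun L => L h)). Qed.

Lemma diffZ_fun V W (f : V -> R) (g : V -> W) x h :
  differentiable f x -> differentiable g x ->
  'd (fun y => f y *: g y) x h = f x *: 'd g x h + 'd f x h *: g x.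
Proof. by move=> df dg; have [_ /(f_equal (fun L => L h))] := is_diff_scale df dg. Qed.

Lemma diffM_fun V (f g : V -> R) x h :
  differentiable f x -> differentiable g x ->
  'd (fun y => f y * g y) x h = f x * 'd g x h + 'd f x h * g x.
Proof. exact: diffZ_fun. Qed.

Lemma diff_cst_fun V W (c : W) (x h : V) : 'd (fun=> c) x h = 0.
Proof. by have := diff_cst c x => /(f_equal (fun L => L h)). Qed.

Lemma diff_comp_fun (A : normedModType R) V W (f : A -> V) (g : V -> W) x h :
  differentiable f x -> differentiable g (f x) ->
  'd (fun y => g (f y)) x h = 'd g (f x) ('d f x h).
Proof. by move=> df dg; have := diff_comp df dg => /(f_equal (fun L => L h)). Qed.

Lemma diff_lin_fun V W (L : {linear V -> W}) x h : continuous L -> 'd L x h = L h.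
Proof. by move=> cL; have := diff_lin x cL => /(f_equal (fun L => L h)). Qed.

Lemma diff_affine V W (L : {linear V -> W}) (c : W) x h : continuous L ->
  'd (fun y => c + L y) x h = L h.
Proof.
move=> cL; rewrite diffD_fun//; last exact: linear_differentiable.
by rewrite diff_cst_fun add0r diff_lin_fun.
Qed.

Lemma diff_id_sub V (f : V -> V) x h : differentiable f x ->
  'd (fun y => y - f y) x h = h - 'd f x h.
Proof.
move=> df; have cid : continuous (idfun : V -> V) by move=> y; exact: cvg_id.
rewrite diffB_fun//.
by congr (_ - _); exact: (@diff_lin_fun _ _ idfun).
Qed.

Lemma diff_entry V m n (F : V -> 'M[R]_(m.+1, n.+1)) i j x h :
  differentiable F x -> 'd (fun y => F y i j) x h = ('d F x h) i j.
Proof.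
move=> dF; have := @diff_comp_fun _ _ _ F (@entry _ _ i j) x h dF.
move=> ->; last by apply: linear_differentiable; exact: entry_continuous.
by rewrite diff_lin_fun//; exact: entry_continuous.
Qed.

Lemma differentiable_entry V m n (F : V -> 'M[R]_(m.+1, n.+1)) i j x :
  differentiable F x -> differentiable (fun y => F y i j) x.
Proof.
move=> dF; apply: (@differentiable_comp _ _ _ _ F (@entry _ _ i j)) => //.
by apply: linear_differentiable; exact: entry_continuous.
Qed.

(** * Mean value estimates and the inverse function theorem in the plane *)

Lemma is_diff_segment V (x y : V) (t : R) :
  is_diff t (fun s : R => x + s *: (y - x)) (fun s => s *: (y - x)).
Proof.
have d1 : differentiable (cst x : R -> V) t by [].
have d2 := is_diff_scalel t (y - x).
by apply: is_diff_eq; apply/funext => s; rewrite !fctE add0r.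
Qed.

Lemma mean_value V (F : V -> R) (x y : V) :
  (forall t : R, 0 <= t <= 1 -> differentiable F (x + t *: (y - x))) ->
  exists2 t : R, 0 <= t <= 1 & F y - F x = 'd F (x + t *: (y - x)) (y - x).
Proof.
move=> dF; pose g (t : R) := x + t *: (y - x).
have D (t : R) : 0 <= t <= 1 -> is_diff t (F \o g) (fun s => s *: 'd F (g t) (y - x)).
  move=> t01; have [dg eg] := is_diff_segment x y t.
  split; first by apply: differentiable_comp => //; exact: dF.
  rewrite diff_comp//; last exact: dF.
  by apply/funext => s; rewrite /= eg linearZ.
have := @MVT R (F \o g) (fun t => 'd F (g t) (y - x)) 0 1 ltr01.
case=> [t /[!in_itv]/= /andP[t0 t1]||c /[!in_itv]/= /andP[c0 c1]].
- have /D[d e] : 0 <= t <= 1 by rewrite !ltW.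
  split; first exact: diff_derivable.
  by rewrite deriveE// e scale1r.
- apply: continuous_in_subspaceT => t /[!inE]/= /[!in_itv]/= t01.
  by apply: differentiable_continuous; have [] := D t t01.
- rewrite /g /= scale0r scale1r addr0 (addrC x) subrK subr0 mulr1 => ->.
  by exists c => //; rewrite !ltW.
Qed.

Lemma ball_convex V (q : V) r x y (t : R) : ball q r x -> ball q r y -> 0 <= t <= 1 ->
  ball q r (x + t *: (y - x)).
Proof.
rewrite -!ball_normE /= => bx by_ /andP[t0 t1].
have -> : q - (x + t *: (y - x)) = (1 - t) *: (q - x) + t *: (q - y).
  rewrite !scalerBr !scalerBl !scale1r; set a := t *: q; set b := t *: x.
  rewrite opprD !opprB [RHS]addrACA [RHS]addrC !addrA subrK.
  by rewrite [LHS](ACl (3*2*4*1))%AC.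
apply: (le_lt_trans (ler_normD _ _)); rewrite !normrZ (ger0_norm t0) ger0_norm ?subr_ge0//.
have [->|tn0] := eqVneq t 0; first by rewrite subr0 mul1r mul0r addr0.
have tp : 0 < t by rewrite lt_def tn0.
have : t * `|q - y| < t * r by rewrite ltr_pM2l.
have : (1 - t) * `|q - x| <= (1 - t) * r by rewrite ler_wpM2l ?subr_ge0// ltW.
lra.
Qed.

Lemma zero_diff_const V (F : V -> R) (q : V) r :
  (forall x, ball q r x -> differentiable F x) ->
  (forall x, ball q r x -> forall h, 'd F x h = 0) ->
  forall x y, ball q r x -> ball q r y -> F x = F y.
Proof.
move=> dF F0 x y bx by_; apply/esym/eqP; rewrite -subr_eq0.
have [t t01|t t01 ->] := @mean_value _ F x y.
  by apply: dF; exact: ball_convex.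
by rewrite F0//; exact: ball_convex.
Qed.

Lemma norm_prod_le (x : R * R) e : (`|x| <= e) = (`|x.1| <= e) && (`|x.2| <= e).
Proof. by rewrite prod_normE ge_max. Qed.

Lemma compact_square (q : R * R) r : compact [set x : R * R | `|x - q| <= r].
Proof.
have -> : [set x : R * R | `|x - q| <= r] =
    `[q.1 - r, q.1 + r]%classic `*` `[q.2 - r, q.2 + r]%classic.
  apply/seteqP; split => -[x y] /=; rewrite norm_prod_le /= !in_itv /=.
    by rewrite !ler_norml => /andP[/andP[? ?] /andP[? ?]]; split; apply/andP; split; lra.
  by move=> [/andP[? ?] /andP[? ?]]; rewrite !ler_norml; apply/andP; split; apply/andP; split; lra.
by apply: compact_setX; exact: segment_compact.
Qed.

(** A contraction of a compact square has a fixed point: a minimum of the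
    displacement is moved to a smaller one unless it vanishes. *)
Lemma square_fixpoint (T : R * R -> R * R) (q : R * R) r : 0 <= r ->
  (forall x, `|x - q| <= r -> `|T x - q| <= r) ->
  (forall x y, `|x - q| <= r -> `|y - q| <= r -> `|T x - T y| <= 2^-1 * `|x - y|) ->
  exists2 x, `|x - q| <= r & T x = x.
Proof.
move=> r0 TK TL; pose K := [set x : R * R | `|x - q| <= r].
have Kq : K !=set0 by exists q; rewrite /K /= subrr normr0.
have cT : {within K, continuous (fun x => `|T x - x|)}.
  have cT : {within K, continuous T}.
    apply/subspace_continuousP => x Kx; apply/cvgrPdist_le => e e0.
    rewrite near_withinE; near=> y; move=> Ky.
    apply: le_trans (TL _ _ Kx Ky) _.
    rewrite ler_pdivrMl//; apply: (@le_trans _ _ e); last by lra.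
    near: y; apply/nbhs_ballP; exists e => //= y.
    by rewrite -ball_normE /= => /ltW.
  move=> x; apply: cvg_norm; apply: cvgB; first exact: cT.
  exact: (@continuous_subspaceT _ _ K id (fun y => cvg_id)).
have [x Kx xmin] := compact_EVT_min Kq (@compact_square q r) cT.
exists x; first by rewrite inE in Kx.
rewrite inE in Kx.
have := xmin (T x); rewrite inE => /(_ (TK _ Kx)).
move=> /le_trans /(_ (TL _ _ (TK _ Kx) Kx)) h.
apply/eqP; rewrite -subr_eq0 -normr_le0; lra.
Unshelve. all: by end_near. Qed.

(** Solving [P x = y] is finding a fixed point of [x |-> H x + y], a
    contraction of a small square. *)
Lemma perturbed_id_open (P H : R * R -> R * R) (q : R * R) d :
  (forall x, P x = x - H x) ->
  (forall x y, ball q d x -> ball q d y -> `|H x - H y| <= 2^-1 * `|x - y|) ->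
  open (P @` ball q d).
Proof.
move=> PE HL; rewrite openE => _ [x0 bx0 <-].
have : nbhs x0 (ball q d) by apply: open_nbhs_nbhs; split => //; exact: ball_open.
move=> /nbhs_ballP[r /= r0 br].
(* The fixed point is sought in the square of radius r / 2: the center moves by
   at most r / 4, and distances to it are halved. *)
apply/nbhs_ballP; exists (r / 4); first by rewrite /= divr_gt0.
move=> y; rewrite -ball_normE /= => ylt.
have inB x : `|x - x0| <= r / 2 -> ball q d x.
  move=> xr; apply: br; rewrite -ball_normE /= distrC.
  by apply: le_lt_trans xr _; rewrite ltr_pdivrMr// mulr_natr mulr2n ltrDl.
have [|x xr|x1 x2 x1r x2r|x xr xe] := @square_fixpoint (fun x => H x + y) x0 (r / 2).
- by rewrite divr_ge0// ltW.
- have -> : H x + y - x0 = (H x - H x0) - (P x0 - y).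
    by rewrite PE !opprB addrA [_ - _ + y]addrAC [RHS]addrA subrK.
  apply: (le_trans (ler_normB _ _)).
  have := HL _ _ (inB _ xr) bx0; lra.
- rewrite opprD addrACA subrr addr0; apply: HL; exact: inB.
- exists x; first by have := inB _ xr; rewrite -ball_normE.
  by rewrite PE -{1}xe addrAC subrr add0r.
Qed.

Local Notation R2 := (R * R)%type.

Lemma scaleE (a b : R) : a *: b = a * b. Proof. by []. Qed.

Lemma linear_planeE W (T : {linear R2 -> W}) h :
  T h = h.1 *: T (1, 0) + h.2 *: T (0, 1).
Proof.
rewrite -!linearZ -linearD; congr (T _); case: h => a b.
by congr (_, _); rewrite /= !scaleE !mulr1 !mulr0 ?addr0 ?add0r.
Qed.

Lemma det_neq0 (T : {linear R2 -> R2}) : injective T ->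
  (T (1, 0)).1 * (T (0, 1)).2 - (T (1, 0)).2 * (T (0, 1)).1 != 0.
Proof.
move=> Tinj; set a := T (1, 0); set b := T (0, 1); apply/eqP => d0.
have T0 h : h.1 *: a + h.2 *: b = 0 -> h = 0.
  by rewrite -linear_planeE => h0; apply: Tinj; rewrite h0 linear0.
have h1 : (b.2, - a.2) = 0 :> R * R.
  apply: T0 => /=; congr (_, _) => /=; rewrite !scaleE; lra.
have h2 : (b.1, - a.1) = 0 :> R * R.
  apply: T0 => /=; congr (_, _) => /=; rewrite !scaleE; lra.
case: h1 h2 => b2 /eqP + [b1 /eqP]; rewrite !oppr_eq0 => /eqP a2 /eqP a1.
have : (1, 0) = 0 :> R * R.
  by apply: T0 => /=; rewrite scale0r addr0 scale1r; case: (a) a1 a2 => /= ? ? -> ->.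
by case=> /eqP; rewrite oner_eq0.
Qed.

Lemma continuous_at_pair (T U V : topologicalType) (f : T -> U) (g : T -> V) x :
  {for x, continuous f} -> {for x, continuous g} ->
  {for x, continuous (fun y => (f y, g y))}.
Proof. by move=> cf cg; exact: cvg_pair. Qed.

Lemma plane_left_inverse (T : {linear R2 -> R2}) : injective T ->
  exists L : {linear R2 -> R2},
    [/\ continuous L, injective L & forall h, L (T h) = h].
Proof.
move=> Tinj; have := det_neq0 Tinj.
set a := T (1, 0); set b := T (0, 1); set d := _ - _ => d0.
pose f (y : R * R) : R * R := (d^-1 * (b.2 * y.1 - b.1 * y.2), d^-1 * (a.1 * y.2 - a.2 * y.1)).
have lf : linear f.
  by move=> k x y; congr (_, _); rewrite /= !scaleE; ring.
pose fM := GRing.isLinear.Build _ _ _ _ _ lf.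
pose L : {linear _ -> _} := HB.pack f fM.
exists L; split.
- suff cf : continuous f by exact: cf.
  move=> y; apply: (@continuous_at_pair _ _ _ (fun y => d^-1 * (b.2 * y.1 - b.1 * y.2))
    (fun y => d^-1 * (a.1 * y.2 - a.2 * y.1))); apply: cvgM; try exact: cvg_cst;
  apply: cvgB; apply: cvgM; try exact: cvg_cst; solve [exact: cvg_fst|exact: cvg_snd].
- move=> x y /=; rewrite /L /= /f => -[/(mulfI (invr_neq0 d0)) e1 /(mulfI (invr_neq0 d0)) e2].
  have E1 : d * (x.1 - y.1) = 0.
    have -> : d * (x.1 - y.1) = a.1 * (b.2 * x.1 - b.1 * x.2 - (b.2 * y.1 - b.1 * y.2))
        + b.1 * (a.1 * x.2 - a.2 * x.1 - (a.1 * y.2 - a.2 * y.1)) by rewrite /d; ring.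
    by rewrite e1 e2 !subrr !mulr0 addr0.
  have E2 : d * (x.2 - y.2) = 0.
    have -> : d * (x.2 - y.2) = a.2 * (b.2 * x.1 - b.1 * x.2 - (b.2 * y.1 - b.1 * y.2))
        + b.2 * (a.1 * x.2 - a.2 * x.1 - (a.1 * y.2 - a.2 * y.1)) by rewrite /d; ring.
    by rewrite e1 e2 !subrr !mulr0 addr0.
  move/eqP: E1; rewrite mulf_eq0 (negbTE d0) /= subr_eq0 => /eqP E1.
  move/eqP: E2; rewrite mulf_eq0 (negbTE d0) /= subr_eq0 => /eqP E2.
  by case: x y E1 E2 {e1 e2} => ? ? [? ?] /= -> ->.
- move=> h; rewrite [T h]linear_planeE -/a -/b /L /= /f; case: h => u v /=.
  by congr (_, _); rewrite !scaleE /d; field; exact: d0.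
Qed.

Lemma quarter_sum (u v w : R) : u <= w * 4^-1 -> v <= w * 4^-1 -> u + v <= 2^-1 * w.
Proof. by move=> *; lra. Qed.

(** Where the partial derivatives are below one quarter, the mean value
    theorem makes both components contract by one half. *)
Lemma small_diff_lipschitz (H : R * R -> R * R) (U : set (R * R)) q : open U -> U q ->
  class_C 1 U H -> (forall h, 'd H q h = 0) ->
  exists2 d : R, 0 < d & ball q d `<=` U /\
    forall x y, ball q d x -> ball q d y -> `|H x - H y| <= 2^-1 * `|x - y|.
Proof.
move=> oU Uq CH dH0.
have Dcvg v : `|'D_v H x| @[x --> q] --> 0.
  rewrite -(normr0 (R * R)%type) -(dH0 v) -deriveE; last by apply: CH.1.
  by apply: cvg_norm; exact: (CH.2 v q Uq).
have small v : \forall x \near q, `|'D_v H x| < 4^-1.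
  by have /cvgr_lt := Dcvg v; apply; rewrite invr_gt0.
have : nbhs q (U `&` ([set x | `|'D_(1, 0) H x| < 4^-1] `&`
    [set x | `|'D_(0, 1) H x| < 4^-1])).
  apply: filterI; first exact: open_nbhs_nbhs.
  by apply: filterI; exact: small.
move=> /nbhs_ballP[d /= d0 Hd]; exists d => //; split; first by move=> x /Hd[].
have dH x : ball q d x -> differentiable H x by move=> /Hd[Ux _]; exact: CH.1.
have bd x h : ball q d x -> `|'d H x h| <= 2^-1 * `|h|.
  move=> bx; have [Ux [h1 h2]] := Hd _ bx; rewrite linear_planeE.
  apply: (le_trans (ler_normD _ _)); rewrite !normrZ.
  rewrite -!deriveE; try exact: dH.
  have : `|h.1| <= `|h| /\ `|h.2| <= `|h| by apply/andP; rewrite -norm_prod_le.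
  case=> k1 k2.
  have a1 := ler_pM (normr_ge0 _) (normr_ge0 _) k1 (ltW h1).
  have a2 := ler_pM (normr_ge0 _) (normr_ge0 _) k2 (ltW h2).
  exact: quarter_sum a1 a2.
have comp (p : {linear R2 -> R}) : continuous p -> (forall x, `|p x| <= `|x|) ->
   forall x y, ball q d x -> ball q d y -> `|p (H x) - p (H y)| <= 2^-1 * `|x - y|.
  move=> cp ple x y bx by_.
  have dpH z : ball q d z -> differentiable (p \o H) z.
    move=> bz; apply: differentiable_comp; first exact: dH.
    exact: linear_differentiable.
  have [t t01|t t01 E] := @mean_value _ (p \o H) y x.
    by apply: dpH; exact: ball_convex.
  have bz : ball q d (y + t *: (x - y)) by exact: ball_convex.
  rewrite [_ - _]E diff_comp; [|exact: dH|exact: linear_differentiable].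
  by rewrite /= diff_lin//; apply: (le_trans (ple _)); exact: bd.
move=> x y bx by_; rewrite norm_prod_le; apply/andP; split.
  apply: (comp fst) => // [z|z]; first exact: cvg_fst.
  by have := lexx `|z|; rewrite {1}norm_prod_le => /andP[].
apply: (comp snd) => // [z|z]; first exact: cvg_snd.
by have := lexx `|z|; rewrite {1}norm_prod_le => /andP[].
Unshelve. all: by end_near. Qed.

(** The inverse function theorem, with a continuous inverse; its
    differentiability is a case of [is_diff_lift]. *)
Lemma inverse_function (F : R2 -> R2) (U : set R2) q : open U -> U q ->
  class_C 1 U F -> injective ('d F q) ->
  exists2 d : R, 0 < d & [/\ ball q d `<=` U, open (F @` ball q d) &
    exists g : R2 -> R2, forall x, ball q d x -> g (F x) = x /\ {for F x, continuous g}].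
Proof.
move=> oU Uq CF Finj; have [L [cL Linj LF]] := plane_left_inverse Finj.
have cid : continuous (idfun : R2 -> R2) by move=> x; exact: cvg_id.
have CLF : class_C 1 U (L \o F) by exact: class_C_lin.
pose H x := x - L (F x).
have CH : class_C 1 U H.
  apply: (class_CB oU _ CLF).
  exact: (@class_C_linear 1 R2 R2 U idfun cid).
have dFq : differentiable F q by exact: CF.1.
have dLq : differentiable L (F q) by exact: linear_differentiable.
have dH0 h : 'd H q h = 0.
  apply: (etrans (diff_id_sub h (CLF.1 q Uq))).
  by rewrite (diff_comp_fun h dFq dLq) diff_lin_fun// LF subrr.
have [d d0 [BU HL]] := small_diff_lipschitz oU Uq CH dH0.
have PE x : (L \o F) x = x - H x by rewrite /H opprB addrC subrK.
have oP := perturbed_id_open PE HL.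
have lip x y : ball q d x -> ball q d y -> `|x - y| <= 2 * `|L (F x) - L (F y)|.
  move=> bx by_; have h := HL _ _ bx by_.
  have E : x - y = (L (F x) - L (F y)) + (H x - H y).
    by rewrite /H opprB [RHS](AC (2*(2*2)) ((3*6)*(1*4)*(5*2)))%AC/= !subrr !addr0.
  have := ler_normD (L (F x) - L (F y)) (H x - H y); rewrite -E; lra.
have oF : open (F @` ball q d).
  have -> : F @` ball q d = L @^-1` ((L \o F) @` ball q d).
    apply/seteqP; split => [_ [x bx <-]|y [x bx /= /Linj <-]]; last by exists x.
    by exists x.
  by apply: open_comp => // y _; exact: cL.
exists d => //; split=> //.
pose g y := xget q [set x | ball q d x /\ F x = y].
have gF x : ball q d x -> g (F x) = x.
  move=> bx; rewrite /g; case: xgetP => [z _ [bz zE]|/(_ x)]; last by case.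
  apply/eqP; rewrite -subr_eq0 -normr_le0; have := lip _ _ bz bx.
  by rewrite zE subrr normr0 mulr0.
exists g => x bx; split; first exact: gF.
apply/cvgrPdist_le => e e0; rewrite gF//.
have cLx : \forall y \near F x, `|L (F x) - L y| < e / 2.
  have /cvgrPdist_lt := cL (F x); apply; exact: divr_gt0.
have n : nbhs (F x) ((F @` ball q d) `&` [set y | `|L (F x) - L y| < e / 2]).
  by apply: filterI => //; apply: open_nbhs_nbhs; split => //; exists x.
apply: (filterS _ n) => _ [[z bz <-]] /= /ltW hz; rewrite gF//.
apply: (le_trans (lip _ _ bx bz)).
by rewrite -ler_pdivlMl// mulrC.
Qed.

(** A continuous lift [t] of a differentiable map [Z] through a map [X] whose
    differential has a left inverse is differentiable: the increment of [t] is
    controlled by that of [Z], so the remainder of [X] is negligible. *)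
Lemma is_diff_lift V W (A : normedModType R) (X : A -> W) (Z : V -> W) (t : V -> A) (z : V)
    (L : {linear W -> A}) :
  differentiable X (t z) -> continuous L -> (forall h, L ('d X (t z) h) = h) ->
  differentiable Z z -> {for z, continuous t} ->
  (\forall y \near z, X (t y) = Z y) -> is_diff z t (L \o 'd Z z).
Proof.
move=> dX cL LX dZ ct XZ.
have [K K0 LK] := linear_lipschitz cL.
have cdZ : continuous ('d Z z) by exact: diff_continuous.
have [M M0 ZM] := linear_lipschitz cdZ.
have cLZ : continuous (L \o 'd Z z).
  by move=> x; apply: continuous_comp; [exact: cdZ|exact: cL].
apply: eps_diff => // e e0.
pose e2 := Num.min 1 (e / 2 / K).
pose e1 := Num.min (2^-1 / K) (e / 2 / (K * (2 * K * (M + 1)))).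
have M1 : 0 < M + 1 by exact: addr_gt0.
have e2p : 0 < e2 by rewrite lt_min ltr01 !divr_gt0.
have e1p : 0 < e1 by rewrite lt_min !divr_gt0// ?invr_gt0// !mulr_gt0.
have Xz : X (t z) = Z z by exact: (nbhs_singleton XZ).
have sh0 : (fun h : V => h + z) @ 0 --> z.
  rewrite -[X in _ --> X]add0r; apply: cvgD; [exact: cvg_id|exact: cvg_cst].
have n1 : \forall h \near (0:V), X (t (h + z)) = Z (h + z) by exact: (sh0 _ XZ).
have n2 : \forall h \near (0:V), `|Z (h + z) - Z z - 'd Z z h| <= e2 * `|h|.
  exact: diff_eps.
have n3 : \forall h \near (0:V), `|X (t (h + z)) - X (t z) - 'd X (t z) (t (h + z) - t z)|
    <= e1 * `|t (h + z) - t z|.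
  have tc : (fun h : V => t (h + z) - t z) @ 0 --> (0 : A).
    rewrite -[X in _ --> X](subrr (t z)); apply: cvgB; last exact: cvg_cst.
    exact: (cvg_comp _ _ sh0 ct).
  have H3 : \forall h \near (0:V), `|X (t (h + z) - t z + t z) - X (t z) -
      'd X (t z) (t (h + z) - t z)| <= e1 * `|t (h + z) - t z|.
    exact: tc _ (diff_eps dX e1p).
  by apply: filterS H3 => h /=; rewrite subrK.
near=> h.
have h1 : X (t (h + z)) = Z (h + z) by near: h; exact: n1.
have h2 : `|Z (h + z) - Z z - 'd Z z h| <= e2 * `|h| by near: h; exact: n2.
have : `|X (t (h + z)) - X (t z) - 'd X (t z) (t (h + z) - t z)|
    <= e1 * `|t (h + z) - t z| by near: h; exact: n3.
rewrite Xz h1; set k := t (h + z) - t z => h3.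
have kE : k = L ('d Z z h) + L (Z (h + z) - Z z - 'd Z z h) - L (Z (h + z) - Z z - 'd X (t z) k).
  by rewrite -linearD -linearB (addrC ('d Z z h)) subrK opprB addrC subrK LX.
have E : k - (L \o 'd Z z) h =
    L (Z (h + z) - Z z - 'd Z z h) - L (Z (h + z) - Z z - 'd X (t z) k).
  by rewrite {1}kE /= -!addrA addrC -!addrA addNr addr0.
have b2 := le_trans (LK _) (ler_wpM2l (ltW K0) h2).
have b3 := le_trans (LK _) (ler_wpM2l (ltW K0) h3).
have b1 := le_trans (LK _) (ler_wpM2l (ltW K0) (ZM h)).
have kle : `|k| <= K * (M * `|h|) + K * (e2 * `|h|) + K * (e1 * `|k|).
  rewrite {1}kE; apply: (le_trans (ler_normB _ _)); apply: lerD => //.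
  by apply: (le_trans (ler_normD _ _)); exact: lerD.
rewrite E; apply: (le_trans (ler_normB _ _)); apply: (le_trans (lerD b2 b3)).
move: kle; have := normr_ge0 h; have := normr_ge0 k.
move: `|k| `|h| => u v u0 v0 kle {E kE b1 b2 b3 h1 h2 h3 k}.
have Ke1 : K * e1 <= 2^-1 by rewrite -ler_pdivlMl// mulrC ge_min lexx.
have Ke2 : K * e2 <= e / 2 by rewrite -ler_pdivlMl// mulrC ge_min lexx orbT.
have e21 : e2 <= 1 by rewrite ge_min lexx.
have Ke1' : (K * (2 * K * (M + 1))) * e1 <= e / 2.
  by rewrite -ler_pdivlMl ?mulr_gt0// mulrC ge_min lexx orbT.
have u1 : K * e1 * u <= 2^-1 * u by rewrite ler_wpM2r.
have u2 : K * (e2 * v) <= K * v by rewrite ler_wpM2l ?(ltW K0)// ler_piMl.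
have ule : u <= 2 * K * (M + 1) * v by move: kle; rewrite (mulrA K e1 u); lra.
have u3 : K * (e1 * u) <= (e / 2) * v.
  apply: (@le_trans _ _ (K * (e1 * (2 * K * (M + 1) * v)))).
    by rewrite !ler_wpM2l// ltW.
  rewrite (_ : K * _ = (K * (2 * K * (M + 1))) * e1 * v); last by ring.
  by rewrite ler_wpM2r.
have u4 : K * (e2 * v) <= (e / 2) * v by rewrite mulrA ler_wpM2r.
lra.
Unshelve. all: by end_near. Qed.

(** * Charts, tangent planes and differentials on a surface *)

Local Notation V3 := 'cV[R]_3.

Implicit Types (S : set V3) (U : set R2) (X : R2 -> V3) (q : R2).

Lemma ord3_ind (P : 'I_3 -> Prop) : P 0 -> P 1 -> P 2 -> forall k, P k.
Proof.
move=> P0 P1 P2 [[|[|[|//]]] klt].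
- by rewrite (_ : Ordinal klt = 0)//; exact: val_inj.
- by rewrite (_ : Ordinal klt = 1)//; exact: val_inj.
- by rewrite (_ : Ordinal klt = 2)//; exact: val_inj.
Qed.

Lemma cV3P (v w : V3) : v 0 0 = w 0 0 -> v 1 0 = w 1 0 -> v 2 0 = w 2 0 -> v = w.
Proof. by move=> e0 e1 e2; apply/matrixP => + j; rewrite ord1; exact: ord3_ind. Qed.

Lemma col3E (a b c : R) :
  (col3 a b c 0 0 = a) * (col3 a b c 1 0 = b) * (col3 a b c 2 0 = c).
Proof. by rewrite /col3 !mxE. Qed.

Lemma linear_form_continuous (a b c : R) :
  continuous (fun w : V3 => a * w 0 0 + b * w 1 0 + c * w 2 0).
Proof.
have ce (k : R) (i : 'I_3) : continuous (fun w : V3 => k * w i 0).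
  move=> w; apply: (@cvgM _ _ (nbhs w) _ (fun=> k) (fun w : V3 => w i 0)); first exact: cvg_cst.
  exact: coord_continuous.
move=> w; apply: (@cvgD _ _ _ (nbhs w) _ (fun w : V3 => a * w 0 0 + b * w 1 0) (fun w : V3 => c * w 2 0)).
  apply: (@cvgD _ _ _ (nbhs w) _ (fun w : V3 => a * w 0 0) (fun w : V3 => b * w 1 0)); exact: ce.
exact: ce.
Qed.

(** The Euclidean cross product with the sign of the time component reversed:
    it is Minkowski-orthogonal to both factors. *)
Definition mcross (a b : V3) : V3 :=
  col3 (- (a 1 0 * b 2 0 - a 2 0 * b 1 0)) (a 2 0 * b 0 0 - a 0 0 * b 2 0)
       (a 0 0 * b 1 0 - a 1 0 * b 0 0).

Lemma mcross_neq0 (T : {linear R2 -> V3}) : injective T ->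
  mcross (T (1, 0)) (T (0, 1)) != 0.
Proof.
move=> Tinj; set a := T (1, 0); set b := T (0, 1); apply/eqP => c0.
have z0 : a 1 0 * b 2 0 - a 2 0 * b 1 0 = 0.
  by have := f_equal (fun v : V3 => v 0 0) c0; rewrite /mcross !col3E mxE; lra.
have z1 : a 2 0 * b 0 0 - a 0 0 * b 2 0 = 0.
  by have := f_equal (fun v : V3 => v 1 0) c0; rewrite /mcross !col3E mxE.
have z2 : a 0 0 * b 1 0 - a 1 0 * b 0 0 = 0.
  by have := f_equal (fun v : V3 => v 2 0) c0; rewrite /mcross !col3E mxE.
have T0 (i : 'I_3) : (b i 0, - a i 0) = 0 :> R2.
  apply: Tinj; rewrite linear_planeE linear0 -/a -/b /=.
  have /andP[/eqP i0 /andP[/eqP i1 /eqP i2]] : [&& b i 0 * a 0 0 - a i 0 * b 0 0 == 0,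
     b i 0 * a 1 0 - a i 0 * b 1 0 == 0 & b i 0 * a 2 0 - a i 0 * b 2 0 == 0].
    by move: i; apply: ord3_ind; apply/and3P; split; apply/eqP; lra.
  by apply: cV3P; rewrite !mxE mulNr.
have a0 : a = 0.
  apply: cV3P; rewrite [RHS]mxE; apply/eqP; rewrite -oppr_eq0; apply/eqP.
  - by have := T0 0; case.
  - by have := T0 1; case.
  - by have := T0 2; case.
have /Tinj : T (1, 0) = T 0 by rewrite linear0.
by case=> /eqP; rewrite oner_eq0.
Qed.

(** Coordinates in the image plane, after projection along the Euclidean
    normal. *)
Lemma space_left_inverse (T : {linear R2 -> V3}) : injective T ->
  exists2 L : {linear V3 -> R2}, continuous L & forall h, L (T h) = h.
Proof.
move=> Tinj; have := mcross_neq0 Tinj; set a := T (1, 0); set b := T (0, 1) => cab.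
pose c0 := a 1 0 * b 2 0 - a 2 0 * b 1 0.
pose c1 := a 2 0 * b 0 0 - a 0 0 * b 2 0.
pose c2 := a 0 0 * b 1 0 - a 1 0 * b 0 0.
pose D := c0 ^+ 2 + c1 ^+ 2 + c2 ^+ 2.
have D0 : D != 0.
  apply: contra cab => /eqP D0; apply/eqP.
  have [z0 z1 z2] : [/\ c0 = 0, c1 = 0 & c2 = 0].
    have := sqr_ge0 c0; have := sqr_ge0 c1; have := sqr_ge0 c2 => p2 p1 p0.
    by split; apply/eqP; rewrite -sqrf_eq0 eq_le; apply/andP; split => //; rewrite /D in D0; lra.
  by apply: cV3P; rewrite /mcross col3E mxE// -/c0 z0 oppr0.
pose f1 (w : V3) : R := D^-1 * (b 1 0 * c2 - b 2 0 * c1) * w 0 0 +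
  D^-1 * (b 2 0 * c0 - b 0 0 * c2) * w 1 0 + D^-1 * (b 0 0 * c1 - b 1 0 * c0) * w 2 0.
pose f2 (w : V3) : R := D^-1 * (a 2 0 * c1 - a 1 0 * c2) * w 0 0 +
  D^-1 * (a 0 0 * c2 - a 2 0 * c0) * w 1 0 + D^-1 * (a 1 0 * c0 - a 0 0 * c1) * w 2 0.
pose f w := (f1 w, f2 w) : R2.
have lf : linear f.
  by move=> k x y; congr (_, _); rewrite /= /f1 /f2 !mxE !scaleE; ring.
pose fM := GRing.isLinear.Build _ _ _ _ _ lf.
pose L : {linear _ -> _} := HB.pack f fM.
have cf1 : continuous f1 by exact: linear_form_continuous.
have cf2 : continuous f2 by exact: linear_form_continuous.
exists L.
  suff cf : continuous f by exact: cf.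
  by move=> w; exact: (continuous_at_pair (cf1 w) (cf2 w)).
move=> h; rewrite [T h]linear_planeE -/a -/b /L /= /f /f1 /f2 !mxE; case: h => u v /=.
by congr (_, _); rewrite /D /c0 /c1 /c2; field; exact: D0.
Qed.

(** Near [z] a map into the surface factors differentiably through the chart:
    the continuous inverse of the chart lifts it, and [is_diff_lift]
    differentiates the lift. Independence of the chart always comes from
    here. *)
Lemma chart_lift (C : normedModType R) S U X q (Z : C -> V3) z :
  chart S U X -> U q -> Z z = X q -> differentiable Z z -> (\near z, S (Z z)) ->
  exists t : C -> R2,
    [/\ t z = q, \near z, U (t z), \near z, X (t z) = Z z, differentiable t z &
        forall h, 'd X q ('d t z h) = 'd Z z h].
Proof.
move=> [[V oV XU] [oU CX _ Xinj [g [gX cg]]]] Uq Zz dZ SZ.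
have nU : \near z, (X @` U) (Z z).
  have cZ : {for z, continuous Z} by exact: differentiable_continuous.
  have nV : nbhs (Z z) V.
    apply: open_nbhs_nbhs; split=> //; rewrite Zz.
    by have : (X @` U) (X q) by [exists q]; rewrite XU => -[].
  have := filterI SZ (cZ _ nV : \near z, V (Z z)) => n.
  have {}n : \forall y \near z, S (Z y) /\ V (Z y) by exact: n.
  by apply: filterS n => y [Sy Vy]; rewrite XU.
pose t := g \o Z.
have tz : t z = q by rewrite /t /= Zz gX.
have ct : {for z, continuous t}.
  have /subspace_continuousP/(_ (X q)) := cg => /(_ (ex_intro2 _ _ q Uq erefl)) cgq.
  rewrite /prop_for /continuous_at tz => A; rewrite -[q]gX// => /cgq nA.
  have cZ : {for z, continuous Z} by exact: differentiable_continuous.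
  rewrite /prop_for /continuous_at Zz in cZ.
  have n : \forall y \near z, (X @` U) (Z y) -> A (g (Z y)) by exact: (cZ _ nA).
  have : \forall y \near z, A (g (Z y)) by apply: filterS2 nU n => y ? ; apply.
  by [].
have dXq : differentiable X q by exact: (CX 1).1.
have [L cL LX] := space_left_inverse (Xinj q Uq).
have nX : \near z, X (t z) = Z z.
  by apply: filterS nU => y [x Ux xy]; rewrite /t /= -xy gX.
have nUt : \near z, U (t z).
  by apply: filterS nU => y [x Ux xy]; rewrite /t /= -xy gX.
clearbody t; subst q.
have [dt _] := is_diff_lift dXq cL LX dZ ct nX.
have dXt' : differentiable (fun y => X (t y)) z by exact: differentiable_comp.
exists t; split => // h.
have e1 := diff_comp_fun h dt dXq.
have e2 := f_equal (fun L => L h) (near_eq_diffE nX dXt').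
exact: esym (etrans e2 e1).
Qed.

Lemma chart_in S U X q : chart S U X -> U q -> S (X q).
Proof.
move=> [[V _ XU] _] Uq; have : (X @` U) (X q) by exists q.
by rewrite XU => -[].
Qed.

Lemma chart_open S U X : chart S U X -> open U.
Proof. by case=> _ []. Qed.

Lemma chart_smooth S U X : chart S U X -> smooth_on U X.
Proof. by case=> _ []. Qed.

Lemma smooth_diff V W (U : set V) (F : V -> W) (q : V) : smooth_on U F -> U q -> differentiable F q.
Proof. by move=> /(_ 1) [+ _] Uq; apply. Qed.

Lemma chart_diff S U X q : chart S U X -> U q -> differentiable X q.
Proof. by move=> /chart_smooth; exact: smooth_diff. Qed.

Lemma chart_inj S U X q : chart S U X -> U q -> injective ('d X q).
Proof. by move=> [_ [_ _ _ + _]]; apply. Qed.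

Lemma chart_near S U X q : chart S U X -> U q -> \near q, U q.
Proof. by move=> /chart_open oU Uq; exact: open_nbhs_nbhs. Qed.

Lemma chart_nearS S U X q : chart S U X -> U q -> \near q, S (X q).
Proof.
move=> cX Uq; apply: filterS (chart_near cX Uq) => y Uy; exact: chart_in cX Uy.
Qed.

(** The transition maps of [chart_lift] identify the tangent planes of all
    charts. *)
Lemma tangentE S U X q : chart S U X -> U q -> tangent S (X q) = range ('d X q).
Proof.
move=> cX Uq; apply/seteqP; split => [w [U' [X' [q' [h [cX' Uq' Xq' ->]]]]]|w [h _ <-]].
  have [t [_ _ _ _ dt]] := chart_lift cX Uq Xq' (chart_diff cX' Uq') (chart_nearS cX' Uq').
  by exists ('d t q' h) => //; rewrite dt.
by exists U, X, q, h.
Qed.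

Lemma differentiable_chart (V : normedModType R) S (F : V3 -> V) U X q U' X' q' :
  chart S U X -> U q -> chart S U' X' -> U' q' -> X' q' = X q ->
  differentiable (F \o X') q' -> differentiable (F \o X) q.
Proof.
move=> cX Uq cX' Uq' E dF.
have [t [tq _ tX dt _]] := chart_lift cX' Uq' (esym E) (chart_diff cX Uq) (chart_nearS cX Uq).
have H : differentiable ((F \o X') \o t) q by apply: differentiable_comp => //; rewrite tq.
apply: near_eq_differentiable H.
by apply: filterS tX => y /= ->.
Qed.

(** Two charts give the same value, since they differ by a transition map of
    [chart_lift]. *)
Lemma surface_diffE (V : normedModType R) S (F : V3 -> V) U X q h :
  chart S U X -> U q -> differentiable (F \o X) q ->
  surface_diff S F (X q) ('d X q h) = 'd (F \o X) q h.
Proof.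
move=> cX Uq dF; rewrite /surface_diff; case: xgetP; last first.
  by move/(_ ('d (F \o X) q h)); case; exists U, X, q, h.
move=> _ _ [U' [X' [q' [h' [[cX' Uq'] E Eh dF' ->]]]]].
have [t [tq _ tX dt dX]] := chart_lift cX Uq E (chart_diff cX' Uq') (chart_nearS cX' Uq').
have Eh' : 'd t q' h' = h by apply: (chart_inj cX Uq); rewrite dX.
have H : differentiable ((F \o X) \o t) q' by apply: differentiable_comp => //; rewrite tq.
have n : \near q', ((F \o X) \o t) q' = (F \o X') q' by apply: filterS tX => y /= ->.
apply: (etrans (f_equal (fun L => L h') (near_eq_diffE n H))).
apply: (etrans (@diff_comp_fun _ _ _ t (F \o X) q' h' dt _)); first by rewrite tq.
by rewrite Eh' tq.
Qed.

(** * Smoothness of vector operations *)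

Lemma class_C_col3 k V (D : set V) (f g h : V -> R) : open D ->
  class_C k D f -> class_C k D g -> class_C k D h ->
  class_C k D (fun x => col3 (f x) (g x) (h x)).
Proof.
move=> oD Cf Cg Ch; apply: class_C_mx => // + j; rewrite ord1; apply: ord3_ind.
- by apply: class_C_ext Cf => // x _; rewrite col3E.
- by apply: class_C_ext Cg => // x _; rewrite col3E.
- by apply: class_C_ext Ch => // x _; rewrite col3E.
Qed.

Lemma differentiable_col3 V (F : V -> V3) x :
  (forall i, differentiable (fun y => F y i 0) x) -> differentiable F x.
Proof.
move=> dF; pose d (i : 'I_3) : V3 := delta_mx i 0.
have -> : F = fun y => F y 0 0 *: d 0 + F y 1 0 *: d 1 + F y 2 0 *: d 2.
  by apply/funext => y; apply: cV3P; rewrite !mxE /=; ring.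
have dm i : differentiable (fun y => F y i 0 *: d i) x.
  exact: (@differentiableZl _ _ _ (fun y => F y i 0)).
apply: (@differentiableD _ _ _ (fun y => F y 0 0 *: d 0 + F y 1 0 *: d 1)
  (fun y => F y 2 0 *: d 2)) => //.
exact: (@differentiableD _ _ _ (fun y => F y 0 0 *: d 0) (fun y => F y 1 0 *: d 1)).
Qed.

Lemma class_C_mdot k V (D : set V) (F G : V -> V3) : open D ->
  class_C k D F -> class_C k D G -> class_C k D (fun x => mdot (F x) (G x)).
Proof.
move=> oD CF CG.
have m i : class_C k D (fun x => F x i 0 * G x i 0).
  by apply: class_CM => //; exact: class_C_entry.
rewrite /mdot; apply: class_CD => //; apply: class_CD => //.
exact: class_CN.
Qed.

Lemma class_C_mcross k V (D : set V) (F G : V -> V3) : open D ->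
  class_C k D F -> class_C k D G -> class_C k D (fun x => mcross (F x) (G x)).
Proof.
move=> oD CF CG.
have m i j : class_C k D (fun x => F x i 0 * G x j 0).
  by apply: class_CM => //; exact: class_C_entry.
rewrite /mcross; apply: class_C_col3 => //; last 2 first.
- exact: class_CB.
- exact: class_CB.
by apply: class_CN => //; exact: class_CB.
Qed.

Lemma smooth_derive V W (D : set V) (F : V -> W) v :
  smooth_on D F -> smooth_on D ('D_v F).
Proof. by move=> CF k; exact: (CF k.+1).2. Qed.

Lemma mdot_leibniz (a b c d : V3) :
  - (a 0 0 * b 0 0 + c 0 0 * d 0 0) + (a 1 0 * b 1 0 + c 1 0 * d 1 0) +
  (a 2 0 * b 2 0 + c 2 0 * d 2 0) = mdot a b + mdot c d.
Proof. by rewrite /mdot; ring. Qed.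

Lemma diff_mdot V (F G : V -> V3) x h : differentiable F x -> differentiable G x ->
  'd (fun y => mdot (F y) (G y)) x h = mdot (F x) ('d G x h) + mdot ('d F x h) (G x).
Proof.
move=> dF dG.
have dFi i := differentiable_entry i 0 dF; have dGi i := differentiable_entry i 0 dG.
have dm i : differentiable (fun y => F y i 0 * G y i 0) x.
  exact: (@differentiableM _ _ (fun y => F y i 0) (fun y => G y i 0)).
have dn : differentiable (fun y => - (F y 0 0 * G y 0 0)) x by exact: differentiableN.
have ds : differentiable (fun y => - (F y 0 0 * G y 0 0) + F y 1 0 * G y 1 0) x.
  exact: (@differentiableD _ _ _ (fun y => - (F y 0 0 * G y 0 0)) (fun y => F y 1 0 * G y 1 0)).
have em i : 'd (fun y => F y i 0 * G y i 0) x h =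
    F x i 0 * ('d G x h) i 0 + ('d F x h) i 0 * G x i 0.
  by rewrite diffM_fun// !diff_entry.
have en : 'd (fun y => - (F y 0 0 * G y 0 0)) x h = - 'd (fun y => F y 0 0 * G y 0 0) x h.
  by have := diffN (dm 0) => /(f_equal (fun L => L h)).
apply: (etrans (diffD_fun h ds (dm 2))).
rewrite (diffD_fun h dn (dm 1)) en !em; exact: mdot_leibniz.
Qed.

(** * Null frames of Minkowski space *)

Lemma sum_sqr_eq0 (x y : R) : x * x + y * y = 0 -> x = 0 /\ y = 0.
Proof.
move=> e; have := sqr_ge0 x; have := sqr_ge0 y; rewrite !expr2 => h2 h1.
have [/eqP z1 /eqP z2] : x * x = 0 /\ y * y = 0 by split; lra.
by move: z1 z2; rewrite -!expr2 !sqrf_eq0 => /eqP -> /eqP ->.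
Qed.

Lemma sum_sqr_ratio (a p1 p2 q1 q2 : R) : q1 = a * p1 -> q2 = a * p2 ->
  p1 * p1 + p2 * p2 != 0 -> (q1 * p1 + q2 * p2) / (p1 * p1 + p2 * p2) = a.
Proof. by move=> -> -> d0; rewrite -!mulrA -mulrDr mulfK. Qed.

Lemma mdotC (v w : V3) : mdot v w = mdot w v.
Proof. by rewrite /mdot; ring. Qed.

Lemma mdotDr (u v w : V3) : mdot u (v + w) = mdot u v + mdot u w.
Proof. by rewrite /mdot !mxE; ring. Qed.

Lemma mdotZr a (u v : V3) : mdot u (a *: v) = a * mdot u v.
Proof. by rewrite /mdot !mxE; ring. Qed.

Lemma mdotDl (u v w : V3) : mdot (v + w) u = mdot v u + mdot w u.
Proof. by rewrite mdotC mdotDr !(mdotC u). Qed.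

Lemma mdotZl a (u v : V3) : mdot (a *: v) u = a * mdot v u.
Proof. by rewrite mdotC mdotZr (mdotC u). Qed.

Lemma mdotNr (u v : V3) : mdot u (- v) = - mdot u v.
Proof. by rewrite -scaleN1r mdotZr mulN1r. Qed.

Lemma mdotBr (u v w : V3) : mdot u (v - w) = mdot u v - mdot u w.
Proof. by rewrite mdotDr mdotNr. Qed.

Lemma mdotBl (u v w : V3) : mdot (v - w) u = mdot v u - mdot w u.
Proof. by rewrite mdotC mdotBr !(mdotC u). Qed.

Lemma mdot0r (u : V3) : mdot u 0 = 0.
Proof. by rewrite -(scale0r u) mdotZr mul0r. Qed.

(** A null vector is proportional to a unique [N] of this form. *)
Definition null1 (N : V3) : Prop := N 0 0 = 1 /\ mdot N N = 0.

(** The unit spacelike vector and the second null vector that complete [N] to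
    an adapted frame. *)
Definition perp1 (N : V3) : V3 := col3 0 (- N 2 0) (N 1 0).
Definition conull (N : V3) : V3 := col3 (- 2^-1) (2^-1 * N 1 0) (2^-1 * N 2 0).

Lemma null1_circle N : null1 N -> N 1 0 * N 1 0 + N 2 0 * N 2 0 = 1.
Proof. by case; rewrite /mdot => -> h; lra. Qed.

Lemma perp1_norm N : null1 N -> mdot (perp1 N) (perp1 N) = 1.
Proof. by move=> /null1_circle; rewrite /mdot /perp1 !col3E => h; lra. Qed.

Lemma null1_perp1 N : null1 N -> mdot N (perp1 N) = 0.
Proof. by move=> _; rewrite /mdot /perp1 !col3E; ring. Qed.

Lemma perp1_conull N : mdot (perp1 N) (conull N) = 0.
Proof. by rewrite /mdot /perp1 /conull !col3E; ring. Qed.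

Lemma conull_null N : null1 N -> mdot (conull N) (conull N) = 0.
Proof. by move=> /null1_circle; rewrite /mdot /conull !col3E => h; lra. Qed.

Lemma conull_orth N w : null1 N -> mdot N w = 0 -> mdot (conull N) w = w 0 0.
Proof. by case=> N0 _; rewrite /mdot /conull !col3E N0 => h; lra. Qed.

Lemma null1_conull N : null1 N -> mdot N (conull N) = 1.
Proof.
by move=> HN; have := null1_circle HN; have [N0 _] := HN; rewrite /mdot /conull !col3E N0 => h; lra.
Qed.

Lemma null1_orth N w : null1 N -> mdot N w = 0 ->
  w = w 0 0 *: N + mdot (perp1 N) w *: perp1 N.
Proof.
move=> HN; have c := null1_circle HN; have [N0 _] := HN.
move=> h; have {}h : w 0 0 = N 1 0 * w 1 0 + N 2 0 * w 2 0.
  by move: h; rewrite /mdot N0; lra.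
have E1 : w 1 0 = w 1 0 * (N 1 0 * N 1 0 + N 2 0 * N 2 0) by rewrite c mulr1.
have E2 : w 2 0 = w 2 0 * (N 1 0 * N 1 0 + N 2 0 * N 2 0) by rewrite c mulr1.
rewrite /mdot /perp1 !col3E; apply: cV3P; rewrite !mxE /=.
- by rewrite N0; ring.
- by rewrite h {1}E1; ring.
- by rewrite h {1}E2; ring.
Qed.

Lemma null1_unique N N' : null1 N -> null1 N' -> mdot N N' = 0 -> N' = N.
Proof.
move=> HN [N'0 N'n] /(null1_orth HN) E; rewrite N'0 scale1r in E.
move: N'n; rewrite E mdotDl !mdotDr !mdotZl !mdotZr null1_perp1// (mdotC (perp1 N) N).
rewrite null1_perp1// perp1_norm//; have [_ ->] := HN; rewrite !mulr0 !add0r mulr1.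
by move/eqP; rewrite -expr2 sqrf_eq0 => /eqP ->; rewrite scale0r addr0.
Qed.

Lemma null1_scale (n : V3) : n != 0 -> mdot n n = 0 ->
  n 0 0 != 0 /\ null1 ((n 0 0)^-1 *: n).
Proof.
move=> n0 nn.
have h : n 0 0 != 0.
  apply: contra n0 => /eqP h; apply/eqP.
  move: nn; rewrite /mdot h; have := sqr_ge0 (n 1 0); have := sqr_ge0 (n 2 0).
  rewrite !expr2 => p2 p1 e.
  have [z1 z2] : n 1 0 * n 1 0 = 0 /\ n 2 0 * n 2 0 = 0 by split; lra.
  by apply: cV3P; rewrite mxE//; apply/eqP; rewrite -sqrf_eq0 expr2; apply/eqP.
by split=> //; split; rewrite ?mxE ?mulVf// mdotZl mdotZr nn !mulr0.
Qed.

(** In a frame with the prescribed inner products the coordinates of a vector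
    are its products with the frame vectors taken in reverse order. *)
Definition null_gram (E : 'M[R]_3) : Prop :=
  let e i := col i E in
  [/\ [/\ mdot (e 0) (e 0) = 0, mdot (e 0) (e 1) = 0,
          mdot (e 1) (e 2) = 0 & mdot (e 2) (e 2) = 0],
      mdot (e 0) (e 2) = 1 & mdot (e 1) (e 1) = 1].

Lemma sum3 (F : 'I_3 -> R) : \sum_i F i = F 0 + F 1 + F 2.
Proof.
rewrite !big_ord_recl big_ord0 addr0 addrA; congr (_ + F _ + F _); exact: val_inj.
Qed.

Lemma mulmx_cols (E : 'M[R]_3) (c : V3) :
  E *m c = c 0 0 *: col 0 E + c 1 0 *: col 1 E + c 2 0 *: col 2 E.
Proof.
by apply/matrixP => i j; rewrite !mxE sum3 !ord1 !(mulrC (E _ _)).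
Qed.

Lemma null_gram_coord (E : 'M[R]_3) w : null_gram E -> E \in unitmx ->
  [/\ (invmx E *m w) 0 0 = mdot (col 2 E) w, (invmx E *m w) 1 0 = mdot (col 1 E) w &
      (invmx E *m w) 2 0 = mdot (col 0 E) w].
Proof.
move=> [[g00 g01 g12 g22] g02 g11] uE; set c := invmx E *m w.
have -> : w = E *m c by rewrite /c mulKVmx.
rewrite mulmx_cols !mdotDr !mdotZr.
rewrite (mdotC (col 2 E) (col 0 E)) (mdotC (col 2 E) (col 1 E)) (mdotC (col 1 E) (col 0 E)).
by rewrite g00 g01 g12 g22 g02 g11 !mulr0 !mulr1 !addr0 !add0r.
Qed.

Lemma null_gram_unit (E : 'M[R]_3) : null_gram E -> E \in unitmx.
Proof.
move=> [[g00 g01 g12 g22] g02 g11].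
pose A : 'M[R]_3 := \matrix_(i, k) ((if k == 0 then -1 else 1) * E k (rev_ord i)).
have H i j : (A *m E) i j = mdot (col (rev_ord i) E) (col j E).
  by rewrite !mxE sum3 !mxE /mdot !mxE /=; ring.
have rev3 : [/\ rev_ord (0 : 'I_3) = 2, rev_ord (1 : 'I_3) = 1 & rev_ord (2 : 'I_3) = 0].
  by split; exact: val_inj.
have [r0 r1 r2] := rev3.
suff /mulmx1_unit[] : A *m E = 1%:M by [].
apply/matrixP => i j; rewrite H [RHS]mxE.
move: i j; do 2! apply: ord3_ind; rewrite ?(r0, r1, r2) //= ?eqxx;
by rewrite 1?mdotC ?(g00, g01, g12, g22, g02, g11)// mdotC ?(g00, g01, g12, g22, g02, g11).
Qed.

(** The adapted frame with [e_0 = l N]. The scale [l] is the freedom that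
    separates 0-adapted from 1-adapted frames. *)
Definition frame (l : R) (N : V3) : 'M[R]_3 := \matrix_(i, j)
  [:: l * N i 0; perp1 N i 0; l^-1 * conull N i 0]`_j.

Lemma frame_cols l N :
  [/\ col 0 (frame l N) = l *: N, col 1 (frame l N) = perp1 N &
      col 2 (frame l N) = l^-1 *: conull N].
Proof. by split; apply/matrixP => i j; rewrite ord1 !mxE. Qed.

Lemma frame_gram l N : l != 0 -> null1 N -> null_gram (frame l N).
Proof.
move=> l0 HN; have [c0 c1 c2] := frame_cols l N; have [_ NN] := HN.
rewrite /null_gram c0 c1 c2 !mdotZl !mdotZr NN null1_perp1// perp1_conull conull_null//.
by rewrite null1_conull// perp1_norm// !mulr0 mulr1 mulfV.
Qed.

(** * The null direction field of a lightlike surface *)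

(** The null tangent direction, scaled to time component 1; [xget] picks it,
    and [nhatP] shows that there is something to pick. *)
Definition nhat S (p : V3) : V3 :=
  xget 0 [set N | null1 N /\ tangent S p = [set w | mdot N w = 0]].

Lemma linear_plane_free (T : {linear R2 -> V3}) (N : V3) : injective T ->
  (forall h, T h = (T h) 0 0 *: N) -> False.
Proof.
move=> Tinj TN; have := mcross_neq0 Tinj; rewrite (TN (1, 0)) (TN (0, 1)) => /eqP; apply.
by apply: cV3P; rewrite /mcross !col3E !mxE; ring.
Qed.

Lemma linear_comb V W (T : {linear V -> W}) a b c d (x y : V) :
  T (a *: x + b *: (c *: (y - d *: x))) = a *: T x + b *: (c *: (T y - d *: T x)).
Proof.
have e z k : T (k *: z) = k *: T z by exact: linearZZ.
have f u v : T (u - v) = T u - T v by exact: linearB.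
by rewrite linearD !e f e.
Qed.

(** The tangent plane is contained in the orthogonal complement of its
    radical, and both have dimension 2. A vector of the radical is orthogonal
    to itself, hence null. *)
Lemma nhatP S p : lightlike_surface S -> S p ->
  null1 (nhat S p) /\ tangent S p = [set w | mdot (nhat S p) w = 0].
Proof.
move=> [rS lS] Sp; rewrite /nhat; case: xgetP => [N _ //|none].
have [n [Tn n0 nT]] := lS p Sp.
have [U [X [cX [q Uq Xq]]]] := rS p Sp; subst p.
have TE := tangentE cX Uq; have Xinj := chart_inj cX Uq.
have [n00 HN] := null1_scale n0 (nT _ Tn); set N := _ *: n in HN.
have NT w : tangent S (X q) w -> mdot N w = 0 by move=> /nT; rewrite /N mdotZl => ->; rewrite mulr0.
exfalso; apply: (none N); split=> //; apply/seteqP; split=> [w /NT //|w /= Nw].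
have [h hc] : exists h, mdot (perp1 N) ('d X q h) != 0.
  apply: contrapT => no; apply: (linear_plane_free Xinj (N := N)) => h.
  have Th : tangent S (X q) ('d X q h) by rewrite TE; exists h.
  rewrite {1}(null1_orth HN (NT _ Th)) (_ : mdot (perp1 N) _ = 0) ?scale0r ?addr0//.
  by apply/eqP; apply: contrapT => /negP hh; apply: no; exists h.
rewrite TE in Tn *; have [k _ kn] := Tn.
have Nk : N = 'd X q ((n 0 0)^-1 *: k) by rewrite linearZ /= kn.
set a := 'd X q h in hc.
have aE : a = a 0 0 *: N + mdot (perp1 N) a *: perp1 N.
  by apply: null1_orth => //; apply: NT; rewrite TE; exists h.
have pE : perp1 N = (mdot (perp1 N) a)^-1 *: (a - a 0 0 *: N).
  have -> : a - a 0 0 *: N = mdot (perp1 N) a *: perp1 N by rewrite {1}aE addrAC subrr add0r.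
  by rewrite scalerA mulVf// scale1r.
set k' := _ *: k in Nk.
exists (w 0 0 *: k' + mdot (perp1 N) w *: ((mdot (perp1 N) a)^-1 *: (h - a 0 0 *: k'))) => //.
by rewrite linear_comb -Nk -/a -pE -null1_orth.
Qed.

Section LightlikeChart.
Variables (S : set V3) (U : set R2) (X : R2 -> V3).
Hypotheses (lS : lightlike_surface S) (cX : chart S U X).
Let N q := nhat S (X q).

Lemma chart_null1 q : U q -> null1 (N q).
Proof. by move=> Uq; have [] := nhatP lS (chart_in cX Uq). Qed.

Lemma chart_orth q h : U q -> mdot (N q) ('d X q h) = 0.
Proof.
move=> Uq; have [_ TE] := nhatP lS (chart_in cX Uq).
have : tangent S (X q) ('d X q h) by rewrite (tangentE cX Uq); exists h.
by rewrite TE.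
Qed.

Lemma chart_dX q h : U q ->
  'd X q h = ('d X q h) 0 0 *: N q + mdot (perp1 (N q)) ('d X q h) *: perp1 (N q).
Proof. by move=> Uq; apply: null1_orth; [exact: chart_null1|exact: chart_orth]. Qed.

Lemma chart_transversal q : U q -> exists h, mdot (perp1 (N q)) ('d X q h) != 0.
Proof.
move=> Uq; apply: contrapT => no.
apply: (linear_plane_free (chart_inj cX Uq) (N := N q)) => h.
rewrite {1}(chart_dX h Uq) (_ : mdot (perp1 (N q)) _ = 0) ?scale0r ?addr0//.
by apply/eqP; apply: contrapT => /negP hh; apply: no; exists h.
Qed.

(** The normal of a degenerate plane lies in it, so [N] is the normalized
    cross product of the two coordinate vectors. *)
Lemma chart_null_smooth : smooth_on U N.
Proof.
have oU := chart_open cX; have sX := chart_smooth cX.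
pose nu q := mcross ('D_(1, 0) X q) ('D_(0, 1) X q).
have snu : smooth_on U nu.
  by move=> k; apply: class_C_mcross => //; exact: smooth_derive.
have nuE q : U q -> nu q 0 0 != 0 /\ N q = (nu q 0 0)^-1 *: nu q.
  move=> Uq; have dX := chart_diff cX Uq; have HN := chart_null1 Uq.
  have nu0 : nu q != 0.
    by rewrite /nu !deriveE//; exact: mcross_neq0 (chart_inj cX Uq).
  have orth h : mdot (nu q) ('d X q h) = 0.
    rewrite linear_planeE mdotDr !mdotZr /nu !deriveE//.
    by rewrite /mdot /mcross !col3E; ring.
  have orthT w : mdot (N q) w = 0 -> mdot (nu q) w = 0.
    move=> Nw; have [_ TE] := nhatP lS (chart_in cX Uq).
    have : tangent S (X q) w by rewrite TE.
    by rewrite (tangentE cX Uq) => -[h _ <-].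
  have E : nu q = nu q 0 0 *: N q.
    rewrite {1}(null1_orth HN (w := nu q)).
      by rewrite (mdotC _ (nu q)) orthT ?null1_perp1// scale0r addr0.
    by rewrite mdotC orthT//; have [] := HN.
  have n0 : nu q 0 0 != 0 by apply: contra nu0 => /eqP z; rewrite E z scale0r.
  by split=> //; rewrite {2}E scalerA mulVf// scale1r.
move=> k; apply: (@class_C_ext k _ _ _ (fun q => (nu q 0 0)^-1 *: nu q)) => //.
  by move=> q Uq; have [_ ->] := nuE q Uq.
apply: class_CZ => //; apply: class_C_inv => //; last exact: class_C_entry.
by move=> q Uq; have [] := nuE q Uq.
Qed.

Lemma chart_null_diff q : U q -> differentiable N q.
Proof. exact: smooth_diff chart_null_smooth. Qed.

(** [N] stays null with time component 1, so its derivative is orthogonal to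
    [N] without time component, which leaves the spacelike tangent direction. *)
Lemma chart_dN q h : U q -> ('d N q h) 0 0 = 0 /\
  'd N q h = mdot (perp1 (N q)) ('d N q h) *: perp1 (N q).
Proof.
move=> Uq; have dN := chart_null_diff Uq; have HN := chart_null1 Uq.
have n1 : \near q, 1 = N q 0 0.
  by apply: filterS (chart_near cX Uq) => x Ux; have [-> _] := chart_null1 Ux.
have n2 : \near q, 0 = mdot (N q) (N q).
  by apply: filterS (chart_near cX Uq) => x Ux; have [_ ->] := chart_null1 Ux.
have z0 : ('d N q h) 0 0 = 0.
  rewrite -diff_entry//.
  have := near_eq_diffE n1 (differentiable_cst _ _) => /(f_equal (fun L => L h)) /= ->.
  exact: diff_cst_fun.
have o : mdot (N q) ('d N q h) = 0.
  have := diff_mdot h dN dN.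
  have := near_eq_diffE n2 (differentiable_cst _ _) => /(f_equal (fun L => L h)) /= ->.
  by rewrite diff_cst_fun (mdotC ('d N q h)) -mulr2n => /esym/eqP; rewrite mulrn_eq0 => /eqP.
by split=> //; rewrite {1}(null1_orth HN o) z0 scale0r add0r.
Qed.

End LightlikeChart.

(** * Maurer-Cartan forms in a chart *)

Lemma adapted0_differentiable S O E U X q : adapted0 S O E -> chart S U X -> U q ->
  O (X q) -> differentiable (E \o X) q.
Proof.
move=> [_ sE _] cX Uq Oq; have [U' [X' [cX' [q' Uq' E'] _ sEX]]] := sE _ Oq.
by apply: (differentiable_chart cX Uq cX' Uq' E'); exact: smooth_diff sEX Uq'.
Qed.

Lemma adapted0_gram S O E p : adapted0 S O E -> O p -> null_gram (E p) /\ E p \in unitmx.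
Proof. by move=> [_ _ H] /H[uE _ g1 g2 g3]. Qed.

Lemma mc1E S O E p w : adapted0 S O E -> O p ->
  mc1 E 0 p w = mdot (col 2 (E p)) w /\ mc1 E 1 p w = mdot (col 1 (E p)) w.
Proof.
move=> aE Op; have [g u] := adapted0_gram aE Op.
by have [e0 e1 _] := null_gram_coord w g u; split.
Qed.

(** The coordinates of a vector in a null frame are inner products with the
    frame, so these forms are components of the derivative of [e_0] alone. *)
Lemma mc2E S O E U X q h : adapted0 S O E -> chart S U X -> U q -> O (X q) ->
  let e0 q := col 0 (E (X q)) in
  mc2 S E 0 0 (X q) ('d X q h) = mdot (col 2 (E (X q))) ('d e0 q h) /\
  mc2 S E 1 0 (X q) ('d X q h) = mdot (col 1 (E (X q))) ('d e0 q h).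
Proof.
move=> aE cX Uq Oq e0; have dE := adapted0_differentiable aE cX Uq Oq.
have de0 : differentiable e0 q.
  apply: differentiable_col3 => i; have := differentiable_entry i 0 dE.
  by rewrite (_ : (fun y => e0 y i 0) = (fun y => (E \o X) y i 0))//; apply/funext => y; rewrite mxE.
rewrite /mc2 (surface_diffE h cX Uq dE).
have cE (A B : 'M[R]_3) i : (A *m B) i 0 = (A *m col 0 B) i 0.
  by rewrite !mxE; apply: eq_bigr => k _; rewrite !mxE.
have -> : 'd e0 q h = col 0 ('d (E \o X) q h).
  apply: cV3P; rewrite -(diff_entry _ _ _ de0) [RHS]mxE -(diff_entry _ _ _ dE);
  congr ('d _ q h); by apply/funext => x; rewrite mxE.
have [g u] := adapted0_gram aE Oq.
by rewrite !(cE (invmx _)); have [-> -> _] := null_gram_coord (col 0 ('d (E \o X) q h)) g u.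
Qed.

Lemma scaled_null_field (N dN D : V3) (l d : R) : null1 N -> mdot N dN = 0 ->
  dN 0 0 = 0 -> D = l *: dN + d *: N ->
  mdot (l^-1 *: conull N) D = d / l /\ mdot (perp1 N) D = l * mdot (perp1 N) dN.
Proof.
move=> HN o dN0 ->.
rewrite !mdotDr !mdotZr !mdotZl (mdotC (perp1 _) N) null1_perp1// mulr0 addr0; split => //.
rewrite (conull_orth HN o) dN0 !mulr0 add0r (mdotC (conull _)) null1_conull//.
by rewrite mulr1.
Qed.

Section NullFrame.
Variables (S : set V3) (l : V3 -> R).
Hypotheses (lS : lightlike_surface S) (l0 : forall p, S p -> l p != 0).
Hypothesis sl : forall U X, chart S U X -> smooth_on U (l \o X).
Let E p := frame (l p) (nhat S p).

Lemma frame_adapted0 : adapted0 S S E.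
Proof.
split.
- by exists setT; rewrite ?setTI//; exact: openT.
- move=> p Sp; have [U [X [cX XUp]]] := lS.1 p Sp; exists U, X; split => //.
    by move=> _ [q Uq <-]; exact: chart_in cX Uq.
  have oU := chart_open cX; move=> k; have Cl := sl cX k.
  have CN i : class_C k U (fun q => nhat S (X q) i 0).
    by apply: class_C_entry => //; exact: (chart_null_smooth lS cX).
  have C0 : class_C k U (fun q => l (X q) *: nhat S (X q)).
    by apply: class_CZ => //; exact: (chart_null_smooth lS cX).
  have C1 : class_C k U (fun q => perp1 (nhat S (X q))).
    by apply: class_C_col3 => //; [exact: class_C_cst|exact: class_CN].
  have C2 : class_C k U (fun q => (l (X q))^-1 *: conull (nhat S (X q))).
    apply: class_CZ => //.
      by apply: class_C_inv => // q Uq; apply: l0; exact: chart_in cX Uq.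
    apply: class_C_col3 => //; first exact: class_C_cst.
      by apply: class_CM => //; exact: class_C_cst.
    by apply: class_CM => //; exact: class_C_cst.
  apply: class_C_mx => // i; apply: ord3_ind.
  + by apply: class_C_ext (class_C_entry i 0 oU C0) => // q _; rewrite !mxE.
  + by apply: class_C_ext (class_C_entry i 0 oU C1) => // q _; rewrite !mxE.
  + by apply: class_C_ext (class_C_entry i 0 oU C2) => // q _; rewrite !mxE.
- move=> p Sp e; have [HN TE] := nhatP lS Sp.
  have g := frame_gram (l0 Sp) HN; have [c0 c1 _] := frame_cols (l p) (nhat S p).
  have [g1 g2 g3] := g; split => //; first exact: null_gram_unit.
  rewrite TE /e /E c0 c1; apply/seteqP; split=> [w /= Nw|_ /= [a [b ->]]].
    exists (w 0 0 / l p), (mdot (perp1 (nhat S p)) w).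
    by rewrite scalerA divfK ?l0//; exact: null1_orth.
  by rewrite mdotDr !mdotZr null1_perp1// HN.2 !mulr0 addr0.
Qed.

Section InChart.
Variables (U : set R2) (X : R2 -> V3) (q h : R2).
Hypotheses (cX : chart S U X) (Uq : U q).
Let N q := nhat S (X q).

Lemma frame_mc1 :
  mc1 E 0 (X q) ('d X q h) = (l (X q))^-1 * ('d X q h) 0 0 /\
  mc1 E 1 (X q) ('d X q h) = mdot (perp1 (N q)) ('d X q h).
Proof.
have Sq := chart_in cX Uq; have HN : null1 (N q) := chart_null1 lS cX Uq.
have [-> ->] := mc1E ('d X q h) frame_adapted0 Sq.
have [_ c1 c2] := frame_cols (l (X q)) (nhat S (X q)); rewrite /E c1 c2; split => //.
by rewrite mdotZl (conull_orth HN (chart_orth lS cX h Uq)).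
Qed.

Lemma frame_mc2 :
  mc2 S E 0 0 (X q) ('d X q h) = 'd (l \o X) q h / l (X q) /\
  mc2 S E 1 0 (X q) ('d X q h) = l (X q) * mdot (perp1 (N q)) ('d N q h).
Proof.
have Sq := chart_in cX Uq; have HN : null1 (N q) := chart_null1 lS cX Uq.
have [-> ->] := mc2E h frame_adapted0 cX Uq Sq.
have [_ c1 c2] := frame_cols (l (X q)) (nhat S (X q)); rewrite /E c1 c2.
have -> : (fun q => col 0 (frame (l (X q)) (nhat S (X q)))) = fun q => (l \o X) q *: N q.
  by apply/funext => y; have [] := frame_cols (l (X y)) (nhat S (X y)).
have dl : differentiable (l \o X) q by exact: smooth_diff (sl cX) Uq.
have dNq : differentiable N q := chart_null_diff lS cX Uq.
have [dN0 dNE] := chart_dN lS cX h Uq.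
have dNo : mdot (N q) ('d N q h) = 0 by rewrite dNE mdotZr null1_perp1// mulr0.
exact: (scaled_null_field HN dNo dN0 (diffZ_fun h dl dNq)).
Qed.

End InChart.
End NullFrame.

(** ** The invariant a_1 and the rank of the null field *)

Lemma edge_algebra (a d : R) (x n y dn ln : V3) : a != 0 ->
  y = x - ln -> ln = a^-1 *: dn + d *: n -> dn = a *: (x - x 0 0 *: n) ->
  y = (x 0 0 - d) *: n.
Proof.
move=> a0 -> -> ->; rewrite scalerA mulVf// scale1r scalerBl opprD opprB addrA.
by rewrite (addrC x) subrK.
Qed.

Section Invariants.
Variables (S : set V3) (a : V3 -> R).
Hypothesis lS : lightlike_surface S.
Hypothesis Ha : is_a1 S S (fun p => frame 1 (nhat S p)) a.

Lemma smooth_cst V W (D : set V) (c : W) : smooth_on D (fun=> c).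
Proof. by move=> k; exact: class_C_cst. Qed.

Section InChart.
Variables (U : set R2) (X : R2 -> V3).
Hypothesis cX : chart S U X.
Let N q := nhat S (X q).

Lemma a1_chart q h : U q ->
  mdot (perp1 (N q)) ('d N q h) = a (X q) * mdot (perp1 (N q)) ('d X q h).
Proof.
move=> Uq; have Sq := chart_in cX Uq.
have T : tangent S (X q) ('d X q h) by rewrite (tangentE cX Uq); exists h.
have l0 p : S p -> (1 : R) != 0 by move=> _; exact: oner_neq0.
have sl U' X' : chart S U' X' -> smooth_on U' ((fun=> 1 : R) \o X').
  by move=> _; exact: smooth_cst.
have := Ha Sq T.
have [_ ->] := @frame_mc1 S (fun=> 1) lS l0 sl U X q h cX Uq.
have [_ ->] := @frame_mc2 S (fun=> 1) lS l0 sl U X q h cX Uq.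
by rewrite mul1r.
Qed.

(** The null field turns at the rate [a_1]; where [a_1] vanishes identically
    it is constant, which gives the planes. *)
Lemma null_field_derivative q h : U q ->
  'd N q h = a (X q) *: ('d X q h - ('d X q h) 0 0 *: N q).
Proof.
move=> Uq; have [_ e] := chart_dN lS cX h Uq; apply: (etrans e).
rewrite (a1_chart h Uq) -scalerA; congr (_ *: _).
have e' := chart_dX lS cX h Uq; apply/eqP; rewrite eq_sym subr_eq addrC; exact/eqP.
Qed.

(** [a_1] is only given pointwise, through proportional forms; it is a
    quotient of smooth functions by least squares over the two coordinate
    directions. *)
Lemma a1_smooth : smooth_on U (a \o X).
Proof.
have oU := chart_open cX; have sX := chart_smooth cX.
have sN : smooth_on U N := chart_null_smooth lS cX.
pose P v q := mdot (perp1 (N q)) ('D_v X q); pose Q v q := mdot (perp1 (N q)) ('D_v N q).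
pose den q := P (1, 0) q * P (1, 0) q + P (0, 1) q * P (0, 1) q.
pose num q := Q (1, 0) q * P (1, 0) q + Q (0, 1) q * P (0, 1) q.
have sperp : smooth_on U (fun q => perp1 (N q)).
  move=> k; have CN i : class_C k U (fun q => N q i 0) by exact: class_C_entry (sN k).
  by apply: class_C_col3 => //; [exact: class_C_cst|exact: class_CN].
have sP v : smooth_on U (P v).
  by move=> k; apply: class_C_mdot => //; exact: smooth_derive.
have sQ v : smooth_on U (Q v).
  by move=> k; apply: class_C_mdot => //; exact: smooth_derive.
have den0 q : U q -> den q != 0.
  move=> Uq; have [h] := chart_transversal lS cX Uq.
  rewrite linear_planeE mdotDr !mdotZr -!deriveE; try exact: (chart_diff cX).
  rewrite -/(N q) -/(P (1, 0) q) -/(P (0, 1) q); apply: contra => /eqP d0.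
  by have [-> ->] := sum_sqr_eq0 d0; rewrite !mulr0 addr0.
move=> k; apply: (@class_C_ext k _ _ _ (fun q => num q * (den q)^-1)) => //.
  move=> q Uq; have QP v : Q v q = a (X q) * P v q.
    rewrite /Q /P !deriveE; [exact: a1_chart|exact: (chart_diff cX)|].
    exact: (chart_null_diff lS cX).
  exact: sum_sqr_ratio (QP (1, 0)) (QP (0, 1)) (den0 q Uq).
have PP v : class_C k U (fun q => P v q * P v q) := class_CM oU (sP v k) (sP v k).
have QP v : class_C k U (fun q => Q v q * P v q) := class_CM oU (sQ v k) (sP v k).
have Cn : class_C k U num := class_CD oU (QP (1, 0)) (QP (0, 1)).
have Cd : class_C k U den := class_CD oU (PP (1, 0)) (PP (0, 1)).
exact: (class_CM oU Cn (class_C_inv oU den0 Cd)).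
Qed.

(** With [e_0 = a^-1 N] the displacement of [x - e_0] is along the null field:
    the components of [dx] and [d e_0] transverse to it cancel. *)
Lemma edge_derivative q h : (forall p, S p -> a p != 0) -> U q ->
  let l q := (a (X q))^-1 in
  'd (fun q => X q - l q *: N q) q h = (('d X q h) 0 0 - 'd l q h) *: N q.
Proof.
move=> a0 Uq l; have aq : a (X q) != 0 by apply: a0; exact: chart_in cX Uq.
have dl : differentiable l q.
  have sl : smooth_on U l.
    move=> k; apply: class_C_inv; [exact: chart_open cX| |exact: a1_smooth].
    by move=> x Ux; apply: a0; exact: chart_in cX Ux.
  exact: smooth_diff sl Uq.
have dNq : differentiable N q := chart_null_diff lS cX Uq.
have dX := chart_diff cX Uq.
have dlN : differentiable (fun q => l q *: N q) q by have [] := is_diff_scale dl dNq.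
exact: (edge_algebra aq (diffB_fun h dX dlN) (diffZ_fun h dl dNq) (null_field_derivative h Uq)).
Qed.

End InChart.
End Invariants.

(** * Functions on a connected surface *)

Lemma connected_constant (T : Type) S (F : V3 -> T) : connected S ->
  (forall p, S p -> exists2 V, open V & V p /\ forall p', V p' -> S p' -> F p' = F p) ->
  forall p p', S p -> S p' -> F p' = F p.
Proof.
move=> cS loc p p' Sp Sp'.
pose nb x := xget setT [set V : set V3 | open V /\ V x /\ forall y, V y -> S y -> F y = F x].
have nbP x : S x -> open (nb x) /\ nb x x /\ forall y, nb x y -> S y -> F y = F x.
  move=> Sx; rewrite /nb; case: xgetP => [V _ //|none].
  by have [V oV H] := loc x Sx; case: (none V).
pose B := [set x | S x /\ F x = F p].
pose O := \bigcup_(x in B) nb x.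
pose O' := \bigcup_(x in [set x | S x /\ F x <> F p]) nb x.
have oO : open O by apply: bigcup_open => x [Sx _]; have [] := nbP x Sx.
have oO' : open O' by apply: bigcup_open => x [Sx _]; have [] := nbP x Sx.
have BS : B = S.
  apply: cS.
  - by exists p.
  - exists O => //; apply/seteqP; split => [x [Sx Fx]|x [Sx [y [Sy Fy] nyx]]].
      by split => //; exists x => //; have [_ []] := nbP x Sx.
    by split => //; have [_ [_ ->]] := nbP y Sy.
  - exists (~` O'); first exact: open_closedC.
    apply/seteqP; split => [x [Sx Fx]|x [Sx nO']].
      split => // -[y [Sy Fy] nyx]; apply: Fy.
      by rewrite -Fx; have [_ [_ ->]] := nbP y Sy.
    split=> //; apply: contrapT => Fx; apply: nO'; exists x => //.
    by have [_ []] := nbP x Sx.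
have : S p' by []; rewrite -BS; by case.
Qed.

Lemma chart_sub_open S U X O : chart S U X -> open O -> O `<=` U -> open_in S (X @` O).
Proof.
move=> [[V oV XU] [_ _ _ _ [g [gX cg]]]] oO OU.
have : open (g @^-1` O : set (subspace (X @` U))).
  by apply: open_comp => // x _; exact: cg.
move=> /open_subspaceP[V' oV' E]; exists (V `&` V'); first exact: openI.
apply/seteqP; split => [_ [q Oq <-]|x [[Vx V'x] Sx]].
  have XUq : (X @` U) (X q) by exists q => //; exact: OU.
  have : (V `&` S) (X q) by rewrite -XU.
  case=> Vq Sq; split => //; split=> //.
  have : (g @^-1` O `&` X @` U) (X q) by split => //; rewrite /= gX//; exact: OU.
  by rewrite -E => -[].
have XUx : (X @` U) x by rewrite XU.
have : (V' `&` X @` U) x by [].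
rewrite E => -[Ogx [q Uq qx]]; exists q => //.
by move: Ogx; rewrite /= -qx gX.
Qed.

Lemma surface_constant S (F : V3 -> R) : connected S -> regular_surface S ->
  (forall U X q, chart S U X -> U q ->
    differentiable (F \o X) q /\ forall h, 'd (F \o X) q h = 0) ->
  forall p p', S p -> S p' -> F p' = F p.
Proof.
move=> cS rS HF; apply: connected_constant => // p Sp.
have [U [X [cX [q Uq Xq]]]] := rS p Sp.
have /nbhs_ballP[r /= r0 Br] := chart_near cX Uq.
have [V oV XV] := chart_sub_open cX (ball_open q r) Br.
have bq : ball q r q by exact: ballxx.
exists V => //; rewrite -Xq; split.
  by have : (X @` ball q r) (X q) by [exists q]; rewrite XV => -[].
move=> p' Vp' Sp'.
have : (X @` ball q r) p' by rewrite XV.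
case=> q' bq' <-.
apply: (@zero_diff_const _ (F \o X) q r) => // x bx.
  by have [] := HF _ _ _ cX (Br _ bx).
by have [_] := HF _ _ _ cX (Br _ bx).
Qed.

Lemma surface_constant_vector S (F : V3 -> V3) : connected S -> regular_surface S ->
  (forall U X q, chart S U X -> U q ->
    differentiable (F \o X) q /\ forall h, 'd (F \o X) q h = 0) ->
  forall p p', S p -> S p' -> F p' = F p.
Proof.
move=> cS rS HF p p' Sp Sp'; apply/matrixP => i j; rewrite ord1.
apply: (@surface_constant S (fun p => F p i 0)) => // U X q cX Uq.
have [d e] := HF U X q cX Uq; split; first exact: (differentiable_entry i 0 d).
by move=> h; apply: (etrans (diff_entry i 0 h d)); rewrite e mxE.
Qed.

(** * Null planes *)

Definition plane_comb (a b : V3) (q : R2) : V3 := q.1 *: a + q.2 *: b.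

Lemma plane_comb_linear a b : linear (plane_comb a b).
Proof.
move=> k x y; rewrite /plane_comb /= !scalerDl !scaleE -!scalerA scalerDr.
by rewrite addrACA.
Qed.
HB.instance Definition _ a b := GRing.isLinear.Build R R2 V3 _
  (plane_comb a b) (plane_comb_linear a b).

Lemma plane_comb_continuous a b : continuous (plane_comb a b).
Proof.
move=> q; apply: (@cvgD _ _ _ (nbhs q) _ (fun q => q.1 *: a) (fun q => q.2 *: b)).
  by apply: cvgZ; [exact: cvg_fst|exact: cvg_cst].
by apply: cvgZ; [exact: cvg_snd|exact: cvg_cst].
Qed.

Lemma continuous_subr V (p : V) : continuous (fun x : V => x - p).
Proof. by move=> x; apply: cvgB; [exact: cvg_id|exact: cvg_cst]. Qed.

Lemma mdot_continuous (n : V3) : continuous (mdot n).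
Proof.
have -> : mdot n = fun w => (- n 0 0) * w 0 0 + n 1 0 * w 1 0 + n 2 0 * w 2 0.
  by apply/funext => w; rewrite /mdot mulNr.
exact: linear_form_continuous.
Qed.

Definition null_plane (n p : V3) : set V3 := [set x | mdot n (x - p) = 0].

Lemma mink_isometry_id : mink_isometry (@id V3).
Proof.
exists 1%:M, 0; split; first by move=> v w; rewrite !mul1mx.
by apply/funext => x; rewrite mul1mx addr0.
Qed.

Section NullPlane.
Variables n p : V3.
Hypothesis Hn : null1 n.
Let X q := p + plane_comb n (perp1 n) q.

Lemma null_comb_eq0 q : plane_comb n (perp1 n) q = 0 -> q = 0.
Proof.
rewrite /plane_comb => e; case: q e => s t /= e.
have e0 := f_equal (fun v : V3 => v 0 0) e; have e1 := f_equal (mdot (perp1 n)) e.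
rewrite mdotDr !mdotZr mdot0r (mdotC _ n) null1_perp1// perp1_norm// in e1.
rewrite !mxE (Hn.1) /= in e0.
by congr (_, _); lra.
Qed.

Lemma null_plane_image : X @` setT = null_plane n p.
Proof.
apply/seteqP; split => [_ [q _ <-]|x /= Hx].
  rewrite /null_plane /= /X (addrC p) addrK /plane_comb mdotDr !mdotZr null1_perp1// Hn.2.
  by rewrite !mulr0 addr0.
exists ((x - p) 0 0, mdot (perp1 n) (x - p)) => //.
by rewrite /X /plane_comb /= -null1_orth// addrC subrK.
Qed.

Lemma null_plane_diff q h : 'd X q h = plane_comb n (perp1 n) h.
Proof.
exact: (diff_affine p q h (@plane_comb_continuous n (perp1 n))).
Qed.

Lemma null_coord_continuous :
  continuous (fun x : V3 => ((x - p) 0 0, mdot (perp1 n) (x - p)) : R2).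
Proof.
move=> x; have cs := @continuous_subr V3 p x.
have c1 : {for x, continuous (fun x : V3 => (x - p) 0 0)}.
  exact: (continuous_comp cs (@coord_continuous _ _ _ 0 0 (x - p))).
have c2 : {for x, continuous (fun x : V3 => mdot (perp1 n) (x - p))}.
  exact: (continuous_comp cs (@mdot_continuous (perp1 n) (x - p))).
exact: (continuous_at_pair c1 c2).
Qed.

Lemma null_plane_chart : chart (null_plane n p) setT X.
Proof.
split; first by exists setT; rewrite ?setTI ?null_plane_image//; exact: openT.
split => //; first exact: openT.
- move=> k; apply: (@class_CD k R2 V3 setT (fun=> p)); first exact: openT.
    exact: class_C_cst.
  by apply: class_C_linear; exact: plane_comb_continuous.
- move=> q _ x y; rewrite !null_plane_diff => e.
  apply/eqP; rewrite -subr_eq0; apply/eqP/null_comb_eq0.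
  have f : plane_comb n (perp1 n) (x - y) =
    plane_comb n (perp1 n) x - plane_comb n (perp1 n) y by exact: linearB.
  by rewrite f e subrr.
- exists (fun x => ((x - p) 0 0, mdot (perp1 n) (x - p))); split.
    move=> q _; rewrite /X (addrC p) addrK /plane_comb mdotDr !mdotZr (mdotC _ n).
    rewrite null1_perp1// perp1_norm// !mxE Hn.1 /=; case: q => s t /=.
    by congr (_, _); ring.
  by apply: continuous_subspaceT; exact: null_coord_continuous.
Qed.

Lemma null_plane_lightlike : lightlike_plane (null_plane n p).
Proof.
split.
  exists p, n, (perp1 n); split.
    move=> s t e; have /null_comb_eq0 : plane_comb n (perp1 n) (s, t) = 0 by [].
    by case.
  rewrite -null_plane_image; apply/seteqP; split => [_ [q _ <-]|_ [s [t ->]]].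
    by exists q.1, q.2; rewrite /X /plane_comb addrA.
  by exists (s, t) => //; rewrite /X /plane_comb addrA.
split=> [x|x]; rewrite -{1}null_plane_image => -[q _ <-].
  by exists setT, X; split; [exact: null_plane_chart|exists q].
exists n; rewrite (tangentE null_plane_chart)//; split.
- by exists (1, 0) => //; rewrite null_plane_diff /plane_comb /= scale1r scale0r addr0.
- by apply/eqP => n0; have := Hn.1; rewrite n0 mxE => /esym/eqP; rewrite oner_eq0.
- move=> _ [h _ <-]; rewrite null_plane_diff /plane_comb mdotDr !mdotZr null1_perp1// Hn.2.
  by rewrite !mulr0 addr0.
Qed.

End NullPlane.

(** * Surfaces with a_1 = 0 and with a_2 = 0 *)

Lemma diff_mdot_cst V (n : V3) (F : V -> V3) x h : differentiable F x ->
  differentiable (fun y => mdot n (F y)) x /\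
  'd (fun y => mdot n (F y)) x h = mdot n ('d F x h).
Proof.
move=> dF; pose m := mdot n.
have lm : linear m by move=> k u v; rewrite /m mdotDr mdotZr.
pose mM := GRing.isLinear.Build _ _ _ _ _ lm.
pose L : {linear _ -> _} := HB.pack m mM.
have cL : continuous L by exact: mdot_continuous.
split; first exact: (differentiable_comp dF (linear_differentiable _ cL)).
apply: (etrans (diff_comp_fun h dF (linear_differentiable _ cL))).
exact: diff_lin_fun.
Qed.

Lemma a1_algebra (c m w : R) : c != 0 -> m = c * w -> c^-1 * m = 1 * w.
Proof. by move=> c0 ->; rewrite mulrA mulVf. Qed.

Lemma a2_algebra (l d x c w : R) : l != 0 -> d / l - l^-1 * x = c * w -> d - x = l * c * w.
Proof.
move=> l0 e; apply: (mulfI (invr_neq0 l0)); rewrite -mulrA (mulrA l^-1 l) mulVf// mul1r -e.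
by rewrite mulrBr (mulrC d).
Qed.

Section PlaneAndCone.
Variable S : set V3.
Hypotheses (cS : connected S) (lS : lightlike_surface S).

Lemma adapted0_unit : adapted0 S S (fun p => frame 1 (nhat S p)).
Proof.
apply: (@frame_adapted0 S (fun=> 1) lS); first by move=> p _; exact: oner_neq0.
by move=> U X _; exact: smooth_cst.
Qed.

(** The null field is constant, and then so is its product with the position. *)
Lemma plane_case p0 : S p0 -> a1_zero S -> S `<=` null_plane (nhat S p0) p0.
Proof.
move=> Sp0 a1z; have Ha := a1z _ _ adapted0_unit.
have Nc p : S p -> nhat S p = nhat S p0.
  move=> Sp; apply: (surface_constant_vector cS lS.1 _ Sp0 Sp) => U X q cX Uq.
  split; first exact: (chart_null_diff lS cX).
  by move=> h; have e := null_field_derivative lS Ha cX h Uq; rewrite scale0r in e; exact: e.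
move=> p Sp; rewrite /null_plane /= mdotBr; apply/eqP; rewrite subr_eq0; apply/eqP.
apply: (surface_constant cS lS.1 _ Sp0 Sp) => U X q cX Uq.
have dX := chart_diff cX Uq.
split; first by have [] := diff_mdot_cst (nhat S p0) 0 dX.
move=> h; have [_ e] := diff_mdot_cst (nhat S p0) h dX; apply: (etrans e).
by rewrite -(Nc _ (chart_in cX Uq)) (chart_orth lS cX h Uq).
Qed.

Variable a : V3 -> R.
Hypotheses (Ha : is_a1 S S (fun p => frame 1 (nhat S p)) a) (a0 : forall p, S p -> a p != 0).
Let l p := (a p)^-1.

Lemma inv_a1_neq0 p : S p -> l p != 0.
Proof. by move=> Sp; rewrite invr_neq0// a0. Qed.

Lemma inv_a1_smooth U X : chart S U X -> smooth_on U (l \o X).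
Proof.
move=> cX k; apply: class_C_inv; [exact: chart_open cX| |exact: (a1_smooth lS Ha cX)].
by move=> x Ux; apply: a0; exact: chart_in cX Ux.
Qed.

Lemma adapted1_inv_a1 : adapted1 S S (fun p => frame (l p) (nhat S p)).
Proof.
split; first exact: (frame_adapted0 lS inv_a1_neq0 inv_a1_smooth).
move=> p w Sp Tw; have [U [X [cX [q Uq Xq]]]] := lS.1 p Sp; subst p.
move: Tw; rewrite (tangentE cX Uq) => -[h _ <-].
have [_ ->] := frame_mc1 lS inv_a1_neq0 inv_a1_smooth h cX Uq.
have [_ ->] := frame_mc2 lS inv_a1_neq0 inv_a1_smooth h cX Uq.
exact: (a1_algebra (a0 Sp) (a1_chart lS Ha cX h Uq)).
Qed.

(** The invariant [a_2] measures the velocity of the edge [x - e_0]; where it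
    vanishes identically the edge is a point, which gives the cones. *)
Lemma a2_chart U X q h (a2 : V3 -> R) :
  is_a2 S S (fun p => frame (l p) (nhat S p)) a2 -> chart S U X -> U q ->
  'd (l \o X) q h - ('d X q h) 0 0 =
    l (X q) * a2 (X q) * mdot (perp1 (nhat S (X q))) ('d X q h).
Proof.
move=> H2 cX Uq; have Sq := chart_in cX Uq.
have Tw : tangent S (X q) ('d X q h) by rewrite (tangentE cX Uq); exists h.
have := H2 _ _ Sq Tw.
have [-> ->] := frame_mc1 lS inv_a1_neq0 inv_a1_smooth h cX Uq.
have [-> _] := frame_mc2 lS inv_a1_neq0 inv_a1_smooth h cX Uq.
have lq := inv_a1_neq0 Sq.
exact: a2_algebra.
Qed.

(** The edge does not move; it is the vertex, seen from every point in a null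
    direction. *)
Lemma cone_case p0 : S p0 -> a2_zero S ->
  S `<=` lightlike_cone (p0 - l p0 *: nhat S p0).
Proof.
move=> Sp0 a2z; have H2 := a2z _ _ adapted1_inv_a1.
have yc p : S p -> p - l p *: nhat S p = p0 - l p0 *: nhat S p0.
  move=> Sp; apply: (surface_constant_vector cS lS.1 (F := fun p => p - l p *: nhat S p) _ Sp0 Sp).
  move=> U X q cX Uq; have dX := chart_diff cX Uq.
  have dl : differentiable (l \o X) q := smooth_diff (inv_a1_smooth cX) Uq.
  have dN := chart_null_diff lS cX Uq.
  have [dlN _] := is_diff_scale dl dN.
  split; first exact: (differentiableB dX dlN).
  move=> h; have e := edge_derivative lS Ha cX h a0 Uq; apply: (etrans e).
  have := a2_chart h H2 cX Uq; rewrite mulr0 mul0r => e'.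
  have e2 : 'd X q h 0 0 - 'd (l \o X) q h = 0 by rewrite -opprB e' oppr0.
  by rewrite [X in X *: _]e2 scale0r.
move=> p Sp; rewrite /lightlike_cone /= -(yc p Sp) opprB addrC subrK.
have [[_ NN] _] := nhatP lS Sp.
by rewrite mdotZl mdotZr NN !mulr0.
Qed.

End PlaneAndCone.

(** * Functions of one variable on an open interval *)

Lemma is_deriveP V (f : R -> V) (x : R) df : is_derive x 1 f df ->
  differentiable f x /\ 'd f x 1 = df.
Proof.
move=> [d <-]; have D : differentiable f x by apply/derivable1_diffP.
by split => //; rewrite deriveE.
Qed.

Lemma derive1_is_derive V (f : R -> V) (x : R) l : derivable f x 1 -> derive1 f x = l ->
  is_derive x 1 f l.
Proof. by move=> d <-; rewrite derive1E; exact: derivableP. Qed.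

Lemma diff_is_derive V (f : R -> V) (x : R) : differentiable f x -> is_derive x 1 f ('d f x 1).
Proof. by move=> D; split; [exact: diff_derivable|rewrite deriveE]. Qed.

Lemma is_derive_continuous V (f : R -> V) (x : R) df : is_derive x 1 f df ->
  {for x, continuous f}.
Proof. by move=> /is_deriveP[d _]; exact: differentiable_continuous. Qed.

Lemma is_derive_near_eq V (f g : R -> V) (x : R) l : (\near x, f x = g x) ->
  is_derive x 1 f l -> is_derive x 1 g l.
Proof.
move=> fg /is_deriveP[d <-]; have d' := near_eq_differentiable fg d.
by rewrite -(f_equal (fun L => L 1) (near_eq_diffE fg d)); exact: diff_is_derive.
Qed.

Lemma interval_segment (I : set R) x y (t : R) : is_interval I -> I x -> I y ->
  0 <= t <= 1 -> I (x + t *: (y - x)).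
Proof.
move=> iI Ix Iy /andP[t0 t1]; rewrite scaleE; case: (leP x y) => xy.
  by apply: (iI _ _ Ix Iy); apply/andP; split; nra.
by apply: (iI _ _ Iy Ix); apply/andP; split; nra.
Qed.

Lemma interval_mean_value (I : set R) (F F' : R -> R) x y : is_interval I ->
  (forall t, I t -> is_derive t 1 F (F' t)) -> I x -> I y ->
  exists2 t, I t & F y - F x = F' t * (y - x).
Proof.
move=> iI dF Ix Iy.
have Is (t : R) : 0 <= t <= 1 -> I (x + t *: (y - x)) by exact: interval_segment.
have [t t01|t t01 ->] := @mean_value _ F x y.
  by have [] := is_deriveP (dF _ (Is t t01)).
exists (x + t *: (y - x)); first exact: Is.
have [_ <-] := is_deriveP (dF _ (Is t t01)).
by rewrite mulrC; exact: linear_scalar.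
Qed.

Lemma interval_constant (I : set R) (F : R -> R) x y : is_interval I ->
  (forall t, I t -> is_derive t 1 F 0) -> I x -> I y -> F y = F x.
Proof.
move=> iI dF Ix Iy; have [t _ e] := interval_mean_value iI dF Ix Iy.
by apply/eqP; rewrite -subr_eq0 e mul0r.
Qed.

Lemma open_interval_room (I : set R) x y : open I -> is_interval I -> I x -> I y ->
  exists a b, [/\ a < x, a < y, x < b, y < b & forall z, a <= z <= b -> I z].
Proof.
move=> oI iI Ix Iy.
have room z : I z -> exists2 e : R, 0 < e & I (z - e) /\ I (z + e).
  move=> Iz; have /nbhs_ballP[e /= e0 eI] := open_nbhs_nbhs (conj oI Iz).
  exists (e / 2); first by rewrite divr_gt0.
  split; apply: eI; rewrite -ball_normE /=.
    by rewrite opprB addrC subrK ger0_norm ?divr_ge0 ?ltW// ltr_pdivrMr// mulr_natr mulr2n ltrDl.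
  by rewrite opprD addrA subrr add0r normrN ger0_norm ?divr_ge0 ?ltW// ltr_pdivrMr// mulr_natr mulr2n ltrDl.
have [e e0 [Ie1 Ie2]] := room _ Ix; have [d d0 [Id1 Id2]] := room _ Iy.
exists (Num.min (x - e) (y - d)), (Num.max (x + e) (y + d)).
have Im : I (Num.min (x - e) (y - d)) by rewrite minEle; case: ifP.
have IM : I (Num.max (x + e) (y + d)) by rewrite maxEle; case: ifP.
split; last by move=> z /andP[h1 h2]; apply: (iI _ _ Im IM); apply/andP.
- by rewrite gt_min ltrBlDr ltrDl e0.
- by rewrite gt_min !ltrBlDr !ltrDl d0 orbT.
- by rewrite lt_max ltrDl e0.
- by rewrite lt_max !ltrDl d0 orbT.
Qed.

(** The oriented integral is defined by cases on the order of the end points;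
    a base point to the left of both turns it into one primitive. *)
Lemma oriented_integral_derive (I : set R) (g : R -> R) v : open I -> is_interval I ->
  I 0 -> (forall x, I x -> {for x, continuous g}) -> I v ->
  is_derive v 1 (oriented_integral g 0) (g v).
Proof.
move=> oI iI I0 cg Iv.
have [a [b [a0 av b0 vb abI]]] := open_interval_room oI iI I0 Iv.
have cont c d : a <= c -> d <= b -> {within `[c, d], continuous g}.
  move=> ac db; apply/subspace_continuousP => x; rewrite /= in_itv /= => /andP[cx xd].
  apply: cvg_within_filter; apply: cg; apply: abI.
  by rewrite (le_trans ac cx) (le_trans xd db).
have intg c d : a <= c -> d <= b -> lebesgue_measure.-integrable `[c, d] (EFin \o g).
  by move=> ac db; apply: continuous_compact_integrable; [exact: segment_compact|exact: cont].
pose F x := \int[lebesgue_measure]_(t in `[a, x]) g t.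
have split c d : a <= c -> c <= d -> d <= b ->
    \int[lebesgue_measure]_(t in `[c, d]) g t = F d - F c.
  move=> ac cd db; rewrite /F Rintegral_itvB ?bnd_simp//; last exact: intg.
  rewrite Rintegral_itv_obnd_cbnd//.
  apply: integrableS (intg c d ac db) => // x.
  by rewrite /= !in_itv /= => /andP[/ltW -> ->].
have E x : a < x -> x < b -> oriented_integral g 0 x = F x - F 0.
  move=> ax xb; rewrite /oriented_integral; case: (leP 0 x) => x0.
    exact: (split _ _ (ltW a0) x0 (ltW xb)).
  by rewrite (split _ _ (ltW ax) (ltW x0) (ltW b0)) opprB.
have [dF F'] := @continuous_FTC1_closed _ g a v b vb (intg a b (lexx a) (lexx b)) av (cg v Iv).
have D : is_derive v 1 F (g v) := derive1_is_derive dF F'.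
have D' : is_derive v 1 (fun x => F x - F 0) (g v).
  have := is_deriveB D (is_derive_cst (F 0) v 1); rewrite subr0; exact.
apply: is_derive_near_eq D'.
have oab : open `]a, b[%classic by exact: itv_open.
have vab : `]a, b[%classic v by rewrite /= in_itv /= av vb.
apply: near_open oab vab _ => x; rewrite /= in_itv /= => /andP[ax xb].
by rewrite E.
Qed.

Lemma increasing_inverse (J : set R) (P w : R -> R) : open J -> is_interval J ->
  (forall t, J t -> is_derive t 1 P (w t)) -> (forall t, J t -> 0 < w t) ->
  exists Q : R -> R, [/\ open (P @` J), is_interval (P @` J),
    forall t, J t -> Q (P t) = t &
    forall t, J t -> is_derive (P t) 1 Q (w t)^-1].
Proof.
move=> oJ iJ dP wp.
have Pinj x y : J x -> J y -> P x = P y -> x = y.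
  move=> Jx Jy e; have [t Jt] := interval_mean_value iJ dP Jx Jy.
  rewrite e subrr => /esym/eqP; rewrite mulf_eq0 (gt_eqF (wp t Jt)) /= subr_eq0.
  by move/eqP.
pose Q y := xget 0 [set x | J x /\ P x = y].
have QP t : J t -> Q (P t) = t.
  move=> Jt; rewrite /Q; case: xgetP => [x _ [Jx e]|/(_ t)[]//].
  exact: Pinj.
have nQ t : J t -> {near t, cancel P Q} by move=> Jt; apply: near_open oJ Jt QP.
have nP t : J t -> {near t, continuous P}.
  by move=> Jt; apply: (near_open oJ Jt) => x Jx; exact: is_derive_continuous (dP x Jx).
exists Q; split=> //.
- rewrite openE => _ [t Jt <-].
  have [cQ PQ] := near_can_continuousAcan_sym (nQ t Jt) (nP t Jt).
  have cQt : {for P t, continuous Q} by exact: nbhs_singleton cQ.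
  have nJ : \forall y \near P t, J (Q y).
    apply: (cQt J); rewrite QP//; exact: open_nbhs_nbhs.
  have : \forall y \near P t, J (Q y) /\ P (Q y) = y.
    by apply: filterS2 nJ PQ => y.
  by apply: filterS => y [Jy <-]; exists (Q y).
- apply/connected_intervalP; apply: connected_continuous_connected.
    by apply/connected_intervalP.
  apply/subspace_continuousP => x Jx; apply: cvg_within_filter.
  exact: is_derive_continuous (dP x Jx).
- move=> t Jt; apply: (is_derive_inverse (nQ t Jt) (nP t Jt) (dP t Jt)).
  by rewrite gt_eqF// wp.
Qed.

(** * Linear equations y'' = q y on an open interval *)

Lemma oriented_integral0 (g : R -> R) : oriented_integral g 0 0 = 0.
Proof. by rewrite /oriented_integral lexx set_itv1 Rintegral_set1. Qed.

(** Twice the hyperbolic cosine: a weight that bounds [k] times its own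
    integral from 0, on both sides of 0. With [k] large, integration
    contracts on a segment of any length. *)
Definition dcosh (k t : R) : R := expR (k * t) + expR (- (k * t)).

Lemma dcosh_ge1 k t : 1 <= dcosh k t.
Proof.
rewrite /dcosh; have := expR_ge0 (k * t); have := expR_ge0 (- (k * t)).
case: (leP 0 (k * t)) => h; first by have : 1 <= expR (k * t); [rewrite -expR0 ler_expR|lra].
by have : 1 <= expR (- (k * t)); [rewrite -expR0 ler_expR oppr_ge0 ltW|lra].
Qed.

Lemma is_derive_expR_scale k (t : R) : is_derive t 1 (fun x => expR (k * x)) (k * expR (k * t)).
Proof.
have d : is_derive t 1 (fun x : R => k *: x) (k *: 1) by exact: is_deriveZ.
have de : is_derive (k * t) 1 (@expR R) (expR (k * t)) by exact: is_derive_expR.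
have := is_derive1_comp de d; rewrite scaleE mulr1 mulrC; exact.
Qed.

Lemma dsinh_derive k (t : R) :
  is_derive t 1 (fun x => expR (k * x) - expR (- (k * x))) (k * dcosh k t).
Proof.
have d1 := is_derive_expR_scale k t; have d2 := is_derive_expR_scale (- k) t.
have := is_deriveB d1 d2.
have -> : k * expR (k * t) - - k * expR (- k * t) = k * dcosh k t.
  by rewrite /dcosh mulrDr !mulNr opprK.
rewrite (_ : (fun x => expR (k * x)) - (fun x => expR (- k * x)) =
  fun x => expR (k * x) - expR (- (k * x)))//.
by apply/funext => x; rewrite !fctE mulNr.
Qed.

(** In the norm weighted by [dcosh k], integration from 0 has norm at most
    [k^-1]: compare with the odd primitive of the weight. *)
Lemma primitive_bound (a b k K : R) (z h : R -> R) : a <= 0 <= b -> 0 < k ->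
  (forall t, a <= t <= b -> is_derive t 1 z (h t)) -> z 0 = 0 ->
  (forall t, a <= t <= b -> `|h t| <= K * dcosh k t) ->
  forall t, a <= t <= b -> `|z t| <= K / k * dcosh k t.
Proof.
move=> /andP[a0 b0] k0 dz z0 hK t tab.
pose I := [set t : R | a <= t <= b].
have iI : is_interval I.
  move=> x y /andP[ax xb] /andP[ay yb] c /andP[xc cy]; apply/andP; split.
    exact: le_trans ax xc.
  exact: le_trans cy yb.
have I0 : I 0 by apply/andP.
pose sh (t : R) := K / k * (expR (k * t) - expR (- (k * t))).
have sh0 : sh 0 = 0 by rewrite /sh mulr0 oppr0 subrr mulr0.
have dsh (x : R) : is_derive x 1 sh (K * dcosh k x).
  have := is_deriveZ (K / k) (dsinh_derive k x).
  by rewrite scaleE mulrA divfK ?gt_eqF.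
have d1 (x : R) : I x -> is_derive x 1 (fun y => sh y - z y) (K * dcosh k x - h x).
  by move=> Ix; exact: is_deriveB (dsh x) (dz x Ix).
have d2 (x : R) : I x -> is_derive x 1 (fun y => sh y + z y) (K * dcosh k x + h x).
  by move=> Ix; exact: is_deriveD (dsh x) (dz x Ix).
have [c1 Ic1 e1] := interval_mean_value iI d1 I0 tab.
have [c2 Ic2 e2] := interval_mean_value iI d2 I0 tab.
rewrite sh0 z0 !subr0 in e1; rewrite sh0 z0 addr0 !subr0 in e2.
have p1 : 0 <= K * dcosh k c1 - h c1.
  by rewrite subr_ge0; apply: le_trans (hK _ Ic1); exact: ler_norm.
have p2 : 0 <= K * dcosh k c2 + h c2.
  by have := hK _ Ic2; rewrite ler_norml => /andP[+ _]; rewrite lerNl -subr_ge0 opprK addrC.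
have Kk : 0 <= K / k.
  rewrite divr_ge0 ?(ltW k0)//.
  have := le_trans (normr_ge0 _) (hK _ I0); rewrite pmulr_lge0//.
  exact: lt_le_trans (dcosh_ge1 k 0).
have e3 := expR_ge0 (k * t); have e4 := expR_ge0 (- (k * t)).
have q1 : 0 <= K / k * expR (k * t) by exact: mulr_ge0.
have q2 : 0 <= K / k * expR (- (k * t)) by exact: mulr_ge0.
rewrite ler_norml /dcosh; case: (leP 0 t) => t0.
  have r1 : 0 <= sh t - z t by rewrite e1 mulr_ge0.
  have r2 : 0 <= sh t + z t by rewrite e2 mulr_ge0.
  by move: r1 r2; rewrite /sh mulrBr mulrDr => r1 r2; apply/andP; split; lra.
have r1 : sh t - z t <= 0 by rewrite e1 mulr_ge0_le0// ltW.
have r2 : sh t + z t <= 0 by rewrite e2 mulr_ge0_le0// ltW.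
by move: r1 r2; rewrite /sh mulrBr mulrDr => r1 r2; apply/andP; split; lra.
Qed.

Lemma geometric_small (K e : R) : 0 < e -> exists N, forall n, (N <= n)%N ->
  K * 2^-1 ^+ n < e.
Proof.
move=> e0; have h : `|2^-1 : R| < 1 by rewrite ger0_norm ?invr_ge0// invf_lt1// ltr1n.
have /cvgrPdist_lt/(_ e e0) := @cvg_geometric R K 2^-1 h.
move=> [N _ HN]; exists N => n Nn; have := HN n Nn.
by rewrite /= sub0r normrN; apply: le_lt_trans; exact: ler_norm.
Qed.

Lemma geometric_le0 (x K : R) : (forall n, x <= K * 2^-1 ^+ n) -> x <= 0.
Proof.
move=> H; apply/ler_addgt0Pl => e e0; rewrite addr0.
have [N HN] := geometric_small K e0; apply: le_trans (H N) _.
by apply: ltW; exact: HN.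
Qed.

Lemma segment_bounded (a b : R) (g : R -> R) :
  (forall t, a <= t <= b -> {for t, continuous g}) ->
  exists2 C, 0 <= C & forall t, a <= t <= b -> `|g t| <= C.
Proof.
move=> cg; case: (leP a b) => ab; last first.
  by exists 0 => // t /andP[h1 h2]; have := le_trans h1 h2; rewrite leNgt ab.
have c : {within `[a, b], continuous (fun t => `|g t|)}.
  apply/subspace_continuousP => x; rewrite /= in_itv /= => xab.
  by apply: cvg_within_filter; apply: cvg_norm; exact: cg.
have [m _ Hm] := EVT_max ab c.
by exists `|g m| => // t tab; apply: Hm; rewrite in_itv.
Qed.

Lemma half_sqr_ge (M : R) : 0 <= M -> M <= 2^-1 * ((M + 2) * (M + 2)).
Proof. by move=> M0; have := mulr_ge0 M0 M0; lra. Qed.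

Lemma three_thirds (x x' s s' e : R) : `|s - s'| < e / 3 -> `|x - s| <= e / 3 ->
  `|x' - s'| <= e / 3 -> `|x - x'| <= e.
Proof.
move=> h1 h2 h3; have -> : x - x' = ((x - s) + (s - s')) - (x' - s') by ring.
have := ler_normB ((x - s) + (s - s')) (x' - s'); have := ler_normD (x - s) (s - s').
lra.
Qed.

Section Picard.
Variables (I : set R) (q : R -> R) (c0 c1 : R).
Hypotheses (oI : open I) (iI : is_interval I) (I0 : I 0).
Hypothesis cq : forall x, I x -> {for x, continuous q}.

Let rhs (y : R -> R) x := q x * y x.
Definition picard1 (y : R -> R) t := c1 + oriented_integral (rhs y) 0 t.
Definition picard (y : R -> R) t :=
  c0 + c1 * t + oriented_integral (oriented_integral (rhs y) 0) 0 t.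

Lemma picard_derive (y : R -> R) (t : R) : (forall x, I x -> {for x, continuous y}) -> I t ->
  is_derive t 1 (picard y) (picard1 y t) /\ is_derive t 1 (picard1 y) (q t * y t).
Proof.
move=> cy It.
have cr x : I x -> {for x, continuous (rhs y)}.
  by move=> Ix; apply: cvgM; [exact: cq|exact: cy].
have d1 x : I x -> is_derive x 1 (oriented_integral (rhs y) 0) (rhs y x).
  by move=> Ix; exact: (oriented_integral_derive oI iI I0 cr).
have d2 : is_derive t 1 (oriented_integral (oriented_integral (rhs y) 0) 0)
    (oriented_integral (rhs y) 0 t).
  apply: (oriented_integral_derive oI iI I0) => // x Ix.
  exact: is_derive_continuous (d1 x Ix).
have dl : is_derive t 1 (fun x : R => c0 + c1 * x) c1.
  have := is_deriveD (is_derive_cst c0 t 1) (is_deriveZ c1 (is_derive_id t 1)).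
  by rewrite scaleE mulr1 add0r.
split; first exact: is_deriveD dl d2.
by have := is_deriveD (is_derive_cst c1 t 1) (d1 t It); rewrite add0r.
Qed.

Lemma picard0 (y : R -> R) : picard y 0 = c0 /\ picard1 y 0 = c1.
Proof. by rewrite /picard /picard1 !oriented_integral0 mulr0 !addr0. Qed.

Lemma picard_continuous (y : R -> R) : (forall x, I x -> {for x, continuous y}) ->
  forall x, I x -> {for x, continuous (picard y)}.
Proof. by move=> cy x Ix; have [/is_derive_continuous] := picard_derive cy Ix. Qed.

(** Two integrations gain the factor [M / (M + 2)^2], which is at most one
    half. *)
Lemma picard_contracts (a b M K : R) (y z : R -> R) : a <= 0 <= b -> (forall t, a <= t <= b -> I t) ->
  0 <= M -> (forall t, a <= t <= b -> `|q t| <= M) ->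
  (forall x, I x -> {for x, continuous y}) -> (forall x, I x -> {for x, continuous z}) ->
  (forall t, a <= t <= b -> `|y t - z t| <= K * dcosh (M + 2) t) ->
  forall t, a <= t <= b -> `|picard y t - picard z t| <= K / 2 * dcosh (M + 2) t.
Proof.
move=> ab0 abI M0 qM cy cz yz t tab.
have k0 : 0 < M + 2 by lra.
have d2 x : a <= x <= b ->
    is_derive x 1 (fun x => picard1 y x - picard1 z x) (q x * y x - q x * z x).
  move=> /abI Ix; have [_ dy] := picard_derive cy Ix; have [_ dz] := picard_derive cz Ix.
  exact: is_deriveB dy dz.
have d1 x : a <= x <= b ->
    is_derive x 1 (fun x => picard y x - picard z x) (picard1 y x - picard1 z x).
  move=> /abI Ix; have [dy _] := picard_derive cy Ix; have [dz _] := picard_derive cz Ix.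
  exact: is_deriveB dy dz.
have [y0 y01] := picard0 y; have [z0 z01] := picard0 z.
have zz1 : picard1 y 0 - picard1 z 0 = 0 by rewrite y01 z01 subrr.
have zz0 : picard y 0 - picard z 0 = 0 by rewrite y0 z0 subrr.
have b2 : forall x, a <= x <= b -> `|q x * y x - q x * z x| <= (M * K) * dcosh (M + 2) x.
  move=> x xab; rewrite -mulrBr normrM -mulrA; apply: ler_pM => //; first exact: qM.
  exact: yz.
have b1 := primitive_bound ab0 k0 d2 zz1 b2.
have b0 := primitive_bound ab0 k0 d1 zz0 b1.
apply: le_trans (b0 t tab) _; rewrite ler_wpM2r//.
  by apply: le_trans (dcosh_ge1 _ _); exact: ler01.
have K0 : 0 <= K.
  have := le_trans (normr_ge0 _) (yz t tab); rewrite pmulr_lge0//.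
  exact: lt_le_trans (dcosh_ge1 _ _).
rewrite !ler_pdivrMr// -!mulrA (mulrC M) ler_wpM2l//.
exact: half_sqr_ge.
Qed.

Let S n := iter n picard (fun=> 0).

Lemma picard_iter_continuous n : forall x, I x -> {for x, continuous (S n)}.
Proof.
elim: n => [|n IH]; first by move=> x _; exact: cst_continuous.
exact: picard_continuous.
Qed.

Lemma picard_iter_step (a b : R) : a <= 0 <= b -> (forall t, a <= t <= b -> I t) ->
  exists M C : R, [/\ 0 <= C, 0 <= M, forall t, a <= t <= b -> `|q t| <= M &
    forall n t, a <= t <= b -> `|S n.+1 t - S n t| <= C * 2^-1 ^+ n * dcosh (M + 2) t].
Proof.
move=> ab0 abI.
have [M M0 qM] := segment_bounded (fun t tab => cq (abI t tab)).
have [C C0 SC] : exists2 C, 0 <= C & forall t, a <= t <= b -> `|S 1 t - S 0 t| <= C.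
  apply: (@segment_bounded a b (fun t => S 1 t - S 0 t)) => t /abI It.
  by apply: cvgB; exact: picard_iter_continuous.
exists M, C; split => //; elim=> [|n IH] t tab.
  rewrite expr0 mulr1; apply: le_trans (SC t tab) _.
  by rewrite ler_peMr// dcosh_ge1.
rewrite exprSr mulrA.
exact: (picard_contracts ab0 abI M0 qM (@picard_iter_continuous _) (@picard_iter_continuous _) IH).
Qed.

Lemma picard_iter_tail (a b : R) : a <= 0 <= b -> (forall t, a <= t <= b -> I t) ->
  exists M C : R, [/\ 0 <= C, 0 <= M, forall t, a <= t <= b -> `|q t| <= M &
    forall n m t, a <= t <= b ->
      `|S (n + m)%N t - S n t| <= C * 2^-1 ^+ n * dcosh (M + 2) t].
Proof.
move=> ab0 abI; have [M [C [C0 M0 qM H]]] := picard_iter_step ab0 abI.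
exists M, (C * 2); split => //; first by rewrite mulr_ge0.
move=> n m t tab; set W := dcosh _ _.
have W0 : 0 <= W by apply: le_trans (dcosh_ge1 _ _); exact: ler01.
have CW : 0 <= C * W by exact: mulr_ge0.
suff : `|S (n + m)%N t - S n t| <= C * W * (2^-1 ^+ n * (2 - 2 * 2^-1 ^+ m)).
  move=> /le_trans; apply.
  have -> : C * 2 * 2^-1 ^+ n * W = C * W * (2^-1 ^+ n * 2) by ring.
  rewrite ler_wpM2l// ler_wpM2l ?exprn_ge0 ?invr_ge0//.
  by rewrite gerBl mulr_ge0// exprn_ge0// invr_ge0.
elim: m => [|m IH].
  by rewrite addn0 subrr normr0 expr0 mulr1 subrr !mulr0.
have := H (n + m)%N t tab; rewrite -/W exprD addnS => h.
have := ler_normD (S (n + m).+1 t - S (n + m)%N t) (S (n + m)%N t - S n t).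
rewrite addrA subrK => /le_trans; apply.
apply: le_trans (lerD h IH) _; rewrite exprS le_eqVlt; apply/orP; left; apply/eqP.
by field.
Qed.

(** The iterates converge on each compact subinterval, in a weighted norm
    that depends on it, so the solution exists on the whole interval. *)
Lemma linear_ode2 : exists y y1 : R -> R, [/\ y 0 = c0, y1 0 = c1 &
  forall t, I t -> is_derive t 1 y (y1 t) /\ is_derive t 1 y1 (q t * y t)].
Proof.
have cvS t : I t -> cvgn (S ^~ t).
  move=> It; have [a [b [a0 at0 b0 tb abI]]] := open_interval_room oI iI I0 It.
  have ab0 : a <= 0 <= b by rewrite !ltW.
  have [M [C [C0 M0 qM H]]] := picard_iter_step ab0 abI.
  have tab : a <= t <= b by rewrite !ltW.
  pose u n := S n.+1 t - S n t.
  have -> : S ^~ t = fun n => series u n + S 0 t.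
    apply/funext => n; elim: n => [|n IH]; first by rewrite /series /= big_geq// add0r.
    by rewrite /series /= big_nat_recr//= addrAC -IH /u addrC subrK.
  apply: is_cvgD; last exact: is_cvg_cst.
  apply: normed_cvg; apply: (@series_le_cvg _ _ (geometric (C * dcosh (M + 2) t) 2^-1)).
  - by move=> n; exact: normr_ge0.
  - move=> n; rewrite /geometric /= mulr_ge0 ?exprn_ge0 ?invr_ge0// mulr_ge0//.
    by apply: le_trans (dcosh_ge1 _ _); exact: ler01.
  - by move=> n; rewrite /geometric /= mulrAC; exact: H.
  - apply: is_cvg_geometric_series.
    by rewrite ger0_norm ?invr_ge0// invf_lt1// ltr1n.
pose y t := limn (S ^~ t).
have tail (a b : R) : a <= 0 <= b -> (forall t, a <= t <= b -> I t) ->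
    exists M C : R, [/\ 0 <= C, 0 <= M, forall t, a <= t <= b -> `|q t| <= M &
    forall n t, a <= t <= b -> `|y t - S n t| <= C * 2^-1 ^+ n * dcosh (M + 2) t].
  move=> ab0 abI; have [M [C [C0 M0 qM H]]] := picard_iter_tail ab0 abI.
  exists M, C; split => // n t tab; apply/ler_addgt0Pl => e e0.
  have /cvgrPdist_lt/(_ e e0)[N _ HN] := cvS t (abI t tab).
  have h1 := HN (n + N)%N (leq_addl _ _).
  have h2 := H n N t tab.
  have -> : y t - S n t = (y t - S (n + N)%N t) + (S (n + N)%N t - S n t).
    by rewrite addrA subrK.
  by apply: le_trans (ler_normD _ _) _; apply: lerD => //; exact: ltW.
have cy t : I t -> {for t, continuous y}.
  move=> It; have [a [b [a0 at0 b0 tb abI]]] := open_interval_room oI iI I0 It.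
  have ab0 : a <= 0 <= b by rewrite !ltW.
  have [M [C [C0 M0 qM H]]] := tail a b ab0 abI.
  have cW (x : R) : {for x, continuous (dcosh (M + 2))}.
    apply: cvgD; first exact: is_derive_continuous (is_derive_expR_scale (M + 2) x).
    have := is_derive_continuous (is_derive_expR_scale (- (M + 2)) x).
    rewrite (_ : (fun x => expR (- (M + 2) * x)) = fun x => expR (- ((M + 2) * x)))//.
    by apply/funext => z; rewrite mulNr.
  have [B B0 WB] := @segment_bounded a b _ (fun x _ => cW x).
  apply/cvgrPdist_le => e e0.
  have e3 : 0 < e / 3 by rewrite divr_gt0.
  have [N HN] := geometric_small (C * B) e3; have {}HN := HN N (leqnn N).
  have bd x : a <= x <= b -> `|y x - S N x| <= e / 3.
    move=> xab; apply: le_trans (H N x xab) _; apply: le_trans (ltW HN).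
    rewrite mulrAC ler_wpM2r ?exprn_ge0 ?invr_ge0// ler_wpM2l//.
    by apply: le_trans (ler_norm _) (WB _ xab).
  have /cvgrPdist_lt/(_ _ e3) cS := @picard_iter_continuous N t It.
  have oab : open `]a, b[%classic by exact: itv_open.
  have vab : `]a, b[%classic t by rewrite /= in_itv /= at0 tb.
  have nab : \forall x \near t, a < x < b.
    by apply: (near_open oab vab) => x; rewrite /= in_itv.
  near=> x.
  have xab : a < x < b by near: x.
  have h1 : `|S N t - S N x| < e / 3 by near: x; exact: cS.
  have h2 : `|y t - S N t| <= e / 3 by apply: bd; rewrite !ltW.
  have h3 : `|y x - S N x| <= e / 3 by apply: bd; case/andP: xab => *; rewrite !ltW.
  exact: three_thirds h1 h2 h3.
have yE t : I t -> picard y t = y t.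
  move=> It; have [a [b [a0 at0 b0 tb abI]]] := open_interval_room oI iI I0 It.
  have ab0 : a <= 0 <= b by rewrite !ltW.
  have tab : a <= t <= b by rewrite !ltW.
  have [M [C [C0 M0 qM H]]] := tail a b ab0 abI.
  apply/eqP; rewrite -subr_eq0 -normr_le0; apply: (@geometric_le0 _ (C * dcosh (M + 2) t)) => n.
  have h1 := picard_contracts ab0 abI M0 qM cy (@picard_iter_continuous n) (H n) tab.
  have h2 := H n.+1 t tab.
  have -> : picard y t - y t = (picard y t - picard (S n) t) - (y t - S n.+1 t).
    by rewrite opprB addrA subrK.
  apply: le_trans (ler_normB _ _) _; apply: le_trans (lerD h1 h2) _.
  by rewrite exprS le_eqVlt; apply/orP; left; apply/eqP; field.
exists y, (picard1 y); have [p0 p1] := picard0 y; split; rewrite -?yE//.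
move=> t It; have [d1 d2] := picard_derive cy It; split => //.
apply: is_derive_near_eq d1.
by apply: (near_open oI It) => x Ix; exact: yE.
Unshelve. all: by end_near. Qed.

End Picard.

(** * Unit-speed curves on the light cone *)

Lemma is_derive_mdot (F H : R -> V3) (v : R) F' H' : is_derive v 1 F F' ->
  is_derive v 1 H H' ->
  is_derive v 1 (fun x => mdot (F x) (H x)) (mdot (F v) H' + mdot F' (H v)).
Proof.
move=> /is_deriveP[dF <-] /is_deriveP[dH <-].
have D : differentiable (fun x => mdot (F x) (H x)) v.
  have e i := differentiable_entry i 0 dF; have e' i := differentiable_entry i 0 dH.
  have m i : differentiable (fun y => F y i 0 * H y i 0) v.
    exact: (@differentiableM _ _ (fun y => F y i 0) (fun y => H y i 0)).
  have mN : differentiable (fun y => - (F y 0 0 * H y 0 0)) v by exact: differentiableN.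
  exact: differentiableD (differentiableD mN (m 1)) (m 2).
by rewrite -(diff_mdot (1 : R) dF dH); exact: diff_is_derive.
Qed.

Lemma is_derive_entry (F : R -> V3) (v : R) F' i : is_derive v 1 F F' ->
  is_derive v 1 (fun x => F x i 0) (F' i 0).
Proof.
move=> /is_deriveP[dF <-]; rewrite -(diff_entry i 0 (1 : R) dF).
exact: diff_is_derive (differentiable_entry i 0 dF).
Qed.

Lemma is_derive_col3 (F : R -> V3) (v : R) (F' : V3) :
  (forall i, is_derive v 1 (fun x => F x i 0) (F' i 0)) -> is_derive v 1 F F'.
Proof.
move=> H; have dF : differentiable F v.
  by apply: differentiable_col3 => i; have [] := is_deriveP (H i).
have -> : F' = 'd F v 1.
  apply/matrixP => i j; rewrite ord1; have [_ <-] := is_deriveP (H i).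
  exact: diff_entry.
exact: diff_is_derive.
Qed.

Lemma is_derive_unique V (F : R -> V) (v : R) a b :
  is_derive v 1 F a -> is_derive v 1 F b -> a = b.
Proof. by move=> [_ <-] [_ <-]. Qed.

Lemma is_derive_locally_cst V (I : set R) (F : R -> V) (v : R) c d : open I -> I v ->
  (forall x, I x -> F x = c) -> is_derive v 1 F d -> d = 0.
Proof.
move=> oI Iv Fc dF; apply: is_derive_unique dF _.
apply: is_derive_near_eq (is_derive_cst c v 1).
by apply: (near_open oI Iv) => x Ix; rewrite Fc.
Qed.

(** [G] runs on the light cone with unit speed. Its primitives are the null
    curves parametrized by pseudo-arclength. *)
Definition null_curve (I : set R) (G G1 G2 : R -> V3) : Prop :=
  forall v, I v -> [/\ is_derive v 1 G (G1 v), is_derive v 1 G1 (G2 v),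
    mdot (G v) (G v) = 0 & mdot (G1 v) (G1 v) = 1].

Lemma null_curve_gram (I : set R) G G1 G2 v : open I -> null_curve I G G1 G2 -> I v ->
  [/\ mdot (G v) (G1 v) = 0, mdot (G v) (G2 v) = - 1 & mdot (G1 v) (G2 v) = 0].
Proof.
move=> oI nc Iv.
have g01 x : I x -> mdot (G x) (G1 x) = 0.
  move=> Ix; have [d1 _ _ _] := nc x Ix.
  have := is_derive_locally_cst oI Ix (fun y Iy => let: And4 _ _ h _ := nc y Iy in h)
    (is_derive_mdot d1 d1).
  by rewrite (mdotC (G1 x)); lra.
have [d1 d2 _ n1] := nc v Iv.
split; first exact: g01.
  have := is_derive_locally_cst oI Iv g01 (is_derive_mdot d1 d2).
  by rewrite n1; lra.
have := is_derive_locally_cst oI Iv (fun y Iy => let: And4 _ _ _ h := nc y Iy in h)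
    (is_derive_mdot d2 d2).
by rewrite (mdotC (G2 v)); lra.
Qed.

Definition columns (a b c : V3) : 'M[R]_3 := \matrix_(i, j) [:: a i 0; b i 0; c i 0]`_j.

Lemma columnsE a b c :
  [/\ col 0 (columns a b c) = a, col 1 (columns a b c) = b & col 2 (columns a b c) = c].
Proof. by split; apply/matrixP => i j; rewrite ord1 !mxE. Qed.

Lemma mul_col (A B : 'M[R]_3) i : A *m col i B = col i (A *m B).
Proof. by apply/matrixP => k j; rewrite !mxE; apply: eq_bigr => l _; rewrite mxE. Qed.

Lemma null_gram_expand a b c w : null_gram (columns a b c) ->
  w = mdot c w *: a + mdot b w *: b + mdot a w *: c.
Proof.
move=> g; have u := null_gram_unit g; have [e0 e1 e2] := null_gram_coord w g u.
have [c0 c1 c2] := columnsE a b c; rewrite c0 c1 c2 in e0 e1 e2.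
by rewrite -{1}(mulKVmx u w) mulmx_cols e0 e1 e2 c0 c1 c2.
Qed.

(** The form has the same matrix in both frames, so the change of frame
    preserves it. *)
Lemma null_gram_isometry E F : null_gram E -> null_gram F ->
  exists2 A, O21 A & forall i, A *m col i E = col i F.
Proof.
move=> gE gF; have uE := null_gram_unit gE.
have form (M : 'M[R]_3) (c d : V3) : null_gram M ->
    mdot (M *m c) (M *m d) = c 0 0 * d 2 0 + c 1 0 * d 1 0 + c 2 0 * d 0 0.
  move=> [[g00 g01 g12 g22] g02 g11]; rewrite !mulmx_cols !mdotDl !mdotDr !mdotZl !mdotZr.
  rewrite (mdotC (col 2 M) (col 0 M)) (mdotC (col 2 M) (col 1 M)) (mdotC (col 1 M) (col 0 M)).
  by rewrite g00 g01 g12 g22 g02 g11; ring.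
exists (F *m invmx E) => [v w|i].
  by rewrite -!mulmxA form// -(form E)// !mulKVmx.
by rewrite -mulmxA mul_col mulVmx// mul_col mulmx1.
Qed.

(** The coefficient of [G] is the one that makes the third vector null. *)
Lemma null_curve_frame (I : set R) G G1 G2 v (f : R) : open I -> null_curve I G G1 G2 ->
  I v -> mdot (G2 v) (G2 v) = - (2 * f) ->
  null_gram (columns (G v) (G1 v) (f *: G v - G2 v)).
Proof.
move=> oI nc Iv n2; have [g01 g02 g12] := null_curve_gram oI nc Iv.
have [_ _ g00 g11] := nc v Iv; have [c0 c1 c2] := columnsE (G v) (G1 v) (f *: G v - G2 v).
rewrite /null_gram c0 c1 c2 !(mdotBl, mdotBr, mdotZl, mdotZr) (mdotC (G2 v) (G v)).
by rewrite (mdotC (G1 v) (G v)) g00 g01 g02 g11 g12 n2; split; [split|..]; ring.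
Qed.

(** Differentiating the constant inner products of [G], [G'] and [G''] gives
    the components of the third derivative in the null frame: this is the
    third-order equation. *)
Lemma null_curve_third (I : set R) G G1 G2 G3 v : open I -> null_curve I G G1 G2 ->
  (forall x, I x -> is_derive x 1 G2 (G3 x)) -> I v ->
  let f x := - 2^-1 * mdot (G2 x) (G2 x) in
  is_derive v 1 f (- mdot (G2 v) (G3 v)) /\
  G3 v = (2 * f v) *: G1 v - mdot (G2 v) (G3 v) *: G v.
Proof.
move=> oI nc d3 Iv f; split.
  have := is_deriveZ (- 2^-1) (is_derive_mdot (d3 v Iv) (d3 v Iv)).
  rewrite scaleE (mdotC (G3 v)) (_ : _ * _ = - mdot (G2 v) (G3 v)); first exact.
  by field.
have [d1 d2 _ _] := nc v Iv; have [g01 g02 g12] := null_curve_gram oI nc Iv.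
have g03 : mdot (G v) (G3 v) = 0.
  have := is_derive_locally_cst oI Iv
    (fun y Iy => let: And3 _ h _ := null_curve_gram oI nc Iy in h) (is_derive_mdot d1 (d3 v Iv)).
  by rewrite g12 addr0.
have g13 : mdot (G1 v) (G3 v) = 2 * f v.
  have := is_derive_locally_cst oI Iv
    (fun y Iy => let: And3 _ _ h := null_curve_gram oI nc Iy in h) (is_derive_mdot d2 (d3 v Iv)).
  by rewrite /f => h; lra.
have n2 : mdot (G2 v) (G2 v) = - (2 * f v) by rewrite /f; field.
have E := null_gram_expand (G3 v) (null_curve_frame oI nc Iv n2).
rewrite {1}E g03 g13 scale0r addr0 addrC; congr (_ + _); rewrite -scaleNr; congr (_ *: _).
by rewrite mdotC mdotBr mdotZr (mdotC _ (G v)) g03 (mdotC (G3 v)) mulr0 add0r.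
Qed.

(** * The third-order equation of the curve *)

Lemma is_derive_derivable V (F : R -> V) (v : R) d : is_derive v 1 F d -> derivable F v 1.
Proof. by case. Qed.

Lemma derive1_on V (I : set R) (F F' : R -> V) v : (forall x, I x -> is_derive x 1 F (F' x)) ->
  I v -> derive1 F v = F' v.
Proof. by move=> dF Iv; rewrite derive1E; have [_ ->] := dF v Iv. Qed.

Lemma derive1_chain V (I : set R) (F F' F'' : R -> V) : open I ->
  (forall x, I x -> F x = F' x) -> (forall x, I x -> is_derive x 1 F' (F'' x)) ->
  forall x, I x -> is_derive x 1 F (F'' x).
Proof.
move=> oI e d x Ix; apply: is_derive_near_eq (d x Ix).
by apply: (near_open oI Ix) => y Iy; rewrite e.
Qed.

Definition initial0 : V3 := let s : R := (Num.sqrt 2)^-1 in s *: col3 1 1 0.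
Definition initial1 : V3 := let s : R := (Num.sqrt 2)^-1 in col3 s s 1.
Definition initial2 (f0 : R) : V3 :=
  let s : R := (Num.sqrt 2)^-1 in col3 (s * (f0 + 3 / 2)) (s * (f0 - 1 / 2)) 1.

Lemma is_solutionI (f f1 : R -> R) (I : set R) (G G1 G2 : R -> V3) : open I -> I 0 ->
  (forall v, I v -> is_derive v 1 f (f1 v)) ->
  (forall v, I v -> is_derive v 1 G (G1 v)) ->
  (forall v, I v -> is_derive v 1 G1 (G2 v)) ->
  (forall v, I v -> is_derive v 1 G2 ((2 * f v) *: G1 v + f1 v *: G v)) ->
  G 0 = initial0 -> G1 0 = initial1 -> G2 0 = initial2 (f 0) -> is_solution f I G.
Proof.
move=> oI I0 df d0 d1 d2 i0 i1 i2.
have e1 := fun v Iv => derive1_on (v := v) d0 Iv.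
have d1' := derive1_chain oI e1 d1.
have e2 := fun v Iv => derive1_on (v := v) d1' Iv.
have d2' := derive1_chain oI e2 d2.
have e3 := fun v Iv => derive1_on (v := v) d2' Iv.
split => //=; last 2 first.
- by rewrite e1.
- by rewrite [LHS]e2.
- case=> [|[|[|k]]] v k3 Iv; last by exfalso; move: k3; rewrite !ltnS ltn0.
  + exact: is_derive_derivable (d0 v Iv).
  + exact: is_derive_derivable (d1' v Iv).
  + exact: is_derive_derivable (d2' v Iv).
- move=> v Iv; rewrite [X in X - _ - _]e3// e1// (derive1_on df Iv).
  by rewrite addrAC addrK subrr.
Qed.

Lemma is_solutionE (f : R -> R) (I : set R) (G : R -> V3) v : is_solution f I G -> I v ->
  [/\ is_derive v 1 G (derive1 G v), is_derive v 1 (derive1 G) (derive1n 2 G v) &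
      is_derive v 1 (derive1n 2 G)
        ((2 * f v) *: derive1 G v + derive1 f v *: G v)].
Proof.
move=> [d e _ _ _] Iv; split; apply: derive1_is_derive => //.
- exact: (d 0%N).
- exact: (d 1%N).
- exact: (d 2%N).
- have /eqP := e v Iv; rewrite subr_eq0 subr_eq => /eqP E.
  by rewrite addrC; exact: E.
Qed.

(** The operator of the equation is skew-adjoint, so two solutions [z] and
    [g] have a constant bilinear concomitant. *)
Lemma concomitant_derive (z z1 z2 g g1 g2 f : R -> R) (f1 v : R) :
  is_derive v 1 z (z1 v) -> is_derive v 1 z1 (z2 v) ->
  is_derive v 1 z2 (2 * f v * z1 v + f1 * z v) ->
  is_derive v 1 g (g1 v) -> is_derive v 1 g1 (g2 v) ->
  is_derive v 1 g2 (2 * f v * g1 v + f1 * g v) -> is_derive v 1 f f1 ->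
  is_derive v 1 (fun x => z x * g2 x - z1 x * g1 x + z2 x * g x - 2 * f x * z x * g x) 0.
Proof.
move=> dz dz1 dz2 dg dg1 dg2 df.
have m1 := is_deriveM dz dg2; have m2 := is_deriveM dz1 dg1; have m3 := is_deriveM dz2 dg.
have m4 := is_deriveM (is_deriveM (is_deriveZ 2 df) dz) dg.
have := is_deriveB (is_deriveD (is_deriveB m1 m2) m3) m4.
set D := (X in is_derive _ _ _ X -> _); have -> : D = 0.
  have -> : D = z v * (2 * f v * g1 v + f1 * g v) + g2 v * z1 v -
      (z1 v * g2 v + g1 v * z2 v) + (z2 v * g1 v + g v * (2 * f v * z1 v + f1 * z v)) -
      (2 * f v * z v * g1 v + g v * (2 * f v * z1 v + z v * (2 * f1))) by [].
  by ring.
exact.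
Qed.

(** The concomitants of a component [z] of the difference with the three
    components of [G] vanish. They form a combination of [G''], [G'] and [G]
    whose product with [G] is [- z]. *)
Lemma null_curve_unique (f f1 : R -> R) (I : set R) (G G1 G2 H H1 H2 : R -> V3) :
  open I -> is_interval I -> I 0 ->
  null_curve I G G1 G2 ->
  (forall v, I v -> is_derive v 1 f (f1 v)) ->
  (forall v, I v -> is_derive v 1 G2 ((2 * f v) *: G1 v + f1 v *: G v)) ->
  (forall v, I v -> [/\ is_derive v 1 H (H1 v), is_derive v 1 H1 (H2 v) &
     is_derive v 1 H2 ((2 * f v) *: H1 v + f1 v *: H v)]) ->
  H 0 = G 0 -> H1 0 = G1 0 -> H2 0 = G2 0 -> forall v, I v -> H v = G v.
Proof.
move=> oI iI I0 nc df dG2 dH e0 e1 e2 v Iv.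
apply/matrixP => j j'; rewrite ord1 {j'}.
pose z x := H x j 0 - G x j 0; pose z1 x := H1 x j 0 - G1 x j 0.
pose z2 x := H2 x j 0 - G2 x j 0.
have dz x : I x -> [/\ is_derive x 1 z (z1 x), is_derive x 1 z1 (z2 x) &
    is_derive x 1 z2 (2 * f x * z1 x + f1 x * z x)].
  move=> Ix; have [h1 h2 h3] := dH x Ix; have [k1 k2 _ _] := nc x Ix.
  split.
  - exact: is_deriveB (is_derive_entry j h1) (is_derive_entry j k1).
  - exact: is_deriveB (is_derive_entry j h2) (is_derive_entry j k2).
  - have := is_deriveB (is_derive_entry j h3) (is_derive_entry j (dG2 x Ix)).
    set D := (X in is_derive _ _ _ X -> _); have -> : D = 2 * f x * z1 x + f1 x * z x.
      by rewrite /D /z1 /z !mxE; ring.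
    exact.
pose B i x := z x * G2 x i 0 - z1 x * G1 x i 0 + z2 x * G x i 0 - 2 * f x * z x * G x i 0.
have dB i x : I x -> is_derive x 1 (B i) 0.
  move=> Ix; have [a1 a2 a3] := dz x Ix; have [k1 k2 _ _] := nc x Ix.
  have k3 : is_derive x 1 (fun y => G2 y i 0) (2 * f x * G1 x i 0 + f1 x * G x i 0).
    by have := is_derive_entry i (dG2 x Ix); rewrite !mxE.
  exact: (concomitant_derive a1 a2 a3 (is_derive_entry i k1) (is_derive_entry i k2) k3 (df x Ix)).
have B0 i : B i v = 0.
  rewrite (interval_constant iI (dB i) I0 Iv) /B /z /z1 /z2 e0 e1 e2 !subrr.
  by rewrite !mul0r !mulr0 mul0r subrr !addr0 subrr.
have [g01 g02 g12] := null_curve_gram oI nc Iv; have [_ _ g00 _] := nc v Iv.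
have : mdot (G v) (z v *: G2 v - z1 v *: G1 v + z2 v *: G v - (2 * f v * z v) *: G v) = 0.
  rewrite (_ : _ - _ = 0) ?mdot0r//.
  apply/matrixP => i i'; rewrite ord1 [RHS]mxE -(B0 i) /B !mxE; ring.
rewrite !(mdotBr, mdotDr, mdotZr) g00 g01 g02 !mulr0 subr0 addr0 subr0 mulrN1.
by move/eqP; rewrite oppr_eq0 subr_eq0 => /eqP.
Qed.

Lemma unique_solutionI (f f1 : R -> R) (I : set R) (G G1 G2 : R -> V3) :
  open_interval0 I -> null_curve I G G1 G2 ->
  (forall v, I v -> is_derive v 1 f (f1 v)) ->
  (forall v, I v -> is_derive v 1 G2 ((2 * f v) *: G1 v + f1 v *: G v)) ->
  G 0 = initial0 -> G1 0 = initial1 -> G2 0 = initial2 (f 0) -> unique_solution f I G.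
Proof.
move=> [oI iI I0] nc df d2 i0 i1 i2; split.
  apply: (is_solutionI oI I0 df _ _ d2) => // v Iv; first by have [] := nc v Iv.
  by have [] := nc v Iv.
move=> H sH; have [_ _ j0 j1 j2] := sH.
apply: (null_curve_unique oI iI I0 nc df d2 (H1 := derive1 H) (H2 := derive1n 2 H)).
- by move=> v Iv; have [h1 h2] := is_solutionE sH Iv; rewrite (derive1_on df Iv).
- by rewrite j0 i0.
- by rewrite j1 i1.
- by rewrite j2 i2.
Qed.

(** * The tangent developable of a null curve *)

(** An immersion is locally a homeomorphism onto its image: compose it with a
    left inverse of its differential. *)
Lemma immersion_local (D : set R2) (X : R2 -> V3) q : open D -> D q -> smooth_on D X ->
  (forall x, D x -> injective ('d X x)) ->
  exists W : set R2, [/\ W q, W `<=` D & regular_parametrization W X (X @` W)].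
Proof.
move=> oD Dq sX Xinj; have [L cL LX] := space_left_inverse (Xinj q Dq).
have dX : differentiable X q := smooth_diff sX Dq.
have CF : class_C 1 D (L \o X) by apply: class_C_lin.
have Finj : injective ('d (L \o X) q).
  have e h : 'd (L \o X) q h = h.
    apply: (etrans (diff_comp_fun h dX (linear_differentiable _ cL))).
    by rewrite diff_lin_fun// LX.
  by move=> x y; rewrite !e.
have [d d0 [BD _ [g gP]]] := inverse_function oD Dq CF Finj.
exists (ball q d); split => //; first exact: ballxx.
split => //; first exact: ball_open.
- by move=> k; apply: class_C_sub BD _.
- by move=> x /BD; exact: Xinj.
exists (g \o L); split; first by move=> x bx; have [] := gP x bx.
apply/subspace_continuousP => _ [x bx <-]; apply: cvg_within_filter.
have [_ cg] := gP x bx.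
exact: (continuous_comp (@cL (X x)) cg).
Qed.

Lemma diff_comp_scalar V W (p : V -> R) (f : R -> W) (f' : W) x h : differentiable p x ->
  is_derive (p x) 1 f f' -> 'd (fun y => f (p y)) x h = 'd p x h *: f'.
Proof.
move=> dp /is_deriveP[df <-]; apply: (etrans (diff_comp_fun h dp df)).
exact: linear_scalar.
Qed.

Lemma fst_continuous : continuous (fst : R2 -> R).
Proof. by move=> x; exact: cvg_fst. Qed.

Lemma snd_continuous : continuous (snd : R2 -> R).
Proof. by move=> x; exact: cvg_snd. Qed.

Lemma diff_fst (x h : R2) : differentiable (fst : R2 -> R) x /\ 'd (fst : R2 -> R) x h = h.1.
Proof.
have c : continuous (fst : R2 -> R) := fst_continuous.
split; first exact: (@linear_differentiable _ R2 R fst x c).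
exact: (@diff_lin_fun R2 R fst x h c).
Qed.

Lemma diff_snd (x h : R2) : differentiable (snd : R2 -> R) x /\ 'd (snd : R2 -> R) x h = h.2.
Proof.
have c : continuous (snd : R2 -> R) := snd_continuous.
split; first exact: (@linear_differentiable _ R2 R snd x c).
exact: (@diff_lin_fun R2 R snd x h c).
Qed.

Lemma smooth_primitive V (I : set R) (Y G : R -> V) : open I ->
  (forall v, I v -> is_derive v 1 Y (G v)) -> smooth_on I G -> smooth_on I Y.
Proof.
move=> oI dY sG [|k]; first by move=> v Iv; exact: is_derive_continuous (dY v Iv).
exact: class_C_derive1 oI dY (sG k).
Qed.

Definition oint (G : R -> V3) (v : R) : V3 :=
  \col_i oriented_integral (fun t => G t i 0) 0 v.

Lemma oint0 G : oint G 0 = 0.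
Proof. by apply/matrixP => i j; rewrite !mxE oriented_integral0. Qed.

Lemma developable_algebra (r s c a b d g g' : V3) (h1 h2 x x' : R) :
  r = s - c -> c = 0 -> s = a - b -> a = x *: d + x' *: g -> x' = h1 *: x ->
  d = h2 *: g' -> b = h2 *: g -> r = (h1 * x) *: g + h2 *: (x *: g' - g).
Proof.
move=> -> -> -> -> -> -> ->; rewrite subr0 scaleE scalerBr !scalerA (mulrC x).
by rewrite (addrC (_ *: g')) addrA.
Qed.

Section SurfaceMap.
Variables (I : set R) (G G1 G2 : R -> V3).
Hypotheses (hI : open_interval0 I) (nc : null_curve I G G1 G2) (sG : smooth_on I G).
Let D := [set: R] `*` I.

Lemma open_strip : open D.
Proof.
have [oI _ _] := hI.
have -> : D = (snd : R2 -> R) @^-1` I by apply/seteqP; split => -[u v] //= [].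
by apply: open_comp => // x _; exact: snd_continuous.
Qed.

Lemma oint_derive v : I v -> is_derive v 1 (oint G) (G v).
Proof.
have [oI iI I0] := hI; move=> Iv; apply: is_derive_col3 => i.
have cG x : I x -> {for x, continuous (fun t => G t i 0)}.
  move=> Ix; have [d _ _ _] := nc Ix; exact: is_derive_continuous (is_derive_entry i d).
have := oriented_integral_derive oI iI I0 cG Iv.
by rewrite (_ : (fun x => oint G x i 0) = oriented_integral (fun t => G t i 0) 0)//;
  apply/funext => x; rewrite mxE.
Qed.

Lemma surface_map_smooth : smooth_on D (surface_map G).
Proof.
have [oI _ _] := hI; have oD := open_strip; move=> k.
have C1 : class_C k D (fun q : R2 => expR q.1).
  by apply: class_C_expR => //; apply: (@class_C_linear k R2 R D fst); exact: fst_continuous.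
have C2 : class_C k D (snd : R2 -> R).
  by apply: (@class_C_linear k R2 R D snd); exact: snd_continuous.
have DI x : D x -> I x.2 by case.
have CG : class_C k D (G \o snd) := class_C_comp oD DI C2 (sG k).
have CY : class_C k D (oint G \o snd).
  exact: class_C_comp oD DI C2 (smooth_primitive oI oint_derive sG k).
apply: (class_CB oD (class_CB oD (class_CZ oD C1 CG) CY)).
exact: class_C_cst.
Qed.

Lemma surface_map_diff q h : D q -> 'd (surface_map G) q h =
  (h.1 * expR q.1) *: G q.2 + h.2 *: (expR q.1 *: G1 q.2 - G q.2).
Proof.
move=> [_ Iv]; have [d1 _ _ _] := nc Iv; have dY := oint_derive Iv.
have [f1 f1E] := diff_fst q h; have [f2 f2E] := diff_snd q h.
have dE : is_derive q.1 1 (@expR R) (expR q.1) by exact: is_derive_expR.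
have [DE _] := is_deriveP dE; have [DG _] := is_deriveP d1; have [DY _] := is_deriveP dY.
have eE := etrans (diff_comp_scalar h f1 dE) (f_equal (fun z => z *: expR q.1) f1E).
have eG := diff_comp_scalar h f2 d1; rewrite f2E in eG.
have eY := diff_comp_scalar h f2 dY; rewrite f2E in eY.
have cE : differentiable (fun q : R2 => expR q.1) q := differentiable_comp f1 DE.
have cG : differentiable (fun q : R2 => G q.2) q := differentiable_comp f2 DG.
have cY : differentiable (fun q : R2 => oint G q.2) q := differentiable_comp f2 DY.
have [cEG _] := is_diff_scale cE cG.
have cA : differentiable (fun q : R2 => expR q.1 *: G q.2 - oint G q.2) q.
  exact: differentiableB cEG cY.
have e1 : 'd (surface_map G) q h =
    'd (fun q : R2 => expR q.1 *: G q.2 - oint G q.2) q h - 'd (fun _ : R2 => G 0) q h.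
  exact: (diffB_fun h cA (differentiable_cst (G 0) q)).
exact: (developable_algebra e1 (diff_cst_fun _ _ _) (diffB_fun h cEG cY)
  (diffZ_fun h cE cG) eE eG eY).
Qed.

(** Products with [G'] and [G''] recover the two components of the vector. *)
Lemma surface_map_immersion q : D q -> injective ('d (surface_map G) q).
Proof.
move=> Dq; have [oI _ _] := hI; have Iv := Dq.2.
have [_ _ g00 g11] := nc Iv; have [g01 g02 g12] := null_curve_gram oI nc Iv.
suff H h : 'd (surface_map G) q h = 0 -> h = 0.
  move=> x y e; apply/eqP; rewrite -subr_eq0; apply/eqP/H.
  by rewrite linearB e subrr.
rewrite surface_map_diff// => e.
have := f_equal (mdot (G1 q.2)) e; have := f_equal (mdot (G2 q.2)) e.
rewrite !(mdotDr, mdotZr, mdotNr) !mdot0r !(mdotC _ (G q.2)) (mdotC (G2 _) (G1 _)).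
rewrite g01 g02 g11 g12; have := expR_gt0 q.1; case: h {e} => a b /= E0 E1 E2.
have b0 : b = 0.
  have : b * expR q.1 = 0 by lra.
  by move/eqP; rewrite mulf_eq0 (gt_eqF E0) orbF => /eqP.
have a0 : a = 0.
  have : a * expR q.1 = 0 by move: E1; rewrite b0; lra.
  by move/eqP; rewrite mulf_eq0 (gt_eqF E0) orbF => /eqP.
by rewrite a0 b0.
Qed.

End SurfaceMap.

(** * Existence of the curve with a prescribed function *)

Lemma is_derive_mulR (f g : R -> R) (x f' g' : R) : is_derive x 1 f f' ->
  is_derive x 1 g g' -> is_derive x 1 (fun y => f y * g y) (f x * g' + f' * g x).
Proof. by move=> df dg; have := is_deriveM df dg; rewrite !scaleE (mulrC (g x)); exact. Qed.

Lemma is_derive_addR V (f g : R -> V) (x : R) f' g' : is_derive x 1 f f' ->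
  is_derive x 1 g g' -> is_derive x 1 (fun y => f y + g y) (f' + g').
Proof. by move=> df dg; exact: is_deriveD. Qed.

Lemma is_derive_scale V (f : R -> V) (k x : R) f' : is_derive x 1 f f' ->
  is_derive x 1 (fun y => k *: f y) (k *: f').
Proof. by move=> df; exact: is_deriveZ. Qed.

Lemma is_derive_scalel V (p : R -> R) (x p' : R) (w : V) : is_derive x 1 p p' ->
  is_derive x 1 (fun y => p y *: w) (p' *: w).
Proof.
move=> /is_deriveP[dp <-]; have e := diffZ_fun (1 : R) dp (differentiable_cst w x).
rewrite diff_cst_fun scaler0 add0r in e; rewrite -e; apply: diff_is_derive.
exact: differentiableZl.
Qed.

Lemma is_derive_comb3 (p r t : R -> R) (x p' r' t' : R) (A B C : V3) :
  is_derive x 1 p p' -> is_derive x 1 r r' -> is_derive x 1 t t' ->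
  is_derive x 1 (fun y => p y *: A + r y *: B + t y *: C) (p' *: A + r' *: B + t' *: C).
Proof.
move=> dp dr dt; have h1 := is_derive_scalel A dp; have h2 := is_derive_scalel B dr.
exact: is_derive_addR (is_derive_addR h1 h2) (is_derive_scalel C dt).
Qed.

Lemma smooth_ode2 (I : set R) (q y y1 : R -> R) : open I -> smooth_on I q ->
  (forall t, I t -> is_derive t 1 y (y1 t) /\ is_derive t 1 y1 (q t * y t)) ->
  smooth_on I y /\ smooth_on I y1.
Proof.
move=> oI sq dy.
have H k : class_C k I y /\ class_C k I y1.
  elim: k => [|k [Cy Cy1]].
    by split=> t It; [have [/is_derive_continuous] := dy t It|have [_ /is_derive_continuous] := dy t It].
  split; first by apply: (class_C_derive1 oI _ Cy1) => t It; have [] := dy t It.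
  apply: (class_C_derive1 oI _ (class_CM oI (sq k) Cy)) => t It.
  by have [_] := dy t It.
by split=> k; have [] := H k.
Qed.

Lemma sqrt2_inv : (Num.sqrt 2 : R)^-1 * (Num.sqrt 2)^-1 = 2^-1.
Proof. by rewrite -invfM -expr2 sqr_sqrtr. Qed.

(** The third coefficient in the representation of the solution by products:
    [initial2 f0 = f0 *: initial0 + 2 *: initial_conull]. *)
Definition initial_conull : V3 := let s : R := (Num.sqrt 2)^-1 in
  col3 (s * (3 / 4)) (- (s / 4)) (1 / 2).

Lemma initial_gram : let A := initial0 in let B := initial1 in let C := initial_conull in
  [/\ mdot A A = 0, mdot A B = 0 & mdot B B = 1] /\
  [/\ mdot A C = - 2^-1, mdot B C = 0 & mdot C C = 0].
Proof.
rewrite /initial0 /initial1 /initial_conull /mdot /= !mxE /=; set s := (Num.sqrt 2)^-1.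
have s2 : s * s = 2^-1 := sqrt2_inv.
have e (x y : R) : (s * x) * (s * y) = 2^-1 * (x * y) by rewrite mulrACA s2.
have e1 (x : R) : (s * x) * s = 2^-1 * x by rewrite mulrAC s2.
have e2 (x : R) : s * (s * x) = 2^-1 * x by rewrite mulrA s2.
rewrite !(mulrN, mulNr) !(e, e1, e2) s2.
by split; split; lra.
Qed.

Lemma initial2E f0 : initial2 f0 = f0 *: initial0 + 2 *: initial_conull.
Proof.
by apply: cV3P; rewrite /initial2 /initial0 /initial_conull !mxE /=; field;
  rewrite sqrtr_eq0 -ltNge.
Qed.

Lemma gram_comb (A B C : V3) (p r t : R) : mdot A A = 0 -> mdot A B = 0 ->
  mdot B B = 1 -> mdot A C = - 2^-1 -> mdot B C = 0 -> mdot C C = 0 ->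
  mdot (p *: A + r *: B + t *: C) (p *: A + r *: B + t *: C) = r * r - p * t.
Proof.
move=> AA AB BB AC BC CC; rewrite !(mdotDl, mdotDr, mdotZl, mdotZr).
by rewrite (mdotC B A) (mdotC C A) (mdotC C B) AA AB BB AC BC CC; field.
Qed.

(** The equation is the symmetric square of [y'' = (f / 2) y]: products of
    two solutions of the latter solve it. For the curve [a^2 A + a b B + b^2
    C] the square of the speed is the square of the Wronskian of [a] and [b],
    which is 1. *)
Lemma null_curve_exists (f : R -> R) (I : set R) : open_interval0 I -> smooth_on I f ->
  exists G G1 G2, [/\ null_curve I G G1 G2, smooth_on I G & unique_solution f I G].
Proof.
move=> hI sf; have [oI iI I0] := hI.
pose q x := 2^-1 * f x.
have sq : smooth_on I q by move=> k; apply: class_CM => //; exact: class_C_cst.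
have cq x : I x -> {for x, continuous q} by exact: sq 0%N x.
have [a [a1 [a0 a10 da]]] := linear_ode2 1 0 oI iI I0 cq.
have [b [b1 [b0 b10 db]]] := linear_ode2 0 1 oI iI I0 cq.
have [sa _] := smooth_ode2 oI sq da; have [sb _] := smooth_ode2 oI sq db.
have [[AA AB BB] [AC BC CC]] := initial_gram.
set A := initial0 in AA AB AC; set B := initial1 in AB BB BC; set C := initial_conull in AC BC CC.
have wr v : I v -> a v * b1 v - a1 v * b v = 1.
  have dw x : I x -> is_derive x 1 (fun y => a y * b1 y - a1 y * b y) 0.
    move=> Ix; have [h1 h2] := da x Ix; have [k1 k2] := db x Ix.
    have := is_deriveB (is_derive_mulR h1 k2) (is_derive_mulR h2 k1).
    set D := (X in is_derive _ _ _ X -> _); have -> : D = 0 by rewrite /D; ring.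
    exact.
  by move=> Iv; rewrite (interval_constant iI dw I0 Iv) a0 a10 b0 b10; ring.
pose G x := (a x * a x) *: A + (a x * b x) *: B + (b x * b x) *: C.
pose G1 x := (a x * a1 x + a1 x * a x) *: A + (a x * b1 x + a1 x * b x) *: B +
  (b x * b1 x + b1 x * b x) *: C.
pose r1 x := a x * (q x * a x) + a1 x * a1 x + (a1 x * a1 x + q x * a x * a x).
pose r2 x := a x * (q x * b x) + a1 x * b1 x + (a1 x * b1 x + q x * a x * b x).
pose r3 x := b x * (q x * b x) + b1 x * b1 x + (b1 x * b1 x + q x * b x * b x).
pose G2 x := r1 x *: A + r2 x *: B + r3 x *: C.
have df x : I x -> is_derive x 1 f (derive1 f x).
  move=> Ix; apply: derive1_is_derive => //; apply/derivable1_diffP.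
  exact: smooth_diff sf Ix.
have d0 x : I x -> is_derive x 1 G (G1 x).
  move=> Ix; have [h1 h2] := da x Ix; have [k1 k2] := db x Ix.
  exact: is_derive_comb3 (is_derive_mulR h1 h1) (is_derive_mulR h1 k1) (is_derive_mulR k1 k1).
have d1 x : I x -> is_derive x 1 G1 (G2 x).
  move=> Ix; have [h1 h2] := da x Ix; have [k1 k2] := db x Ix.
  apply: is_derive_comb3.
  - exact: is_derive_addR (is_derive_mulR h1 h2) (is_derive_mulR h2 h1).
  - exact: is_derive_addR (is_derive_mulR h1 k2) (is_derive_mulR h2 k1).
  - exact: is_derive_addR (is_derive_mulR k1 k2) (is_derive_mulR k2 k1).
have dq x : I x -> is_derive x 1 q (2^-1 * derive1 f x).
  by move=> Ix; have := is_derive_scale 2^-1 (df x Ix); rewrite scaleE; exact.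
have d2 x : I x -> is_derive x 1 G2 ((2 * f x) *: G1 x + derive1 f x *: G x).
  move=> Ix; have [h1 h2] := da x Ix; have [k1 k2] := db x Ix.
  have m (u u1 w w1 : R -> R) : is_derive x 1 u (u1 x) -> is_derive x 1 u1 (q x * u x) ->
      is_derive x 1 w (w1 x) -> is_derive x 1 w1 (q x * w x) ->
      is_derive x 1 (fun x => u x * (q x * w x) + u1 x * w1 x + (u1 x * w1 x + q x * u x * w x))
        (2 * f x * (u x * w1 x + u1 x * w x) + derive1 f x * (u x * w x)).
    move=> du du1 dw dw1.
    have s1 := is_derive_mulR du (is_derive_mulR (dq x Ix) dw).
    have s2 := is_derive_mulR du1 dw1.
    have s3 := is_derive_mulR (is_derive_mulR (dq x Ix) du) dw.
    have := is_derive_addR (is_derive_addR s1 s2) (is_derive_addR s2 s3).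
    set D := (X in is_derive _ _ _ X -> _).
    suff -> : D = 2 * f x * (u x * w1 x + u1 x * w x) + derive1 f x * (u x * w x) by exact.
    rewrite /D; have -> : f x = 2 * q x by rewrite /q; field.
    by field.
  have := is_derive_comb3 A B C (m a a1 a a1 h1 h2 h1 h2) (m a a1 b b1 h1 h2 k1 k2)
    (m b b1 b b1 k1 k2 k1 k2).
  rewrite /G1 /G !scalerDr !scalerA; set D := (X in is_derive _ _ _ X -> _).
  set D' := (X in _ -> is_derive _ _ _ X); suff -> : D = D' by exact.
  by apply: cV3P; rewrite /D /D' !mxE; ring.
have nc : null_curve I G G1 G2.
  move=> v Iv; split; [exact: d0|exact: d1| |].
    by rewrite /G gram_comb //; ring.
  rewrite /G1 gram_comb //.
  have -> : 1 = (a v * b1 v - a1 v * b v) * (a v * b1 v - a1 v * b v) :> R.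
    by rewrite wr// mulr1.
  by ring.
exists G, G1, G2; split => //.
  move=> k; apply: class_CD => //; first apply: class_CD => //.
  - apply: class_CZ => //; [exact: class_CM|exact: class_C_cst].
  - apply: class_CZ => //; [exact: class_CM|exact: class_C_cst].
  - apply: class_CZ => //; [exact: class_CM|exact: class_C_cst].
apply: (unique_solutionI hI nc df d2).
- by rewrite /G a0 b0 !mulr0 !scale0r !addr0 mulr1 scale1r.
- by rewrite /G1 a0 b0 a10 b10 !mulr0 !mul0r !addr0 !scale0r mulr1 scale1r add0r addr0.
- rewrite initial2E /G2 /r1 /r2 /r3 a0 b0 a10 b10 /q -/A -/C.
  by apply: cV3P; rewrite !mxE; field.
Qed.

(** * Adapted frames on a tangent developable *)

Lemma null_parallel (n m : V3) : n != 0 -> m != 0 -> mdot n n = 0 -> mdot m m = 0 ->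
  mdot n m = 0 -> exists2 c, c != 0 & m = c *: n.
Proof.
move=> n0 m0 nn mm nm; have [n00 Hn] := null1_scale n0 nn; have [m00 Hm] := null1_scale m0 mm.
have e := null1_unique Hn Hm; rewrite mdotZl mdotZr nm !mulr0 in e.
exists (m 0 0 / n 0 0); first by rewrite mulf_neq0 ?invr_eq0.
by rewrite -scalerA -(e erefl) scalerA mulfV// scale1r.
Qed.

Lemma adapted0_col_differentiable S O E U X q i : adapted0 S O E -> chart S U X -> U q ->
  O (X q) -> differentiable (fun y => col i (E (X y))) q.
Proof.
move=> aE cX Uq Oq; have dE := adapted0_differentiable aE cX Uq Oq.
apply: differentiable_col3 => k; have := differentiable_entry k i dE.
by rewrite (_ : (fun y => col i (E (X y)) k 0) = (fun y => (E \o X) y k i))//;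
  apply/funext => y; rewrite mxE.
Qed.

Lemma adapted0_near S O E U X q : adapted0 S O E -> chart S U X -> U q -> O (X q) ->
  \near q, U q /\ O (X q).
Proof.
move=> [[V oV ->] _ _] cX Uq [Vq _].
have cXq : {for q, continuous X} := differentiable_continuous (chart_diff cX Uq).
have nV : \near q, V (X q) by apply: cXq; exact: open_nbhs_nbhs.
apply: filterS2 nV (chart_near cX Uq) => y Vy Uy; split => //.
by split => //; exact: chart_in cX Uy.
Qed.

(** In every adapted frame [e_0] spans the radical of the tangent plane. *)
Lemma adapted0_null S O E p n : adapted0 S O E -> O p -> tangent S p n -> n != 0 ->
  mdot n n = 0 -> exists2 c, c != 0 & col 0 (E p) = c *: n.
Proof.
move=> [_ _ H] Op; have [_ -> [g00 g01 g12 g22] g02 _] := H p Op => -[a [b e]] n0 nn.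
apply: null_parallel => //.
  apply/eqP => z; have := g02; rewrite z mdotC mdot0r => /esym/eqP.
  by rewrite oner_eq0.
by rewrite mdotC e mdotDr !mdotZr g00 g01 !mulr0 addr0.
Qed.

Lemma de0_algebra (e0 e1 g de0 de1 dg : V3) (l : R) : e0 = l *: g ->
  0 = mdot e1 de0 + mdot de1 e0 -> 0 = mdot e1 dg + mdot de1 g ->
  mdot e1 de0 = l * mdot e1 dg.
Proof.
move=> -> E1 E2; rewrite mdotZr in E1.
have -> : mdot e1 dg = - mdot de1 g by lra.
by rewrite mulrN; lra.
Qed.

Lemma a2_value (e2 g g1 : V3) (x h1 h2 m : R) : x != 0 -> m != 0 -> mdot e2 (x *: g) = 1 ->
  mdot e2 ((h1 * x) *: g + h2 *: (x *: g1)) -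
    mdot e2 ((h1 * x) *: g + h2 *: (x *: g1 - g)) = x^-1 * x^-1 / m * (h2 * x * m).
Proof.
move=> x0 m0; rewrite mdotZr !(mdotBr, mdotDr, mdotZr) => e.
have -> : mdot e2 g = x^-1 by rewrite -[LHS](mulKf x0) e mulr1.
by field; rewrite ?x0 ?m0.
Qed.

Lemma a2_chain (e2 g g1 d d' dg dx : V3) (x dx1 h1 h2 m : R) : d = d' ->
  d' = x *: dg + dx1 *: g -> dx1 = h1 *: x -> dg = h2 *: g1 ->
  dx = (h1 * x) *: g + h2 *: (x *: g1 - g) -> x != 0 -> m != 0 -> mdot e2 (x *: g) = 1 ->
  mdot e2 d - mdot e2 dx = x^-1 * x^-1 / m * (h2 * x * m).
Proof.
move=> -> -> -> -> -> x0 m0 e; rewrite -(a2_value g1 h1 h2 x0 m0 e).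
by rewrite (addrC (x *: _)) !scalerA (mulrC x h2).
Qed.

Section DevelopableSurface.
Variables (I : set R) (G G1 G2 : R -> V3) (W : set R2).
Hypotheses (hI : open_interval0 I) (nc : null_curve I G G1 G2) (sG : smooth_on I G).
Let X := surface_map G.
Let S := X @` W.
Hypotheses (WI : W `<=` [set: R] `*` I) (pX : regular_parametrization W X S).

Lemma developable_chart : chart S W X.
Proof. by split => //; exists setT; [exact: openT|rewrite setTI]. Qed.

Lemma developable_normal q h : W q -> mdot (G q.2) ('d X q h) = 0.
Proof.
move=> Wq; have [_ Iv] := WI Wq; have [oI _ _] := hI.
have [_ _ g00 _] := nc Iv; have [g01 _ _] := null_curve_gram oI nc Iv.
have e : 'd X q h = _ := surface_map_diff hI nc h (WI Wq).
by rewrite e !(mdotDr, mdotZr, mdotNr) g00 g01; ring.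
Qed.

Lemma developable_ruling q : W q -> tangent S (X q) (G q.2).
Proof.
move=> Wq; rewrite (tangentE developable_chart Wq); exists (expR (- q.1), 0) => //.
have e : 'd X q _ = _ := surface_map_diff hI nc (expR (- q.1), 0) (WI Wq).
by apply: (etrans e); rewrite /= -expRD addNr expR0 scale1r scale0r addr0.
Qed.

Lemma developable_neq0 q : W q -> G q.2 != 0.
Proof.
move=> Wq; have [_ Iv] := WI Wq; have [oI _ _] := hI.
have [_ + _] := null_curve_gram oI nc Iv.
by case: eqP => // ->; rewrite mdotC mdot0r => /esym/eqP; rewrite oppr_eq0 oner_eq0.
Qed.

Lemma developable_null q : W q -> mdot (G q.2) (G q.2) = 0.
Proof. by move=> Wq; have [_ Iv] := WI Wq; have [] := nc Iv. Qed.

Lemma developable_lightlike : lightlike_surface S.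
Proof.
split=> [_ [q Wq <-]|_ [q Wq <-]].
  by exists W, X; split; [exact: developable_chart|exists q].
exists (G q.2); split; [exact: developable_ruling|exact: developable_neq0|].
by move=> w; rewrite (tangentE developable_chart Wq) => -[h _ <-]; exact: developable_normal.
Qed.

Lemma developable_curve_diff q h : W q ->
  differentiable (fun y : R2 => G y.2) q /\ 'd (fun y : R2 => G y.2) q h = h.2 *: G1 q.2.
Proof.
move=> Wq; have [_ Iv] := WI Wq; have [d1 _ _ _] := nc Iv.
have [f2 f2E] := diff_snd q h; have [DG _] := is_deriveP d1.
have eG := diff_comp_scalar h f2 d1; rewrite f2E in eG.
by split => //; exact: differentiable_comp f2 DG.
Qed.

Section Frame.
Variables (O : set V3) (E : V3 -> 'M[R]_3).
Hypothesis aE : adapted0 S O E.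

(** Since [e_1] is orthogonal to the rulings, its product with the derivative
    of [e_0 = l G] is that of [l G'], and [l] need not be differentiated. *)
Lemma developable_frame q : W q -> O (X q) -> let e i := col i (E (X q)) in
  exists l, [/\ l != 0, e 0 = l *: G q.2, mdot (e 1) (G1 q.2) != 0 &
    forall h, mc1 E 1 (X q) ('d X q h) = h.2 * expR q.1 * mdot (e 1) (G1 q.2) /\
              mc2 S E 1 0 (X q) ('d X q h) = l * (h.2 * mdot (e 1) (G1 q.2))].
Proof.
move=> Wq Oq e; have cX := developable_chart.
have [l l0 el] := adapted0_null aE Oq (developable_ruling Wq) (developable_neq0 Wq) (developable_null Wq).
have [[[g00 g01 g12 g22] g02 g11] _] := adapted0_gram aE Oq.
have e1G y : W y -> O (X y) -> mdot (col 1 (E (X y))) (G y.2) = 0.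
  move=> Wy Oy.
  have [c c0 ec] := adapted0_null aE Oy (developable_ruling Wy) (developable_neq0 Wy) (developable_null Wy).
  have [[[_ h01 _ _] _ _] _] := adapted0_gram aE Oy.
  move: h01; rewrite ec mdotZl mdotC => /eqP; rewrite mulf_eq0 (negbTE c0) => /eqP; exact.
have mX h : mdot (e 1) ('d X q h) = h.2 * expR q.1 * mdot (e 1) (G1 q.2).
  have eX : 'd X q h = _ := surface_map_diff hI nc h (WI Wq).
  rewrite eX !(mdotDr, mdotZr, mdotNr) e1G//; ring.
exists l; split => //.
  apply/eqP => z; have [_ _ H] := aE; have [_ TE _ _ _] := H _ Oq.
  have : tangent S (X q) (e 1) by rewrite TE; exists 0, 1; rewrite scale0r scale1r add0r.
  rewrite (tangentE cX Wq) => -[h _ eh]; have := mX h; rewrite eh g11 z mulr0.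
  by move/eqP; rewrite oner_eq0.
move=> h; have [_ ->] := mc1E ('d X q h) aE Oq; split; first exact: mX.
have [_ ->] := mc2E h aE cX Wq Oq.
have d0 := adapted0_col_differentiable 0 aE cX Wq Oq.
have d1 := adapted0_col_differentiable 1 aE cX Wq Oq.
have [dG dGE] := developable_curve_diff h Wq.
have nr := adapted0_near aE cX Wq Oq.
have n1 : \near q, 0 = mdot (col 1 (E (X q))) (col 0 (E (X q))).
  apply: filterS nr => y [Wy Oy]; have [[[_ h01 _ _] _ _] _] := adapted0_gram aE Oy.
  by rewrite mdotC h01.
have n2 : \near q, 0 = mdot (col 1 (E (X q))) (G q.2).
  by apply: filterS nr => y [Wy Oy]; rewrite e1G.
have z1 := f_equal (fun L => L h) (near_eq_diffE n1 (differentiable_cst (0 : R) q)).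
have z2 := f_equal (fun L => L h) (near_eq_diffE n2 (differentiable_cst (0 : R) q)).
have s1 : 0 = _ := etrans (esym (etrans z1 (diff_cst_fun _ _ _))) (diff_mdot h d1 d0).
have s2 : 0 = _ := etrans (esym (etrans z2 (diff_cst_fun _ _ _))) (diff_mdot h d1 dG).
rewrite (de0_algebra el s1 s2) dGE mdotZr.
by [].
Qed.

End Frame.

(** An adapted frame with [e_0 = l G] has [a_1 = l exp(-u)]. A 1-adapted one
    has [l = exp u], and then [a_2] is [exp(-2u)] divided by [mdot e_1 G']. *)
Lemma developable_non_conical : non_conical S.
Proof.
have cX := developable_chart; have [_ _ _ _ [g [gX _]]] := pX.
have OS O E (p : V3) : adapted0 S O E -> O p -> exists2 y, W y & X y = p.
  by move=> [[V _ ->] _ _] [_ [y Wy <-]]; exists y.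
have TE q w : W q -> tangent S (X q) w -> exists h, w = 'd X q h.
  by move=> Wq; rewrite (tangentE cX Wq) => -[h _ <-]; exists h.
split; [move=> O E aE|move=> O E [aE a1E]].
  exists (fun p => col 0 (E p) 0 0 / G (g p).2 0 0 * expR (- (g p).1)).
    move=> p w Op Tw; have [q Wq Xq] := OS O E p aE Op; subst p.
    have [h ->] := TE q w Wq Tw; rewrite gX//.
    have [l [l0 el m0 H]] := developable_frame aE Wq Op; have [-> ->] := H h.
    have [G00 _] := null1_scale (developable_neq0 Wq) (developable_null Wq).
    rewrite el [X in X / _]mxE mulfK// expRN; have := expR_gt0 q.1; set x := expR _ => x0.
    by field; rewrite gt_eqF.
  move=> p Op; have [q Wq Xq] := OS O E p aE Op; subst p; rewrite gX//.
  have [l [l0 el m0 H]] := developable_frame aE Wq Op.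
  have [G00 _] := null1_scale (developable_neq0 Wq) (developable_null Wq).
  by rewrite el [X in X / _]mxE mulfK// mulf_neq0// gt_eqF// expR_gt0.
have e0E q : W q -> O (X q) -> expR q.1 *: G q.2 = col 0 (E (X q)).
  move=> Wq Oq; have [l [l0 el m0 H]] := developable_frame aE Wq Oq; rewrite el.
  have [e1 e2] := H (0, 1); have T : tangent S (X q) ('d X q (0, 1)).
    by rewrite (tangentE cX Wq); exists (0, 1).
  have := a1E _ _ Oq T; rewrite e1 e2 /= !mul1r => /(mulIf m0) <-; by [].
exists (fun p => (expR (g p).1)^-1 * (expR (g p).1)^-1 / mdot (col 1 (E p)) (G1 (g p).2)).
  move=> p w Op Tw; have [q Wq Xq] := OS O E p aE Op; subst p.
  have [h ->] := TE q w Wq Tw; rewrite gX//.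
  have [l [l0 el m0 H]] := developable_frame aE Wq Op; have [e1 _] := H h.
  have [-> _] := mc1E ('d X q h) aE Op; have [-> _] := mc2E h aE cX Wq Op.
  have d0 := adapted0_col_differentiable 0 aE cX Wq Op.
  have [dG dGE] := developable_curve_diff h Wq.
  have [f1 f1E] := diff_fst q h; have dE : is_derive q.1 1 (@expR R) (expR q.1).
    exact: is_derive_expR.
  have [DE _] := is_deriveP dE.
  have eE := etrans (diff_comp_scalar h f1 dE) (f_equal (fun z => z *: expR q.1) f1E).
  have cE : differentiable (fun q : R2 => expR q.1) q := differentiable_comp f1 DE.
  have n0 : \near q, expR q.1 *: G q.2 = col 0 (E (X q)).
    by apply: filterS (adapted0_near aE cX Wq Op) => y [Wy Oy]; exact: e0E.
  have [cEG _] := is_diff_scale cE dG.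
  have de := f_equal (fun L => L h) (near_eq_diffE n0 cEG).
  have dE0 := diffZ_fun h cE dG.
  have u1 : mdot (col 2 (E (X q))) (expR q.1 *: G q.2) = 1.
    have [[_ g02 _] _] := adapted0_gram aE Op.
    by apply: etrans g02; rewrite (mdotC (col 2 _)); congr mdot; exact: e0E.
  have x0 : expR q.1 != 0 := lt0r_neq0 (expR_gt0 q.1).
  have eX : 'd X q h = _ := surface_map_diff hI nc h (WI Wq).
  have K := a2_chain de dE0 eE dGE eX x0 m0 u1.
  apply: (etrans K).
  exact: (f_equal (fun z => _ * z) (esym e1)).
move=> p Op; have [q Wq Xq] := OS O E p aE Op; subst p; rewrite gX//.
have [l [l0 el m0 H]] := developable_frame aE Wq Op.
by rewrite !mulf_neq0// invr_eq0// gt_eqF// expR_gt0.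
Qed.

End DevelopableSurface.

Lemma prescribed_surface (f : R -> R) (I : set R) : open_interval0 I -> smooth_on I f ->
  exists G0 : R -> V3, unique_solution f I G0 /\
    forall u v, I v -> exists (W : set R2) (S : set V3),
      [/\ W (u, v), W `<=` setT `*` I, regular_parametrization W (surface_map G0) S,
          lightlike_surface S & non_conical S].
Proof.
move=> hI sf; have [G [G1 [G2 [nc sG uG]]]] := null_curve_exists hI sf.
exists G; split => // u v Iv.
have [W [Wq WD pX]] := immersion_local (open_strip hI) (conj Logic.I Iv : (setT `*` I) (u, v))
  (surface_map_smooth hI nc sG) (surface_map_immersion hI nc).
exists W, (surface_map G @` W); split => //.
- exact: developable_lightlike hI nc WD pX.
- exact: developable_non_conical hI nc WD pX.
Qed.

(** * Local coordinates and their coordinate lines *)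

Lemma ball_interval (x e : R) : is_interval (ball x e).
Proof.
move=> a b; rewrite -ball_normE /= !ltr_distlC => /andP[a1 a2] /andP[b1 b2] z /andP[az zb].
by rewrite ltr_distlC (lt_le_trans a1 az) (le_lt_trans zb b2).
Qed.

Lemma is_derive_curve V W (c : R -> V) (F : V -> W) (t : R) c' : is_derive t 1 c c' ->
  differentiable F (c t) -> is_derive t 1 (F \o c) ('d F (c t) c').
Proof.
move=> /is_deriveP[dc <-] dF; rewrite -(diff_comp_fun (1 : R) dc dF); apply: diff_is_derive.
exact: differentiable_comp dc dF.
Qed.

Lemma is_derive_comp W (p : R -> R) (F : R -> W) (t p' : R) F' : is_derive t 1 p p' ->
  is_derive (p t) 1 F F' -> is_derive t 1 (F \o p) (p' *: F').
Proof.
by move=> dp /is_deriveP[dF <-]; rewrite -linear_scalar; exact: is_derive_curve.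
Qed.

Lemma is_derive_scaler V (k : R -> R) (n : R -> V) (t k' : R) n' : is_derive t 1 k k' ->
  is_derive t 1 n n' -> is_derive t 1 (fun x => k x *: n x) (k t *: n' + k' *: n t).
Proof.
move=> /is_deriveP[dk <-] /is_deriveP[dn <-]; have [d _] := is_diff_scale dk dn.
rewrite -(diffZ_fun (1 : R) dk dn); exact: diff_is_derive.
Qed.

Lemma is_derive_line (z h : R2) (t : R) : is_derive t 1 (fun t => z + t *: h) h.
Proof.
have := is_derive_addR (is_derive_cst z t 1) (is_derive_scalel h (is_derive_id t 1)).
by rewrite scale1r add0r; exact.
Qed.

Lemma box_constant (F : R2 -> V3) (z0 : R2) e s t :
  (forall z, ball z0 e z -> differentiable F z /\ 'd F z (1, 0) = 0) ->
  ball z0 e (s, t) -> F (s, t) = F (z0.1, t).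
Proof.
move=> dF [bs bt].
have e0 : 0 < e by move: bs; rewrite -ball_normE /= => /(le_lt_trans (normr_ge0 _)).
have lineE x : (x, t) = (0, t) + x *: (1, 0) :> R2.
  by congr (_, _); rewrite /= ?add0r scaleE ?mulr1// mulr0 addr0.
suff H i : F (s, t) i 0 = F (z0.1, t) i 0 by apply: cV3P; exact: H.
apply: (@interval_constant (ball z0.1 e) (fun x => F (x, t) i 0) z0.1 s) => //.
- exact: ball_interval.
- move=> x bx; have [d d0] := dF (x, t) (conj bx bt).
  rewrite lineE in d d0.
  have D := is_derive_curve (is_derive_line (0, t) (1, 0) x) d; rewrite d0 in D.
  have := is_derive_entry i D; rewrite mxE.
  have -> : (fun x => F (x, t) i 0) = (fun x => (F \o (fun x => (0, t) + x *: (1, 0))) x i 0).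
    by apply/funext => y; rewrite /= -lineE.
  exact.
- exact: ballxx.
Qed.

(** Along an integral curve of a smooth field, the derivative of a smooth
    function of the position is again one. *)
Lemma smooth_along_flow W (U : set R2) (J : set R) (x1 x2 : R2 -> R) (c : R -> R2)
    (F : R2 -> W) : open U -> open J -> smooth_on U x1 -> smooth_on U x2 ->
  (forall t, J t -> U (c t) /\ is_derive t 1 c (x1 (c t), x2 (c t))) ->
  smooth_on U F -> smooth_on J (F \o c).
Proof.
move=> oU oJ s1 s2 dc sF k; elim: k F sF => [|k IH] F sF.
  move=> t Jt; have [Uc D] := dc t Jt.
  exact: (continuous_comp (is_derive_continuous D) (sF 0%N _ Uc)).
pose F' q := x1 q *: 'D_(1, 0) F q + x2 q *: 'D_(0, 1) F q.
have sF' : smooth_on U F'.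
  move=> n; apply: class_CD => //; apply: class_CZ => //; exact: smooth_derive.
apply: (class_C_derive1 oJ _ (IH F' sF')) => t Jt; have [Uc D] := dc t Jt.
have dF : differentiable F (c t) := smooth_diff sF Uc.
have := is_derive_curve D dF; rewrite linear_planeE /= -!deriveE//.
Qed.

(** The inverse of the coordinates is differentiable because it lifts the
    identity through them. *)
Lemma local_coordinates (kappa : R2 -> R2) (U : set R2) q0 e0 : open U -> U q0 ->
  class_C 1 U kappa -> (forall q, U q -> injective ('d kappa q)) -> 0 < e0 ->
  exists e (g : R2 -> R2), [/\ 0 < e <= e0, open (g @` ball (kappa q0) e),
    (g @` ball (kappa q0) e) q0 &
    forall z, ball (kappa q0) e z -> [/\ U (g z), kappa (g z) = z, differentiable g z &
      forall h, 'd kappa (g z) ('d g z h) = h]].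
Proof.
move=> oU Uq0 Ck inj e0p.
have [d d0 [BU oK [g gP]]] := inverse_function oU Uq0 Ck (inj _ Uq0).
have /nbhs_ballP[e1 /= e1p sub] : nbhs (kappa q0) (kappa @` ball q0 d).
  by apply: open_nbhs_nbhs; split => //; exists q0 => //; exact: ballxx.
pose e := Num.min e1 e0; have ep : 0 < e by rewrite lt_min e1p.
have {}sub z : ball (kappa q0) e z -> exists2 x, ball q0 d x & kappa x = z.
  by move=> bz; apply: sub; apply: le_ball bz; rewrite ge_min lexx.
have ck x : ball q0 d x -> {for x, continuous kappa}.
  by move=> /BU Ux; apply: differentiable_continuous; exact: Ck.1.
have gE : g @` ball (kappa q0) e = ball q0 d `&` [set x | ball (kappa q0) e (kappa x)].
  apply/seteqP; split => [_ [z bz <-]|x [bx bk]].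
    by have [x bx xz] := sub z bz; have [gx _] := gP x bx; rewrite -xz gx; split => //=; rewrite xz.
  by exists (kappa x) => //; have [] := gP x bx.
exists e, g; split.
- by rewrite ep /e ge_min lexx orbT.
- rewrite gE openE => x [bx bk]; apply: filterI.
    by apply: open_nbhs_nbhs; split => //; exact: ball_open.
  by apply: (ck x bx); apply: open_nbhs_nbhs; split => //; exact: ball_open.
- suff : (g @` ball (kappa q0) e) q0 by [].
  by rewrite gE; split; exact: ballxx.
move=> z bz; have [x bx xz] := sub z bz; have [gx cg] := gP x bx.
have Ux := BU x bx; rewrite xz in gx cg.
have [L [cL _ LK]] := plane_left_inverse (inj x Ux).
have dk : differentiable kappa x by exact: Ck.1.
have nK : \forall y \near z, kappa (g y) = id y.
  have ob : open (ball (kappa q0) e) by exact: ball_open.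
  apply: filterS (open_nbhs_nbhs (conj ob bz)) => y by_.
  by have [w bw <-] := sub y by_; have [-> _] := gP w bw.
rewrite -gx in dk LK.
have cid : continuous (idfun : R2 -> R2) by move=> y; exact: cvg_id.
have [dg _] := is_diff_lift dk cL LK (linear_differentiable z cid) cg nK.
split; [by rewrite gx|by rewrite gx|exact: dg|].
move=> h; have dkg : differentiable (fun y => kappa (g y)) z by exact: differentiable_comp dg dk.
have e1' := diff_comp_fun h dg dk.
have e2 := f_equal (fun L => L h) (near_eq_diffE nK dkg).
apply: (etrans (esym e1')); apply: (etrans (esym e2)).
exact: diff_lin_fun cid.
Qed.

Lemma pair_basis (u v : R) : u *: ((1, 0) : R2) + v *: ((0, 1) : R2) = (u, v).
Proof. by congr (_, _); rewrite /= !scaleE !mulr1 !mulr0 ?addr0 ?add0r. Qed.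

(** * The edge of regression *)

Lemma pair_inj (u v : R) (h : R2) : (u, v) = h -> u = h.1 /\ v = h.2.
Proof. by move=> <-. Qed.

Lemma class_C_pair k V (U : set V) (f g : V -> R) : open U -> class_C k U f ->
  class_C k U g -> class_C k U (fun x => (f x, g x)).
Proof.
move=> oU Cf Cg.
have -> : (fun x => (f x, g x)) = (fun x => f x *: ((1, 0) : R2) + g x *: ((0, 1) : R2)).
  by apply/funext => x; rewrite pair_basis.
apply: class_CD => //; apply: class_CZ => //; exact: class_C_cst.
Qed.

Lemma diff_scalel V W (f : V -> R) (w : W) x h : differentiable f x ->
  differentiable (fun x => f x *: w) x /\ 'd (fun x => f x *: w) x h = 'd f x h *: w.
Proof.
move=> df; have [d _] := is_diff_scale df (differentiable_cst w x); split; first exact: d.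
apply: (etrans (diffZ_fun h df (differentiable_cst w x))).
by rewrite diff_cst_fun scaler0 add0r.
Qed.

Lemma diff_pair V (f g : V -> R) x h : differentiable f x -> differentiable g x ->
  'd (fun x => (f x, g x)) x h = ('d f x h, 'd g x h).
Proof.
move=> df dg.
have -> : (fun x => (f x, g x)) = (fun x => f x *: ((1, 0) : R2) + g x *: ((0, 1) : R2)).
  by apply/funext => y; rewrite pair_basis.
have [d1 e1] := diff_scalel ((1, 0) : R2) h df; have [d2 e2] := diff_scalel ((0, 1) : R2) h dg.
apply: (etrans (diffD_fun h d1 d2)); apply: (etrans (f_equal2 +%R e1 e2)).
exact: pair_basis.
Qed.

Lemma edge_cancel (l b m dl x0 : R) : l != 0 -> b != 0 -> dl - x0 = l * b * m -> x0 - dl = 0 ->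
  m = 0.
Proof.
move=> l0 b0 e e0; have : l * b * m = 0 by lra.
by move/eqP; rewrite !mulf_eq0 (negbTE l0) (negbTE b0) => /eqP.
Qed.

Lemma edge_speed (l b m dl x0 : R) : dl - x0 = l * b * m -> x0 - dl = 1 -> m != 0.
Proof. by move=> e e0; apply/eqP => m0; move: e; rewrite m0 mulr0; lra. Qed.

Lemma cramer (f1 f2 g1 g2 : R) (z : R2) : f1 * g2 + (- f2) * g1 != 0 ->
  z.1 * f1 + z.2 * f2 = 0 -> z.1 * g1 + z.2 * g2 = 1 ->
  z = ((f1 * g2 + (- f2) * g1)^-1 * - f2, (f1 * g2 + (- f2) * g1)^-1 * f1).
Proof.
case: z => u v /= d0; set d := _ + _ in d0 *; move=> e1 e2.
have u1 : u * d = - f2.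
  have -> : u * d = (u * f1 + v * f2) * g2 - f2 * (u * g1 + v * g2) by rewrite /d; ring.
  by rewrite e1 e2; ring.
have v1 : v * d = f1.
  have -> : v * d = f1 * (u * g1 + v * g2) - (u * f1 + v * f2) * g1 by rewrite /d; ring.
  by rewrite e1 e2; ring.
by rewrite -u1 -v1 !(mulrC d^-1) !mulfK.
Qed.

Lemma smooth_diffE (U : set R2) (f : R2 -> R) q h : smooth_on U f -> U q ->
  'd f q h = h.1 * 'D_(1, 0) f q + h.2 * 'D_(0, 1) f q.
Proof.
move=> sf Uq; have df := smooth_diff sf Uq.
by rewrite [LHS]linear_planeE -!deriveE.
Qed.

(** By Cramer's rule a coordinate line is an integral curve of a smooth
    field. *)
Lemma coordinate_curve_smooth W (U : set R2) (J : set R) (f g : R2 -> R) (c : R -> R2)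
    (F : R2 -> W) : open U -> open J -> smooth_on U f -> smooth_on U g ->
  (forall q, U q -> injective ('d (fun q => (f q, g q)) q)) ->
  (forall t, J t -> exists v, [/\ U (c t), is_derive t 1 c v, 'd f (c t) v = 0 & 'd g (c t) v = 1]) ->
  smooth_on U F -> smooth_on J (F \o c).
Proof.
move=> oU oJ sf sg inj dc sF.
pose f1 := 'D_((1, 0) : R2) f; pose f2 := 'D_((0, 1) : R2) f.
pose g1 := 'D_((1, 0) : R2) g; pose g2 := 'D_((0, 1) : R2) g.
have sf1 : smooth_on U f1 by exact: smooth_derive.
have sf2 : smooth_on U f2 by exact: smooth_derive.
have sg1 : smooth_on U g1 by exact: smooth_derive.
have sg2 : smooth_on U g2 by exact: smooth_derive.
pose det q := f1 q * g2 q + (- f2 q) * g1 q.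
have sdet : smooth_on U det.
  move=> k; exact: (class_CD oU (class_CM oU (sf1 k) (sg2 k))
    (class_CM oU (class_CN oU (sf2 k)) (sg1 k))).
have det0 q : U q -> det q != 0.
  move=> Uq; have df : differentiable f q := smooth_diff sf Uq.
  have dg : differentiable g q := smooth_diff sg Uq.
  have := det_neq0 (inj q Uq).
  rewrite (diff_pair ((1, 0) : R2) df dg) (diff_pair ((0, 1) : R2) df dg) /=.
  by rewrite /det /f1 /f2 /g1 /g2 !deriveE// mulNr [X in _ - X]mulrC.
have sdi : smooth_on U (fun q => (det q)^-1) by move=> k; exact: class_C_inv.
apply: (@smooth_along_flow _ U _ (fun q => (det q)^-1 * - f2 q) (fun q => (det q)^-1 * f1 q)
    c F oU oJ) => //.
- by move=> k; exact: (class_CM oU (sdi k) (class_CN oU (sf2 k))).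
- by move=> k; exact: (class_CM oU (sdi k) (sf1 k)).
move=> t Jt; have [v [Uc D e1 e2]] := dc t Jt; split; first exact: Uc.
have E := cramer (det0 _ Uc) (etrans (esym (smooth_diffE v sf Uc)) e1)
  (etrans (esym (smooth_diffE v sg Uc)) e2).
by rewrite {1}E in D.
Qed.

Section EdgeOfRegression.
Variables (S : set V3) (a a2 : V3 -> R).
Hypotheses (lS : lightlike_surface S).
Hypotheses (Ha : is_a1 S S (fun p => frame 1 (nhat S p)) a) (a0 : forall p, S p -> a p != 0).
Hypotheses (H2 : is_a2 S S (fun p => frame (a p)^-1 (nhat S p)) a2).
Hypothesis a20 : forall p, S p -> a2 p != 0.

Section InChart.
Variables (U : set R2) (X : R2 -> V3).
Hypothesis cX : chart S U X.
Let N q := nhat S (X q).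
Let l q := (a (X q))^-1.
Let edge q := X q - l q *: N q.
Let time q := X q 0 0 - l q.
Let kappa q := (l q, time q).

Lemma edge_l_smooth : smooth_on U l.
Proof. exact: (inv_a1_smooth lS Ha a0 cX). Qed.

Lemma edge_time_smooth : smooth_on U time.
Proof.
have oU := chart_open cX; move=> k; apply: class_CB => //; last exact: edge_l_smooth.
by apply: class_C_entry => //; exact: chart_smooth cX k.
Qed.

Lemma edge_time_diff q h : U q -> 'd time q h = ('d X q h) 0 0 - 'd l q h.
Proof.
move=> Uq; have dX := chart_diff cX Uq.
have dl : differentiable l q := smooth_diff edge_l_smooth Uq.
apply: (etrans (diffB_fun h (differentiable_entry 0 0 dX) dl)).
exact: (f_equal (fun z => z - 'd l q h) (diff_entry 0 0 h dX)).
Qed.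

(** Where the edge does not move, the displacement is along the ruling. *)
Lemma edge_time_ker q h : U q -> 'd time q h = 0 -> 'd X q h = ('d X q h) 0 0 *: N q.
Proof.
move=> Uq; rewrite (edge_time_diff h Uq) => e.
have Sq := chart_in cX Uq.
have e2 := a2_chart lS Ha a0 h H2 cX Uq.
have m0 := edge_cancel (invr_neq0 (a0 Sq)) (a20 Sq) e2 e.
apply: (etrans (chart_dX lS cX h Uq)).
by rewrite m0 scale0r addr0.
Qed.

Lemma edge_coord_smooth : smooth_on U kappa.
Proof.
move=> k; apply: class_C_pair; [exact: chart_open cX|exact: edge_l_smooth|].
exact: edge_time_smooth.
Qed.

Lemma edge_coord_diff q h : U q -> 'd kappa q h = ('d l q h, 'd time q h).
Proof.
move=> Uq; apply: diff_pair; first exact: smooth_diff edge_l_smooth Uq.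
exact: smooth_diff edge_time_smooth Uq.
Qed.

Lemma edge_coord_inj q : U q -> injective ('d kappa q).
Proof.
move=> Uq; suff H h : 'd kappa q h = 0 -> h = 0.
  move=> x y e; apply/eqP; rewrite -subr_eq0; apply/eqP/H.
  by rewrite linearB e subrr.
rewrite (edge_coord_diff h Uq) => -[l0 t0].
apply: (chart_inj cX Uq); rewrite linear0.
have e := edge_time_ker Uq t0; rewrite edge_time_diff// l0 subr0 in t0.
by rewrite e t0 scale0r.
Qed.

Lemma edge_diff q h : U q -> differentiable edge q /\ 'd edge q h = 'd time q h *: N q.
Proof.
move=> Uq; have dX := chart_diff cX Uq.
have dl : differentiable l q := smooth_diff edge_l_smooth Uq.
have dN := chart_null_diff lS cX Uq.
have [dlN _] := is_diff_scale dl dN.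
split; first exact: (differentiableB dX dlN).
by rewrite (edge_time_diff h Uq); exact: (edge_derivative lS Ha cX h a0 Uq).
Qed.

Lemma edge_null_ker q h : U q -> 'd time q h = 0 -> 'd N q h = 0.
Proof.
move=> Uq e; apply: (etrans (null_field_derivative lS Ha cX h Uq)).
by rewrite {1}(edge_time_ker Uq e) subrr scaler0.
Qed.

Lemma edge_null_speed q h : U q -> 'd time q h = 1 -> 0 < mdot ('d N q h) ('d N q h).
Proof.
move=> Uq; rewrite (edge_time_diff h Uq) => e.
have Sq := chart_in cX Uq; have HN := chart_null1 lS cX Uq.
have m0 := edge_speed (a2_chart lS Ha a0 h H2 cX Uq) e.
have [_ E] := chart_dN lS cX h Uq.
have n0 : mdot (perp1 (N q)) ('d N q h) != 0.
  by rewrite (a1_chart lS Ha cX h Uq) mulf_neq0// a0.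
rewrite E mdotZl mdotZr perp1_norm// mulr1 -expr2.
by rewrite lt_def sqrf_eq0 n0 sqr_ge0.
Qed.

End InChart.
(** In the coordinates [s = a_1^-1] and [t = x^0 - s] the null direction and
    the edge depend on [t] alone. The edge is a null curve [Y] with velocity
    [n], and the surface is swept out by its tangent lines. *)
Lemma tangent_developable p : S p -> exists (z0 : R2) e (Y n : R -> V3) (U : set V3) (c : V3 -> R2),
  [/\ 0 < e <= `|z0.1|, open_in S U /\ U p,
      forall t, ball z0.2 e t -> [/\ is_derive t 1 Y (n t), mdot (n t) (n t) = 0 &
        0 < mdot (derive1 n t) (derive1 n t)],
      smooth_on (ball z0.2 e) n &
      [/\ U = [set Y z.2 + z.1 *: n z.2 | z in ball z0 e],
          forall z, ball z0 e z -> c (Y z.2 + z.1 *: n z.2) = z &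
          {within U, continuous c}]].
Proof.
move=> Sp; have [U0 [X [cX [q0 Uq0 Xq0]]]] := lS.1 p Sp; subst p.
pose N q := nhat S (X q); pose l q := (a (X q))^-1.
pose edge q := X q - l q *: N q; pose time q := X q 0 0 - l q.
pose kappa q := (l q, time q).
have oU := chart_open cX.
have sk : smooth_on U0 kappa := edge_coord_smooth cX.
have ik q : U0 q -> injective ('d kappa q) := @edge_coord_inj _ _ cX q.
have l0 q : U0 q -> l q != 0 by move=> Uq; apply/invr_neq0/a0; exact: chart_in cX Uq.
have lp : 0 < `|l q0| by rewrite normr_gt0; exact: l0.
have [e [g [e0 og gq0 gP]]] := local_coordinates oU Uq0 (sk 1%N) ik lp.
set z0 := kappa q0 in e0 og gq0 gP.
have /andP[ep _] := e0.
have bs t : ball z0.2 e t -> ball z0 e (z0.1, t) by move=> bt; split => //; exact: ballxx.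
have dgE z h : ball z0 e z -> 'd l (g z) ('d g z h) = h.1 /\ 'd time (g z) ('d g z h) = h.2.
  move=> bz; have [Ug _ _ H] := gP z bz.
  exact: (pair_inj (etrans (esym (edge_coord_diff cX ('d g z h) Ug)) (H h))).
pose n t := N (g (z0.1, t)); pose Y t := edge (g (z0.1, t)).
pose ct t := g (z0.1, t).
have dct t : ball z0.2 e t -> is_derive t 1 ct ('d g (z0.1, t) (0, 1)).
  move=> bt; have [_ _ dg _] := gP _ (bs t bt).
  have lineE x : (z0.1, x) = (z0.1, 0) + x *: (0, 1) :> R2.
    by congr (_, _); rewrite /= ?add0r scaleE ?mulr1// mulr0 addr0.
  rewrite lineE in dg *.
  have := is_derive_curve (is_derive_line (z0.1, 0) (0, 1) t) dg.
  by rewrite (_ : g \o _ = ct)//; apply/funext => x; rewrite /ct /= -lineE.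
(* Neither [N] nor [edge] has a derivative along the first coordinate line. *)
have Nst z : ball z0 e z -> N (g z) = n z.2.
  case: z => s t bz.
  apply: (@box_constant (N \o g) z0 e s t _ bz) => z {}bz.
  have [Ug _ dg _] := gP z bz; have dN := chart_null_diff lS cX Ug.
  split; first exact: differentiable_comp dg dN.
  apply: (etrans (diff_comp_fun ((1, 0) : R2) dg dN)).
  by apply: (edge_null_ker cX Ug); have [_ ->] := dgE z (1, 0) bz.
have Yst z : ball z0 e z -> edge (g z) = Y z.2.
  case: z => s t bz.
  apply: (@box_constant (edge \o g) z0 e s t _ bz) => z {}bz.
  have [Ug _ dg _] := gP z bz; have [dE dEE] := edge_diff cX ('d g z (1, 0)) Ug.
  split; first exact: differentiable_comp dg dE.
  apply: (etrans (diff_comp_fun ((1, 0) : R2) dg dE)); apply: (etrans dEE).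
  by have [_ ->] := dgE z (1, 0) bz; rewrite scale0r.
have Xst z : ball z0 e z -> X (g z) = Y z.2 + z.1 *: n z.2.
  move=> bz; rewrite -Yst// -Nst//; have [_ kz _ _] := gP z bz.
  have -> : z.1 = l (g z) by rewrite -[in LHS]kz.
  by rewrite /edge subrK.
exists z0, e, Y, n, (X @` (g @` ball z0 e)).
have [_ [_ _ _ _ [i [iX ci]]]] := cX.
exists (kappa \o i).
have sub : g @` ball z0 e `<=` U0 by move=> _ [z bz <-]; have [] := gP z bz.
split => //.
- by split; [exact: chart_sub_open cX og sub|exists q0].
- move=> t bt; have bz := bs t bt; have [Ug _ dg _] := gP _ bz.
  have dN := chart_null_diff lS cX Ug.
  have [_ e2] := dgE _ (0, 1) bz.
  have [dE dEE] := edge_diff cX ('d g (z0.1, t) (0, 1)) Ug.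
  rewrite e2 /= scale1r in dEE.
  have DY := is_derive_curve (dct t bt) dE; rewrite dEE in DY.
  have Dn : is_derive t 1 n _ := is_derive_curve (dct t bt) dN.
  split; [exact: DY|by have [] := chart_null1 lS cX Ug|].
  have -> : derive1 n t = 'd N (ct t) ('d g (z0.1, t) (0, 1)).
    by rewrite derive1E; exact: derive_val.
  have e3 : 'd time (g (z0.1, t)) ('d g (z0.1, t) (0, 1)) = 1 by exact: e2.
  have e4 := edge_null_speed cX Ug e3; exact: e4.
- have sN : smooth_on U0 N := chart_null_smooth lS cX.
  have oJ : open (ball z0.2 e) by exact: ball_open.
  apply: (coordinate_curve_smooth oU oJ (edge_l_smooth cX) (edge_time_smooth cX) ik _ sN).
  move=> t bt; have [Ug _ _ _] := gP _ (bs t bt); have [e1 e2] := dgE _ (0, 1) (bs t bt).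
  exists ('d g (z0.1, t) (0, 1)); split; [exact: Ug|exact: dct|exact: e1|exact: e2].
- split.
  + apply/seteqP; split => [_ [_ [z bz <-] <-]|_ [z bz <-]].
      by exists z => //; rewrite -Xst.
    by exists (g z); [exists z|rewrite Xst].
  + move=> z bz; have [Ug kz _ _] := gP z bz.
    by rewrite -Xst// /= iX.
  + apply/subspace_continuousP => _ [q gq <-]; have Uq := sub _ gq.
    have ci0 := continuous_subspaceW (image_subset X sub) ci.
    move/subspace_continuousP: ci0 => /(_ (X q) (ex_intro2 _ _ q gq erefl)) ci'.
    have ck : {for i (X q), continuous kappa}.
      by rewrite iX//; apply: differentiable_continuous; exact: smooth_diff sk Uq.
    exact: (cvg_comp _ _ ci' ck).
Qed.

End EdgeOfRegression.

(** * Normal form of a null curve *)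

Lemma smooth_derive1 V (I : set R) (G : R -> V) : open I -> smooth_on I G ->
  smooth_on I (derive1 G) /\ forall v, I v -> is_derive v 1 G (derive1 G v).
Proof.
move=> oI sG; split.
  rewrite (_ : derive1 G = 'D_1 G); first exact: smooth_derive.
  by apply/funext => v; rewrite derive1E.
move=> v Iv; apply: derive1_is_derive => //; apply: diff_derivable.
exact: smooth_diff sG Iv.
Qed.

Lemma is_derive_mulmx (A : 'M[R]_3) (F : R -> V3) (v : R) F' : is_derive v 1 F F' ->
  is_derive v 1 (fun x => A *m F x) (A *m F').
Proof.
move=> dF; have c := fun i => is_derive_entry i dF; apply: is_derive_col3 => i.
have -> : (fun x => (A *m F x) i 0) =
    fun x => A i 0 * F x 0 0 + A i 1 * F x 1 0 + A i 2 * F x 2 0.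
  by apply/funext => x; rewrite mxE sum3.
rewrite mxE sum3; exact: (is_derive_addR (is_derive_addR (is_derive_scale (A i 0) (c 0))
  (is_derive_scale (A i 1) (c 1))) (is_derive_scale (A i 2) (c 2))).
Qed.

Lemma smooth_mulmx (A : 'M[R]_3) V (I : set V) (F : V -> V3) : open I -> smooth_on I F ->
  smooth_on I (fun x => A *m F x).
Proof.
move=> oI sF k.
have -> : (fun x => A *m F x) = fun x => F x 0 0 *: col 0 A + F x 1 0 *: col 1 A + F x 2 0 *: col 2 A.
  by apply/funext => x; rewrite mulmx_cols.
have c i : class_C k I (fun x => F x i 0) by exact: class_C_entry (sF k).
have d i : class_C k I (fun x => F x i 0 *: col i A).
  by apply: class_CZ => //; exact: class_C_cst.
exact: (class_CD oI (class_CD oI (d 0) (d 1)) (d 2)).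
Qed.

Lemma initial_null_gram f0 : null_gram (columns initial0 initial1 (f0 *: initial0 - initial2 f0)).
Proof.
have -> : f0 *: initial0 - initial2 f0 = (- 2) *: initial_conull.
  by rewrite initial2E opprD addrA subrr add0r scaleNr.
move: initial_gram; move: initial0 initial1 initial_conull => A B C /= [[gAA gAB gBB] [gAC gBC gCC]].
have [c0 c1 c2] := columnsE A B ((- 2) *: C).
rewrite /null_gram c0 c1 c2 !(mdotZl, mdotZr) gAA gAB gBB gAC gBC gCC.
by split; [split|..]; field.
Qed.

(** A Lorentz transformation carries the null frame [G], [G'], [f G - G''] at
    parameter 0 to the prescribed one, and with it the initial data. *)
Lemma normal_position (I : set R) (G G1 G2 : R -> V3) : open_interval0 I ->
  null_curve I G G1 G2 -> smooth_on I G2 ->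
  exists (A : 'M[R]_3) (f : R -> R), [/\ O21 A, A \in unitmx, smooth_on I f,
    null_curve I (fun v => A *m G v) (fun v => A *m G1 v) (fun v => A *m G2 v) &
    unique_solution f I (fun v => A *m G v)].
Proof.
move=> hI nc s2; have [oI iI I0] := hI.
have [_ d3] := smooth_derive1 oI s2.
pose f x := - 2^-1 * mdot (G2 x) (G2 x).
have f3 v : I v -> is_derive v 1 f (- mdot (G2 v) (derive1 G2 v)) /\
    derive1 G2 v = (2 * f v) *: G1 v - mdot (G2 v) (derive1 G2 v) *: G v.
  by move=> Iv; exact: null_curve_third oI nc d3 Iv.
have n2 : mdot (G2 0) (G2 0) = - (2 * f 0) by rewrite /f; field.
have gE := null_curve_frame oI nc I0 n2; have gF := initial_null_gram (f 0).
have [A oA AE] := null_gram_isometry gE gF.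
set E := columns _ _ _ in gE AE; set F := columns _ _ _ in gF AE.
have AEF : A *m E = F by apply/matrixP => i j; have := f_equal (fun v : V3 => v i 0) (AE j);
  rewrite mul_col !mxE.
have uA : A \in unitmx.
  have := null_gram_unit gF; rewrite -AEF unitmx_mul => /andP[]; by [].
have [E0 E1 E2] := columnsE (G 0) (G1 0) (f 0 *: G 0 - G2 0).
have [F0 F1 F2] := columnsE initial0 initial1 (f 0 *: initial0 - initial2 (f 0)).
have A0 : A *m G 0 = initial0 by rewrite -F0 -E0; exact: AE.
have A1 : A *m G1 0 = initial1 by rewrite -F1 -E1; exact: AE.
have A2 : A *m G2 0 = initial2 (f 0).
  have := AE 2; rewrite /E /F E2 F2 mulmxBr -scalemxAr A0 => /(addrI _) e.
  by apply: oppr_inj.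
have ncA : null_curve I (fun v => A *m G v) (fun v => A *m G1 v) (fun v => A *m G2 v).
  move=> v Iv; have [h1 h2 h3 h4] := nc v Iv.
  by split; [exact: is_derive_mulmx|exact: is_derive_mulmx|rewrite oA|rewrite oA].
exists A, f; split => //.
- move=> k; apply: class_CM => //; first exact: class_C_cst.
  by apply: class_C_mdot => //; exact: s2.
- apply: (unique_solutionI hI ncA (fun v Iv => (f3 v Iv).1)) => // v Iv.
  have [_ e] := f3 v Iv; have := is_derive_mulmx A (d3 v Iv).
  have -> : A *m derive1 G2 v = (2 * f v) *: (A *m G1 v) +
      - mdot (G2 v) (derive1 G2 v) *: (A *m G v).
    by rewrite {1}e mulmxBr -!scalemxAr scaleNr.
  exact.
Qed.

Lemma interval_constant_vector (I : set R) (F : R -> V3) x y : is_interval I ->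
  (forall t, I t -> is_derive t 1 F 0) -> I x -> I y -> F y = F x.
Proof.
move=> iI dF Ix Iy; suff H i : F y i 0 = F x i 0 by apply: cV3P; exact: H.
apply: (@interval_constant I (fun t => F t i 0) x y iI _ Ix Iy) => t It.
by have := is_derive_entry i (dF t It); rewrite mxE.
Qed.

Lemma primitive_exists (I : set R) (w : R -> R) t0 : open I -> is_interval I -> I t0 ->
  (forall t, I t -> {for t, continuous w}) ->
  exists2 P : R -> R, P t0 = 0 & forall t, I t -> is_derive t 1 P (w t).
Proof.
move=> oI iI It0 cw; pose I' := [set t | I (t + t0)].
have ct t : {for t, continuous (fun t => t + t0)}.
  by apply: cvgD; [exact: cvg_id|exact: cvg_cst].
have oI' : open I' by apply: open_comp => // t _; exact: ct.
have iI' : is_interval I'.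
  by move=> x y Ix Iy z /andP[xz zy]; apply: (iI _ _ Ix Iy); rewrite !lerD2r xz zy.
have I'0 : I' 0 by rewrite /I' /= add0r.
have cw' t : I' t -> {for t, continuous (fun t => w (t + t0))}.
  by move=> It; exact: (continuous_comp (ct t) (cw _ It)).
exists (fun t => oriented_integral (fun t => w (t + t0)) 0 (t - t0)).
  by rewrite subrr oriented_integral0.
move=> t It; have It' : I' (t - t0) by rewrite /I' /= subrK.
have dP := oriented_integral_derive oI' iI' I'0 cw' It'; rewrite subrK in dP.
have [dP1 dPE] := is_deriveP dP.
have ds : is_derive t 1 (fun t => t - t0) 1.
  by have := is_deriveB (is_derive_id t 1) (is_derive_cst t0 t 1); rewrite subr0; exact.
have := is_derive_curve ds dP1; rewrite dPE; exact.
Qed.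

Lemma unit_speed_algebra (n n1 d : V3) (k k' w sg : R) : 0 < w -> sg * sg = 1 ->
  mdot n n = 0 -> mdot n n1 = 0 -> mdot n1 n1 = w * w * (w * w) -> k = sg / w ->
  d = (- k) *: (k *: n1 + k' *: n) -> mdot d d = 1.
Proof.
move=> w0 sg1 nn nn1 n11 kE ->.
rewrite !(mdotZl, mdotZr, mdotDl, mdotDr) (mdotC n1 n) nn nn1 n11 kE.
have e : - (sg / w) * (- (sg / w) * (sg / w * (sg / w * (w * w * (w * w)) + k' * 0) +
    k' * (sg / w * 0 + k' * 0))) = (sg * sg) * (sg * sg).
  by field; rewrite gt_eqF.
by rewrite e sg1 mulr1.
Qed.

(** The new parameter is, up to sign, the integral of the fourth root of
    [mdot n' n']. With the scaling by [sg / w], [G] has unit speed and a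
    primitive of [n] composed with [th] has velocity [- G]. *)
Lemma pseudo_arclength (J : set R) (n : R -> V3) (t0 sg : R) : open J -> is_interval J -> J t0 ->
  smooth_on J n -> (forall t, J t -> mdot (n t) (n t) = 0 /\ 0 < mdot (derive1 n t) (derive1 n t)) ->
  sg * sg = 1 -> exists (w V th : R -> R) (I : set R),
  let G v := (sg / w (th v)) *: n (th v) in
  [/\ open_interval0 I,
      forall t, J t -> [/\ 0 < w t, I (V t), th (V t) = t, {for t, continuous V} & {for t, continuous w}],
      forall v, I v -> [/\ J (th v), V (th v) = v & is_derive v 1 th (- (sg / w (th v)))],
      smooth_on I G &
      exists G1 G2, null_curve I G G1 G2 /\ smooth_on I G2].
Proof.
move=> oJ iJ Jt0 sn Hn sg1.
have [sn1 dn] := smooth_derive1 oJ sn.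
pose r t := mdot (derive1 n t) (derive1 n t).
have r0 t : J t -> 0 < r t by move=> /Hn[].
(* In a parameter with th' = - sg / w the square of the speed of (sg / w) n is
   r / w ^ 4. *)
pose w t := Num.sqrt (Num.sqrt (r t)).
have w0 t : J t -> 0 < w t by move=> /r0 h; rewrite !sqrtr_gt0.
have w4 t : J t -> w t * w t * (w t * w t) = r t.
  by move=> /r0 /ltW h; rewrite -!expr2 !sqr_sqrtr// sqrtr_ge0.
have sr : smooth_on J r by move=> k; apply: class_C_mdot => //; exact: sn1.
have sw : smooth_on J w.
  move=> k; apply: class_C_sqrt => //; first by move=> t /r0 h; rewrite sqrtr_gt0.
  exact: class_C_sqrt.
have cw t : J t -> {for t, continuous w} by exact: sw 0%N t.
have [P P0 dP] := primitive_exists oJ iJ Jt0 cw.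
have [Q [oPJ iPJ QP dQ]] := increasing_inverse oJ iJ dP w0.
pose V t := - sg * P t; pose th v := Q (- sg * v).
pose I : set R := [set v | (P @` J) (- sg * v)].
have sg2 (x : R) : - sg * (- sg * x) = x by rewrite mulrA mulrNN sg1 mul1r.
have IJ v : I v -> exists2 t, J t & v = V t.
  by move=> [t Jt e]; exists t => //; rewrite /V e sg2.
have thV t : J t -> th (V t) = t by move=> Jt; rewrite /th /V sg2 QP.
have dth v : I v -> is_derive v 1 th (- (sg / w (th v))).
  move=> /IJ[t Jt ->]; rewrite thV//.
  have dQt := dQ t Jt; rewrite -(sg2 (P t)) in dQt.
  have := is_derive_comp (is_derive_scale (- sg) (is_derive_id (V t) (1 : R))) dQt.
  by rewrite !scaleE mulr1 mulNr; exact.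
have oI : open I.
  by apply: open_comp => // v _; apply: cvgM; [exact: cvg_cst|exact: cvg_id].
have iI : is_interval I.
  move=> x y Ix Iy z /andP[xz zy].
  have [s|s] := leP 0 sg.
    by apply: (iPJ _ _ Iy Ix); apply/andP; split; nra.
  by apply: (iPJ _ _ Ix Iy); apply/andP; split; nra.
have hI : open_interval0 I.
  by split => //; exists t0 => //; rewrite P0 mulr0.
have Jth v : I v -> J (th v) by move=> /IJ[t Jt ->]; rewrite thV.
pose k t := sg / w t.
have sk : smooth_on J k.
  move=> m; apply: class_CM => //; first exact: class_C_cst.
  by apply: class_C_inv => // t /w0 h; rewrite gt_eqF.
have sth : smooth_on I th.
  elim=> [|m IH]; first by move=> v Iv; exact: is_derive_continuous (dth v Iv).
  apply: (class_C_derive1 oI dth); apply: class_CN => //.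
  exact: (class_C_comp oI Jth IH (sk m)).
have sm : smooth_on J (fun t => k t *: n t) by move=> m; apply: class_CZ.
pose G v := k (th v) *: n (th v).
have sG : smooth_on I G by move=> m; exact: (class_C_comp oI Jth (sth m) (sm m)).
have [sG1 dG] := smooth_derive1 oI sG; have [sG2 dG1] := smooth_derive1 oI sG1.
exists w, V, th, I; split => //.
- move=> t Jt; split; [exact: w0|by exists t; rewrite // /V sg2|exact: thV| |exact: cw].
  exact: (is_derive_continuous (is_derive_scale (- sg) (dP t Jt))).
- by move=> v Iv; split; [exact: Jth|have [t Jt ->] := IJ v Iv; rewrite thV|exact: dth].
exists (derive1 G), (derive1 (derive1 G)); split; last exact: sG2.
move=> v Iv; split.
- exact: dG.
- exact: dG1.
- by rewrite /G mdotZl mdotZr (Hn _ (Jth v Iv)).1 !mulr0.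
have Jv := Jth v Iv; have dk : differentiable k (th v) := smooth_diff sk Jv.
have dnv := dn _ Jv.
have nn1 : mdot (n (th v)) (derive1 n (th v)) = 0.
  have := is_derive_locally_cst oJ Jv (fun t Jt => (Hn t Jt).1) (is_derive_mdot dnv dnv).
  by rewrite (mdotC (derive1 n _)); lra.
have D := is_derive_comp (dth v Iv) (is_derive_scaler (diff_is_derive dk) dnv).
have E := is_derive_unique (dG v Iv) D.
exact: (unit_speed_algebra (w0 _ Jv) sg1 (Hn _ Jv).1 nn1 (esym (w4 _ Jv)) erefl E).
Qed.

(** * The tangent developable in normal form *)

Lemma mulmx_continuous (M : 'M[R]_3) (b : V3) : continuous (fun x : V3 => M *m (x - b)).
Proof.
have cid : continuous (idfun : V3 -> V3) by move=> y; exact: cvg_id.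
have sid : smooth_on [set: V3] (idfun : V3 -> V3) by move=> k; exact: class_C_linear cid.
have cM x := smooth_mulmx M openT sid 0%N x Logic.I : {for x, continuous (fun x : V3 => M *m x)}.
by move=> x; exact: (continuous_comp (@continuous_subr _ b x) (cM (x - b))).
Qed.

Lemma within_cvg_comp (T T' Z : topologicalType) (psi : T -> T') (c : T' -> Z)
    (B : set T) (U : set T') x (z : Z) :
  {for x, continuous psi} -> (forall y, B y -> U (psi y)) ->
  c @ within U (nbhs (psi x)) --> z -> (c \o psi) @ within B (nbhs x) --> z.
Proof.
move=> cp BU cc A /cc nA; have {}nA : \forall y \near psi x, U y -> A (c y) by exact: nA.
have {}nA : \forall y \near x, U (psi y) -> A (c (psi y)) by exact: cp _ nA.
have H : \forall y \near x, B y -> A (c (psi y)) by apply: filterS nA => y h /BU; exact: h.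
exact: H.
Qed.

(** The sign of [s] is constant on the patch and orients the new parameter,
    as [exp u] is positive. *)
Definition side (s : R) : R := if 0 < s then 1 else - 1.

Lemma side_sqr s : side s * side s = 1.
Proof. by rewrite /side; case: ifP => _; ring. Qed.

Lemma side_ball (s0 s e : R) : e <= `|s0| -> ball s0 e s -> 0 < side s0 * s.
Proof.
rewrite -ball_normE /= ltr_distlC => es /andP[h1 h2].
rewrite /side; have [p|p] := ltP 0 s0.
  by rewrite gtr0_norm// in es; lra.
by rewrite ler0_norm// in es; lra.
Qed.

Lemma motion_algebra (A : 'M[R]_3) (y y0 g m : V3) (x k : R) :
  x *: (A *m (k *: m)) - (A *m y0 - A *m y) - A *m g =
  A *m (y + (x * k) *: m) - A *m (y0 + g).
Proof.
rewrite !mulmxDr -!scalemxAr scalerA; move: (A *m _) (A *m _) (A *m _) (A *m _) => a b c d.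
by apply: cV3P; rewrite !mxE; ring.
Qed.

(** In the parameter of [pseudo_arclength] the patch is the model surface up
    to a Lorentz motion: the integral of [G] is minus the edge, and the
    coordinate [s] is a multiple of [exp u]. *)
Lemma normal_parametrization (z0 : R2) e (Y n : R -> V3) (U : set V3) (c : V3 -> R2) :
  0 < e <= `|z0.1| ->
  (forall t, ball z0.2 e t -> [/\ is_derive t 1 Y (n t), mdot (n t) (n t) = 0 &
    0 < mdot (derive1 n t) (derive1 n t)]) ->
  smooth_on (ball z0.2 e) n ->
  [/\ U = [set Y z.2 + z.1 *: n z.2 | z in ball z0 e],
      forall z, ball z0 e z -> c (Y z.2 + z.1 *: n z.2) = z & {within U, continuous c}] ->
  exists (phi : V3 -> V3) (f : R -> R) (I : set R) (G0 : R -> V3) (W : set R2),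
    [/\ mink_isometry phi, open_interval0 I /\ smooth_on I f, unique_solution f I G0 &
        W `<=` setT `*` I /\ regular_parametrization W (surface_map G0) (phi @` U)].
Proof.
move=> /andP[e0 ez] HY sn [UE cU cc].
have oJ : open (ball z0.2 e) by exact: ball_open.
have Hn t : ball z0.2 e t -> mdot (n t) (n t) = 0 /\ 0 < mdot (derive1 n t) (derive1 n t).
  by move=> /HY[].
pose sg := side z0.1; have sg1 : sg * sg = 1 := side_sqr _.
have [w [V [th [I]]]] := pseudo_arclength oJ (@ball_interval z0.2 e) (ballxx z0.2 e0) sn Hn sg1.
set G := fun v => _; move=> [hI HJ HI sG [G1 [G2 [nc sG2]]]].
have [A [f [oA uA sf ncA uG]]] := normal_position hI nc sG2.
have [oI iI I0] := hI.
have sGA : smooth_on I (fun v => A *m G v) := smooth_mulmx A oI sG.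
pose k v := sg / w (th v).
(* [b] absorbs the base point of the edge and the constant term of the model. *)
pose b := - (A *m (Y (th 0) + G 0)).
pose phi x := A *m x + b.
have ck v : I v -> {for v, continuous k}.
  move=> Iv; have [Jv _ dth] := HI v Iv; have [wp _ _ _ cw] := HJ _ Jv.
  have cwt : {for v, continuous (fun v => w (th v))}.
    exact: (continuous_comp (is_derive_continuous dth) cw).
  by apply: cvgM; [exact: cvg_cst|apply: cvgV => //; rewrite gt_eqF].
have ointE v : I v -> oint (fun v => A *m G v) v = A *m Y (th 0) - A *m Y (th v).
  move=> Iv; pose F v := oint (fun v => A *m G v) v + A *m Y (th v).
  suff e1 : F v = F 0 by apply/eqP; rewrite eq_sym subr_eq -[_ + _]/(F v) e1 /F oint0 add0r.
  apply: (interval_constant_vector iI _ I0 Iv) => x Ix.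
  have [Jx _ dth] := HI x Ix; have [dY _ _] := HY _ Jx.
  have dAY := is_derive_mulmx A (is_derive_comp dth dY).
  have := is_derive_addR (oint_derive hI ncA Ix) dAY.
  by rewrite -scalemxAr /G -scalemxAr scaleNr subrr; exact.
have mapE q : I q.2 -> surface_map (fun v => A *m G v) q =
    phi (Y (th q.2) + (expR q.1 * k q.2) *: n (th q.2)).
  move=> Iv; rewrite /surface_map -/(oint (fun v => A *m G v) q.2) ointE// /phi /b.
  exact: motion_algebra.
pose W : set R2 := [set q | I q.2 /\ ball z0.1 e (expR q.1 * k q.2)].
have WI : W `<=` [set: R] `*` I by move=> q [].
have Wz q : W q -> ball z0 e (expR q.1 * k q.2, th q.2).
  by move=> [Iv bs]; split => //=; have [] := HI _ Iv.
have phiK x : invmx A *m (phi x - b) = x by rewrite /phi addrK mulKmx.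
(* Solving s = exp u * (sg / w t) and t = th v for (u, v). *)
pose inv_coord (z : R2) : R2 := (ln (sg * z.1 * w z.2), V z.2).
have invE q : W q -> inv_coord (expR q.1 * k q.2, th q.2) = q.
  move=> Wq; have [Iv _] := Wq; have [Jv Vth _] := HI _ Iv; have [wp _ _ _ _] := HJ _ Jv.
  rewrite /inv_coord /= Vth (_ : sg * _ * _ = (sg * sg) * expR q.1).
    by rewrite sg1 mul1r expRK; case: (q).
  by rewrite /k; field; rewrite gt_eqF.
have cinv z : ball z0 e z -> {for z, continuous inv_coord}.
  move=> [bs bt]; have [wp _ _ cV cw] := HJ _ bt.
  apply: continuous_at_pair; last exact: (continuous_comp (@snd_continuous z) cV).
  apply: (@continuous_comp _ _ _ (fun z : R2 => sg * z.1 * w z.2) (@ln R)); last first.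
    by apply: continuous_ln; rewrite mulr_gt0//; exact: side_ball ez bs.
  apply: cvgM; first by apply: cvgM; [exact: cvg_cst|exact: fst_continuous].
  exact: (continuous_comp (@snd_continuous z) cw).
exists phi, f, I, (fun v => A *m G v), W; split => //; first by exists A, b.
split => //; split.
- rewrite openE => q [Iv bs]; apply: filterI.
    by have := open_nbhs_nbhs (conj oI Iv); exact: (@snd_continuous q).
  have cs : {for q, continuous (fun q : R2 => expR q.1 * k q.2)}.
    apply: cvgM; first exact: (continuous_comp (@fst_continuous q) (@continuous_expR R q.1)).
    exact: (continuous_comp (@snd_continuous q) (ck _ Iv)).
  apply: cs; apply: open_nbhs_nbhs; split => //; exact: ball_open.
- by move=> m; apply: class_C_sub WI _; exact: surface_map_smooth hI ncA sGA m.
- apply/seteqP; split => [_ [q Wq <-]|_ [x Ux <-]].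
    have [Iv _] := Wq; rewrite mapE//; eexists; last by [].
    by rewrite UE; exists (expR q.1 * k q.2, th q.2) => //; exact: Wz.
  move: Ux; rewrite UE => -[z bz <-]; have [bs bt] := bz; have [wp IV thV _ _] := HJ _ bt.
  have sp : 0 < sg * z.1 := side_ball ez bs.
  have es : expR (ln (sg * z.1 * w z.2)) * k (V z.2) = z.1.
    have -> : expR (ln (sg * z.1 * w z.2)) = sg * z.1 * w z.2.
      by apply: lnK; rewrite posrE; exact: mulr_gt0.
    rewrite /k thV.
    have -> : sg * z.1 * w z.2 * (sg / w z.2) = (sg * sg) * z.1 by field; rewrite gt_eqF.
    by rewrite sg1 mul1r.
  exists (inv_coord z); first by split => //=; rewrite es.
  by rewrite mapE//= es thV.
- by move=> q Wq; exact: (surface_map_immersion hI ncA (WI q Wq)).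
exists (inv_coord \o (c \o (fun x => invmx A *m (x - b)))); split.
  by move=> q Wq; rewrite mapE/= ?phiK; last exact: (WI _ Wq).2; rewrite (cU _ (Wz q Wq)) invE.
apply/subspace_continuousP => _ [y Uy <-].
have [z bz yz] : exists2 z, ball z0 e z & Y z.2 + z.1 *: n z.2 = y.
  by move: Uy; rewrite UE => -[z bz <-]; exists z.
have cy : c y = z by rewrite -yz cU.
have ccy : c @ within U (nbhs y) --> z.
  by rewrite -cy; move/subspace_continuousP: cc => /(_ y Uy); exact.
pose psi (x : V3) := invmx A *m (x - b).
have H1 : (c \o psi) @ within (phi @` U) (nbhs (phi y)) --> z.
  apply: (@within_cvg_comp _ _ _ psi c (phi @` U) U); first exact: mulmx_continuous.
    by move=> _ [x Ux <-]; rewrite /psi phiK.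
  by rewrite /psi phiK.
have H2 : (inv_coord \o (c \o psi)) @ within (phi @` U) (nbhs (phi y)) --> inv_coord z.
  exact: (cvg_comp _ _ H1 (cinv z bz)).
have E : (inv_coord \o (c \o psi)) (phi y) = inv_coord z by rewrite /= /psi phiK cy.
by rewrite -E in H2; exact: H2.
Qed.

Lemma edge_case (S : set V3) (a a2 : V3 -> R) p : lightlike_surface S ->
  is_a1 S S (fun p => frame 1 (nhat S p)) a -> (forall p, S p -> a p != 0) ->
  is_a2 S S (fun p => frame (a p)^-1 (nhat S p)) a2 -> (forall p, S p -> a2 p != 0) -> S p ->
  exists (U : set V3) (phi : V3 -> V3) (f : R -> R) (I : set R) (G0 : R -> V3) (W : set R2),
    [/\ open_in S U /\ U p, mink_isometry phi, open_interval0 I /\ smooth_on I f,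
        unique_solution f I G0 &
        W `<=` setT `*` I /\ regular_parametrization W (surface_map G0) (phi @` U)].
Proof.
move=> lS Ha a0 H2 a20 Sp.
have [z0 [e [Y [n [U [c [e0 oU HY sn HU]]]]]]] := tangent_developable lS Ha a0 H2 a20 Sp.
have [phi [f [I [G0 [W [h1 h2 h3 h4]]]]]] := normal_parametrization e0 HY sn HU.
by exists U, phi, f, I, G0, W.
Qed.

End Calculus.

Theorem theorem4p2 (R : realType) :
  (forall S : set 'cV[R]_3,
     connected S -> lightlike_surface S -> constant_type S ->
     [\/ exists phi P, [/\ mink_isometry phi, lightlike_plane P &
                           phi @` S `<=` P],
         exists phi p, mink_isometry phi /\ phi @` S `<=` lightlike_cone p |
         forall p, S p ->
           exists (U : set 'cV[R]_3) (phi : 'cV[R]_3 -> 'cV[R]_3)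
                  (f : R -> R) (I : set R) (G0 : R -> 'cV[R]_3)
                  (W : set (R * R)),
             [/\ open_in S U /\ U p,
                 mink_isometry phi,
                 open_interval0 I /\ smooth_on I f,
                 unique_solution f I G0 &
                 W `<=` setT `*` I /\
                 regular_parametrization W (surface_map G0) (phi @` U)]]) /\
  (forall (f : R -> R) (I : set R),
     open_interval0 I -> smooth_on I f ->
     exists G0 : R -> 'cV[R]_3,
       unique_solution f I G0 /\
       forall u v, I v ->
         exists (W : set (R * R)) (S : set 'cV[R]_3),
           [/\ W (u, v), W `<=` setT `*` I,
               regular_parametrization W (surface_map G0) S,
               lightlike_surface S & non_conical S]).
Proof.
split; last by move=> f I hI sf; exact: prescribed_surface.
move=> S cS lS ct.
have [[p0 Sp0]|none] := pselect (exists p, S p); last first.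
  by apply: Or33 => p Sp; case: none; exists p.
case: ct => [a1z|[a1n ct]].
  apply: Or31; exists id, (null_plane (nhat S p0) p0); split; first exact: mink_isometry_id.
    by apply: null_plane_lightlike; have [] := nhatP lS Sp0.
  by rewrite image_id; exact: plane_case.
have [a Ha a0] := a1n _ _ (adapted0_unit lS).
have a1f := adapted1_inv_a1 lS Ha a0.
case: ct => [a2z|a2n].
  apply: Or32; exists id, (p0 - (a p0)^-1 *: nhat S p0); split; first exact: mink_isometry_id.
  by rewrite image_id; exact: cone_case.
have [a2 H2 a20] := a2n _ _ a1f.
by apply: Or33 => p Sp; exact: edge_case Ha a0 H2 a20 Sp.
Qed.
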